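(* Let $m\ge1$, $d\ge0$, $k=\mathbb{F}_q$ and $R=R_{2,2m+1}=k[[X,Y]]/(Y^2-X^{2m+1})$, with normalization $\widetilde{R}$. With $t:=q^{-s}$, $$\nu^R_{\widetilde{R}^d}(s)=\sum_{\mu\subseteq(m^d)}g^{(m^d)}_\mu(q)\,(q^dt)^{|\mu|}.$$
   Context: $\widetilde{R}\simeq k[[T]]$ with $X=T^2$, $Y=T^{2m+1}$. $\zeta^R_{\widetilde{R}^d}(s)=\sum_N|\widetilde{R}^d/N|^{-s}$ is the sum over finite-index $R$-submodules $N\subseteq\widetilde{R}^d$, $\zeta^{\widetilde{R}}_{\widetilde{R}^d}(s)$ is the same sum over finite-index $\widetilde{R}$-submodules, and $\nu^R_{\widetilde{R}^d}(s)=\zeta^R_{\widetilde{R}^d}(s)/\zeta^{\widetilde{R}}_{\widetilde{R}^d}(s)$. For a partition $\mu$: $|\mu|$ is its size, $\mu'$ its conjugate, $\mu\subseteq\lambda$ is containment of Young diagrams, and $(m^d)=(m,\dots,m)$ ($d$ parts). The skew Hall polynomial $g^\lambda_\mu(q)$ is the number of submodules of type $\mu$ in a fixed module of type $\lambda$ over a DVR $(V,\pi)$ with residue field $\mathbb{F}_q$ (type $\lambda$ means isomorphic to $\bigoplus_iV/\pi^{\lambda_i}V$). Explicitly, $$g^\lambda_\mu(q)=q^{\sum_{i\ge1}\mu'_i(\lambda'_i-\mu'_i)}\prod_{i\ge1}\genfrac{[}{]}{0pt}{}{\lambda'_i-\mu'_{i+1}}{\lambda'_i-\mu'_i}_{q^{-1}},\qquad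 \genfrac{[}{]}{0pt}{}{n}{k}_q=\frac{(q;q)_n}{(q;q)_k(q;q)_{n-k}},\qquad (a;q)_n=\prod_{j=0}^{n-1}(1-aq^j).$$ *)

(* Defs.v *)
From HB Require Import structures.
From mathcomp Require Import all_boot all_order all_algebra.
From mathcomp Require Import ring_quotient generic_quotient.
From mathcomp Require Import finmap.
From mathcomp Require Import complex.
From mathcomp Require Import mathcomp_extra boolp classical_sets cardinality.
From mathcomp Require Import reals topology normedtype sequences exp trigo.
From mathcomp Require Import summability.
From mathcomp Require Import ring.
Import numFieldNormedType.Exports.

Set Implicit Arguments.
Unset Strict Implicit.
Unset Printing Implicit Defensive.

Import Order.TTheory GRing.Theory Num.Theory.

Local Open Scope ring_scope.

Record fps (K : Type) := Fps { fcoef :> nat -> K }.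

HB.instance Definition _ (K : Type) := gen_eqMixin (fps K).
HB.instance Definition _ (K : Type) := gen_choiceMixin (fps K).

Section FpsRing.
Variable K : comNzRingType.
Implicit Types f g h : fps K.

Lemma fpsP f g : f =1 g -> f = g.
Proof. by case: f g => f [g] /= /funext ->. Qed.

Definition fps_zero : fps K := Fps (fun=> 0).
Definition fps_opp f : fps K := Fps (fun n => - f n).
Definition fps_add f g : fps K := Fps (fun n => f n + g n).
Definition fps_one : fps K := Fps (fun n => (n == 0%N)%:R).
Definition fps_mul f g : fps K := Fps (fun n => \sum_(i < n.+1) f i * g (n - i)%N).

Lemma fps_addA : associative fps_add.
Proof. by move=> f g h; apply: fpsP => n; exact: addrA. Qed.
Lemma fps_addC : commutative fps_add.
Proof. by move=> f g; apply: fpsP => n; exact: addrC. Qed.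
Lemma fps_add0 : left_id fps_zero fps_add.
Proof. by move=> f; apply: fpsP => n; exact: add0r. Qed.
Lemma fps_addN : left_inverse fps_zero fps_opp fps_add.
Proof. by move=> f; apply: fpsP => n; exact: addNr. Qed.

HB.instance Definition _ :=
  GRing.isZmodule.Build (fps K) fps_addA fps_addC fps_add0 fps_addN.

Let agree n f (p : {poly K}) := forall i, (i <= n)%N -> p`_i = f i.

Let trunc n f : {poly K} := \poly_(i < n.+1) f i.

Let truncP n f : agree n f (trunc n f).
Proof. by move=> i lein; rewrite coef_poly ltnS lein. Qed.

Let agree_mul n f g p q :
  agree n f p -> agree n g q -> agree n (fps_mul f g) (p * q).
Proof.
move=> fp gq i lein; rewrite coefM; apply: eq_bigr => j _.
have leji : (j <= i)%N by rewrite -ltnS.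
by rewrite fp ?gq // (leq_trans _ lein) // leq_subr.
Qed.

Let agree_one n : agree n fps_one 1.
Proof. by move=> i _; rewrite coef1. Qed.

Let agree_add n f g p q :
  agree n f p -> agree n g q -> agree n (fps_add f g) (p + q).
Proof. by move=> fp gq i lein; rewrite coefD fp ?gq. Qed.

Let agree_eq f g :
  (forall n, exists p, agree n f p /\ agree n g p) -> f = g.
Proof.
by move=> fg; apply: fpsP => n; have [p [fp gp]] := fg n; rewrite -fp ?gp.
Qed.

Lemma fps_mulA : associative fps_mul.
Proof.
move=> f g h; apply: agree_eq => n.
exists (trunc n f * trunc n g * trunc n h); split; first rewrite -mulrA.
  by do !apply: agree_mul; exact: truncP.
by do !apply: agree_mul; exact: truncP.
Qed.

Lemma fps_mulC : commutative fps_mul.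
Proof.
move=> f g; apply: agree_eq => n; exists (trunc n f * trunc n g).
split; last rewrite mulrC.
  by apply: agree_mul; exact: truncP.
by apply: agree_mul; exact: truncP.
Qed.

Lemma fps_mul1 : left_id fps_one fps_mul.
Proof.
move=> f; apply: agree_eq => n; exists (1 * trunc n f); split.
  by apply: agree_mul; [exact: agree_one|exact: truncP].
by rewrite mul1r; exact: truncP.
Qed.

Lemma fps_mulDl : left_distributive fps_mul fps_add.
Proof.
move=> f g h; apply: agree_eq => n.
exists ((trunc n f + trunc n g) * trunc n h); split; last rewrite mulrDl.
  by apply: agree_mul; [apply: agree_add; exact: truncP|exact: truncP].
by apply: agree_add; apply: agree_mul; exact: truncP.
Qed.

Lemma fps_one_neq0 : fps_one != fps_zero.
Proof.
by apply/eqP => /(congr1 (fun f : fps K => f 0%N)) /= /eqP; rewrite oner_eq0.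
Qed.

HB.instance Definition _ := GRing.Zmodule_isComNzRing.Build (fps K)
  fps_mulA fps_mulC fps_mul1 fps_mulDl fps_one_neq0.

Lemma fps_coef0 n : (0 : fps K) n = 0. Proof. by []. Qed.
Lemma fps_coef1 n : (1 : fps K) n = (n == 0%N)%:R. Proof. by []. Qed.
Lemma fps_coefD f g n : (f + g) n = f n + g n. Proof. by []. Qed.
Lemma fps_coefN f n : (- f) n = - f n. Proof. by []. Qed.
Lemma fps_coefM f g n : (f * g) n = \sum_(i < n.+1) f i * g (n - i)%N.
Proof. by []. Qed.

Definition fpsC (a : K) : fps K := Fps (fun n => if n == 0%N then a else 0).
Definition fpsX : fps K := Fps (fun n => (n == 1%N)%:R).

End FpsRing.
Arguments fpsX {K}.

Section FpsTheory.
Variable K : comNzRingType.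
Implicit Types f g : fps K.

Lemma fps_coef_sum I (r : seq I) (P : pred I) (F : I -> fps K) n :
  (\sum_(i <- r | P i) F i) n = \sum_(i <- r | P i) F i n.
Proof. exact: (big_morph (fun f : fps K => f n)). Qed.

Lemma fpsXM f n : (fpsX * f) n = if n is n'.+1 then f n' else 0.
Proof.
rewrite fps_coefM; case: n => [|n]; first by rewrite big_ord1 /= mul0r.
rewrite big_ord_recl /= mul0r add0r big_ord_recl /= mul1r subn1 big1 ?addr0 //.
by move=> i _; rewrite /= mul0r.
Qed.

Lemma fpsXnM f a n :
  (fpsX ^+ a * f) n = if (n < a)%N then 0 else f (n - a)%N.
Proof.
elim: a n => [|a IH] n; first by rewrite mul1r subn0.
by rewrite exprS -mulrA fpsXM; case: n => [|n] //; rewrite IH.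
Qed.

Lemma fpsXn a n : (fpsX ^+ a : fps K) n = (n == a)%:R.
Proof.
rewrite -[_ ^+ _]mulr1 fpsXnM fps_coef1 subn_eq0.
by case: ltngtP.
Qed.

Lemma fpsCM (a : K) f n : (fpsC a * f) n = a * f n.
Proof.
rewrite fps_coefM big_ord_recl /= subn0 big1 ?addr0 // => i _.
by rewrite /= mul0r.
Qed.

Lemma fpsCXM (a : K) f b n : (fpsC a ^+ b * f) n = a ^+ b * f n.
Proof. by elim: b n => [|b IH] n; rewrite ?mul1r // !exprS -!mulrA fpsCM IH. Qed.

End FpsTheory.

Section FpsField.
Variable k : fieldType.
Implicit Types f g a b : fps k.

Lemma fpsX_inj : injective ( *%R (fpsX : fps k)).
Proof.
move=> f g e; apply: fpsP => n.
by have := fpsXM f n.+1; rewrite e fpsXM.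
Qed.

Lemma fps_divX f : f 0%N = 0 -> exists g, f = fpsX * g.
Proof.
move=> f0; exists (Fps (fun n => f n.+1)); apply: fpsP => n.
by rewrite fpsXM; case: n.
Qed.

Lemma fps_inv f : f 0%N != 0 -> exists g, f * g = 1.
Proof.
move=> f0.
pose next (s : seq k) := (f 0%N)^-1 *
  ((nilp s)%:R - \sum_(i < size s) f i.+1 * s`_i).
pose s := fix s n := if n is n'.+1 then next (s n') :: s n' else [::].
have size_s n : size (s n) = n by elim: n => //= n ->.
pose g : fps k := Fps (fun n => next (s n)).
have nth_s n i : (i < n)%N -> (s n)`_i = g (n - i.+1)%N.
  by elim: n i => // n IH [|i] /=; [rewrite subn1|rewrite ltnS => /IH].
exists g; apply: fpsP => n; rewrite fps_coefM fps_coef1 big_ord_recl subn0.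
rewrite {1}/g /= /next mulrA divff // mul1r /nilp size_s.
rewrite -[RHS]addr0 -addrA; congr (_ + _); apply/eqP; rewrite addrC subr_eq0.
apply/eqP; apply: eq_bigr => i _; rewrite nth_s //.
Qed.

(* If a/b is a root of the monic polynomial P, then a/b lies in k[[T]]. *)
Lemma fps_integrally_closed a b (P : {poly fps k}) :
  b != 0 -> P \is monic ->
  \sum_(i < size P) P`_i * a ^+ i * b ^+ ((size P).-1 - i) = 0 ->
  exists f, a = f * b.
Proof.
move=> b0 Pm; have /existsNP[n bn] : ~ forall n, b n = 0.
  by move=> b00; case/eqP: b0; apply: fpsP => n; rewrite b00.
have : exists2 n, b n != 0 & True by exists n => //; apply/eqP.
move=> {b0 bn n} [n + _]; elim: n a b => [|n IH] a b bn eP.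
  by have [g bg] := fps_inv bn; exists (a * g); rewrite -mulrA [g * b]mulrC bg mulr1.
have [b0|b0] := eqVneq (b 0%N) 0; last first.
  by have [g bg] := fps_inv b0; exists (a * g); rewrite -mulrA [g * b]mulrC bg mulr1.
have [b' def_b] := fps_divX b0.
have sP : (0 < size P)%N by rewrite size_poly_gt0 monic_neq0.
have a0 : a 0%N = 0.
  move: eP; rewrite -(prednK sP) big_ord_recr /= subnn mulr1.
  rewrite -[P`_ _]/(lead_coef P) (monicP Pm) mul1r.
  rewrite (eq_bigr (fun i : 'I__ => fpsX * (P`_i * a ^+ i *
     b ^+ ((size P).-1 - i).-1 * b'))) => [|i _]; last first.
    rewrite -{1}(@prednK ((size P).-1 - i)) ?subn_gt0 // exprSr.
    by rewrite {2}def_b; ring.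
  rewrite -mulr_sumr => /(congr1 (fun h : fps k => h 0%N)).
  rewrite fps_coefD fpsXM add0r fps_coef0 => /eqP.
  have -> j : (a ^+ j) 0%N = a 0%N ^+ j.
    by elim: j => // j IHj; rewrite !exprS fps_coefM big_ord1 IHj.
  by rewrite expf_eq0 => /andP[_ /eqP].
have [a' def_a] := fps_divX a0.
have [||f def_f] := IH a' b'.
- by move: bn; rewrite def_b fpsXM.
- have : fpsX ^+ (size P).-1 * (\sum_(i < size P) P`_i * a' ^+ i *
      b' ^+ ((size P).-1 - i)) = 0.
    rewrite -[RHS]eP mulr_sumr; apply: eq_bigr => i _.
    have lei : (i <= (size P).-1)%N by rewrite -ltnS prednK.
    rewrite def_a def_b !exprMn -[in fpsX ^+ _](subnKC lei) exprD; ring.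
  elim: (size P).-1 {+}(\sum_(i < _) _) => [|j IHj] S; first by rewrite mul1r.
  by rewrite exprS -mulrA => e; apply/IHj/fpsX_inj; rewrite e mulr0.
by exists f; rewrite def_a def_b def_f; ring.
Qed.

End FpsField.

Section Cusp.
Variables (k : fieldType) (m : nat).

(* k[[X,Y]] is k[[X]][[Y]]: the coefficient of X^i Y^j in F is F j i. *)
Definition cuspX : fps (fps k) := fpsC fpsX.
Definition cuspY : fps (fps k) := fpsX.
Definition cusp_eq : fps (fps k) := cuspY ^+ 2 - cuspX ^+ (2 * m).+1.

Definition cusp_ideal : {pred fps (fps k)} :=
  fun F => `[< exists G, F = G * cusp_eq >].

Lemma cusp_eq00 : cusp_eq 0%N 0%N = 0.
Proof.
rewrite /cusp_eq expr2 exprS !(fps_coefD, fps_coefN, fps_coefM, big_ord1) /=.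
by rewrite !mul0r subr0.
Qed.

Lemma cusp_ideal_closed : idealr_closed cusp_ideal.
Proof.
split; first by apply/asboolP; exists 0; rewrite mul0r.
  apply/asboolP => -[G] /(congr1 (fun F : fps (fps k) => F 0%N 0%N)).
  rewrite !(fps_coefM, big_ord1) cusp_eq00 mulr0 !fps_coef1 /= => /eqP.
  by rewrite oner_eq0.
move=> a _ _ /asboolP[G ->] /asboolP[H ->].
by apply/asboolP; exists (a * G + H); rewrite mulrDl mulrA.
Qed.

HB.instance Definition _ := isProperIdeal.Build (fps (fps k)) cusp_ideal
  (idealr_closed_nontrivial cusp_ideal_closed).
HB.instance Definition _ := GRing.isZmodClosed.Build (fps (fps k)) cusp_ideal
  (idealr_closedB cusp_ideal_closed).

Definition cusp := {ideal_quot cusp_ideal}.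
HB.instance Definition _ := GRing.ComNzRing.on cusp.

(* The substitution F(X,Y) |-> F(T^2, T^(2m+1)). *)
Definition cusp_subst (F : fps (fps k)) : fps k :=
  Fps (fun n => \sum_(j < n.+1) \sum_(i < n.+1 | (2 * i + (2 * m).+1 * j == n)%N)
                  F j i).

Definition cusp_norm (r : cusp) : fps k := cusp_subst (repr r).

Let agree2 n (F : fps (fps k)) (P : {poly {poly k}}) :=
  forall i j, (i <= n)%N -> (j <= n)%N -> P`_j`_i = F j i.

Let ev (P : {poly {poly k}}) : {poly k} :=
  (map_poly (comp_poly 'X^2) P).['X^((2 * m).+1)].

Let evM P Q : ev (P * Q) = ev P * ev Q.
Proof. by rewrite /ev rmorphM /= hornerM. Qed.

Let evE P n F : agree2 n F P -> (ev P)`_n = cusp_subst F n.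
Proof.
move=> FP; rewrite /ev.
have -> : map_poly (comp_poly 'X^2) P =
   \poly_(j < maxn n.+1 (size P)) (P`_j \Po 'X^2).
  apply/polyP => j; rewrite coef_map coef_poly; case: ltnP => // h /=.
  rewrite nth_default ?comp_poly0 //.
  by apply: leq_trans h; rewrite leq_maxr.
rewrite horner_poly coef_sum /=.
rewrite (big_ord_widen_cond (maxn n.+1 (size P)) xpredT
  (fun j => \sum_(i < n.+1 | (2 * i + (2 * m).+1 * j == n)%N) F j i)) ?leq_maxl //.
rewrite big_mkcond /= [RHS]big_mkcond /=; apply: eq_bigr => j _ /=.
rewrite -exprM coefMXn comp_polyE coef_sum.
case: (ltnP n _) => [lt|le].
  case: ifP => // _; rewrite big_pred0 // => i; apply/negbTE/eqP => e.
  by move: lt; rewrite -{1}e ltnNge leq_addl.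
have ltj : (j < n.+1)%N.
  by rewrite ltnS (leq_trans _ le) // -{1}(mul1n j) leq_mul2r orbT.
rewrite ltj.
transitivity (\sum_(i < maxn n.+1 (size P`_j))
   (P`_j)`_i * (2 * i + (2 * m).+1 * j == n)%N%:R).
  rewrite (big_ord_widen (maxn n.+1 (size P`_j))
    (fun i => ((P`_j)`_i *: 'X^2 ^+ i)`_(n - (2 * m).+1 * j))) ?leq_maxr //.
  rewrite big_mkcond; apply: eq_bigr => i _; case: ltnP => [_|h]; last first.
    by rewrite nth_default // mul0r.
  rewrite coefZ -exprM coefXn; congr (_ * (nat_of_bool _)%:R).
  by rewrite -(eqn_add2r ((2 * m).+1 * j)) subnK // eq_sym.
rewrite [RHS](big_ord_widen_cond (maxn n.+1 (size P`_j))
  (fun i => 2 * i + (2 * m).+1 * j == n)%N (fun i => F j i)) ?leq_maxl //.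
rewrite [RHS]big_mkcond; apply: eq_bigr => i _ /=.
case: eqP => [e|_]; last by rewrite mulr0.
have lei : (i <= n)%N by rewrite -[leqRHS]e (leq_trans _ (leq_addr _ _)) // leq_pmull.
by rewrite ltnS lei mulr1 FP.
Qed.

Let trunc2 n (F : fps (fps k)) : {poly {poly k}} :=
  \poly_(j < n.+1) \poly_(i < n.+1) F j i.

Let trunc2P n F : agree2 n F (trunc2 n F).
Proof. by move=> i j lei lej; rewrite !coef_poly !ltnS lej coef_poly ltnS lei. Qed.

Let agree2_mul n F G P Q :
  agree2 n F P -> agree2 n G Q -> agree2 n (F * G) (P * Q).
Proof.
move=> FP GQ i j lei lej; rewrite coefM fps_coefM.
rewrite coef_sum fps_coef_sum; apply: eq_bigr => a _.
rewrite coefM fps_coefM; apply: eq_bigr => b _.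
have lea : (a <= j)%N by rewrite -ltnS.
have leb : (b <= i)%N by rewrite -ltnS.
by rewrite FP ?GQ // ?(leq_trans lea) ?(leq_trans leb) //
   (leq_trans (leq_subr _ _)).
Qed.

Let agree2W n n' F P : (n' <= n)%N -> agree2 n F P -> agree2 n' F P.
Proof. by move=> le FP i j li lj; rewrite FP // (leq_trans _ le). Qed.

Lemma cusp_substM F G : cusp_subst (F * G) = cusp_subst F * cusp_subst G.
Proof.
apply: fpsP => n.
rewrite -(evE (agree2_mul (@trunc2P n F) (@trunc2P n G))) evM coefM fps_coefM.
apply: eq_bigr => i _; congr (_ * _); apply: evE.
  by apply: agree2W (@trunc2P n F); rewrite -ltnS.
by apply: agree2W (@trunc2P n G); rewrite leq_subr.
Qed.

Lemma cusp_substD F G : cusp_subst (F + G) = cusp_subst F + cusp_subst G.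
Proof.
apply: fpsP => n; rewrite [RHS]fps_coefD /= -big_split /=.
by apply: eq_bigr => j _; rewrite -big_split.
Qed.

Lemma cusp_subst_agree F (Q : {poly k}) :
  (forall n, exists2 P, agree2 n F P & ev P = Q) ->
  forall n, cusp_subst F n = Q`_n.
Proof. by move=> H n; have [P FP <-] := H n; rewrite (evE FP). Qed.

Lemma cusp_subst1 : cusp_subst 1 = 1.
Proof.
apply: fpsP => n; rewrite (@cusp_subst_agree _ 1); first by rewrite coef1.
move=> {}n; exists 1; last by rewrite /ev rmorph1 hornerC.
by move=> i j _ _; rewrite coef1 fps_coef1; case: (j == 0%N); rewrite ?coef1 ?coef0.
Qed.

Lemma cusp_substC (a : fps k) n :
  cusp_subst (fpsC a) n = if odd n then 0 else a n./2.
Proof.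
rewrite /= big_ord_recl /= [X in _ + X]big1 ?addr0 => [|j _]; last first.
  by rewrite big1 // => i _.
case: ifP => [on|/negbT en].
  rewrite big_pred0 // => i; apply/negbTE/eqP => e.
  by move: on; rewrite -e muln0 addn0 mul2n odd_double.
have ltn : (n./2 < n.+1)%N by rewrite ltnS leq_half_double leqW // -addnn leq_addr.
rewrite (big_pred1 (Ordinal ltn)) // => i /=.
rewrite muln0 addn0 -(inj_eq val_inj) /= mul2n.
by apply/eqP/eqP => [e|->]; [rewrite -[in RHS]e doubleK|rewrite even_halfK].
Qed.

Lemma cusp_substY : cusp_subst cuspY = fpsX ^+ (2 * m).+1.
Proof.
apply: fpsP => n; rewrite (@cusp_subst_agree _ 'X^((2 * m).+1)).
  by rewrite coefXn fpsXn.
move=> {}n; exists 'X; last by rewrite /ev map_polyX hornerX.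
by move=> i j _ _; rewrite coefX /=; case: (j == 1%N); rewrite ?coef1 ?coef0.
Qed.

Lemma cusp_subst_is_zmod_morphism : zmod_morphism cusp_subst.
Proof.
move=> F G; apply: fpsP => n; rewrite [RHS]fps_coefD fps_coefN /= -sumrB /=.
by apply: eq_bigr => j _; rewrite -sumrB.
Qed.
HB.instance Definition _ := GRing.isZmodMorphism.Build _ _ cusp_subst
  cusp_subst_is_zmod_morphism.
HB.instance Definition _ := GRing.isMonoidMorphism.Build _ _ cusp_subst
  (cusp_subst1, cusp_substM).

Lemma cusp_substX : cusp_subst cuspX = fpsX ^+ 2.
Proof.
apply: fpsP => n; rewrite cusp_substC fpsXn /=.
by case: n => [|[|[|[|n]]]] //=; case: ifP.
Qed.

Lemma cusp_subst_eq : cusp_subst cusp_eq = 0.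
Proof.
by rewrite rmorphB !rmorphXn /= cusp_substX cusp_substY -!exprM mulnC subrr.
Qed.

Let term (F : fps (fps k)) b j n : k :=
  (fpsX ^+ ((2 * m).+1 * j) * F (b + 2 * j)%N) n.

Let term0 F b n : term F b 0 n = F b n.
Proof. by rewrite /term !muln0 mul1r addn0. Qed.

Let termS F b j n : term F b j.+1 n =
  if (n < (2 * m).+1)%N then 0 else term F b.+2 j (n - (2 * m).+1).
Proof.
rewrite /term -fpsXnM mulrA -exprD -mulnS.
by have -> : (b + 2 * j.+1 = b.+2 + 2 * j)%N by rewrite mulnS addnCA addnA.
Qed.

Let term_small F b j n : (n < j)%N -> term F b j n = 0.
Proof.
by move=> lt; rewrite /term fpsXnM ifT // (leq_trans lt) // leq_pmull.
Qed.

Let rem (F : fps (fps k)) b : fps k := Fps (fun n => \sum_(j < n.+1) term F b j n).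

Let remE F b : rem F b = F b + fpsX ^+ (2 * m).+1 * rem F b.+2.
Proof.
apply: fpsP => n; rewrite fps_coefD fpsXnM /= big_ord_recl term0; congr (_ + _).
transitivity (\sum_(j < n) (if (n < (2 * m).+1)%N then 0
                              else term F b.+2 j (n - (2 * m).+1))).
  by apply: eq_bigr => j _; exact: termS.
case: ltnP => le; first by rewrite big1.
rewrite [RHS](big_ord_widen n (term F b.+2 ^~ (n - (2 * m).+1)%N)); last first.
  by rewrite ltn_subrL (leq_trans _ le).
rewrite [RHS]big_mkcond; apply: eq_bigr => j _; case: ifP => // /negbT.
by rewrite -leqNgt => /term_small ->.
Qed.

Lemma cusp_divE F : exists G a b, F = G * cusp_eq + fpsC a + fpsC b * cuspY.
Proof.
exists (Fps (fun i => rem F i.+2)), (rem F 0), (rem F 1).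
apply: fpsP => i; rewrite !fps_coefD mulrBr fps_coefD fps_coefN.
rewrite [_ * cuspX ^+ _]mulrC [_ * cuspY ^+ _]mulrC fpsXnM fpsCXM fpsCM /=.
case: i => [|[|i]] /=.
- by rewrite mulr0 addr0 add0r (remE F 0) addrC addrK.
- by rewrite mulr1 addr0 add0r (remE F 1) addrC addrK.
by rewrite mulr0 !addr0 subn2 /= (remE F i.+2) addrK.
Qed.

Lemma fps_parity (f : fps k) : exists a b,
  f = cusp_subst (fpsC a) + fpsX * cusp_subst (fpsC b).
Proof.
exists (Fps (fun n => f n.*2)), (Fps (fun n => f n.*2.+1)).
apply: fpsP => n; rewrite fps_coefD fpsXM cusp_substC.
case: n => [|n]; first by rewrite addr0.
rewrite cusp_substC /=; case: (boolP (odd n)) => on /=.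
  by rewrite addr0 odd_uphalfK.
by rewrite add0r even_halfK.
Qed.

Lemma cusp_subst_ker F : cusp_subst F = 0 -> F \in cusp_ideal.
Proof.
have [G [a [b ->]]] := cusp_divE F.
rewrite 2!rmorphD !rmorphM /= cusp_subst_eq mulr0 add0r cusp_substY => e.
have coef n : cusp_subst (fpsC a) n +
    (if (n < (2 * m).+1)%N then 0 else cusp_subst (fpsC b) (n - (2 * m).+1)%N) = 0.
  by rewrite -fpsXnM [_ * cusp_subst _]mulrC -fps_coefD e.
have b0 : fpsC b = 0.
  apply: fpsP => -[|//] /=; apply: fpsP => n /=.
  have := coef (n.*2 + (2 * m).+1)%N.
  rewrite ltnNge leq_addl addnK !cusp_substC oddD odd_double /= mul2n odd_double.
  by rewrite add0r doubleK.
have a0 : fpsC a = 0.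
  apply: fpsP => -[|//] /=; apply: fpsP => n /=.
  have := coef n.*2; rewrite b0 rmorph0 if_same addr0 cusp_substC odd_double.
  by rewrite doubleK.
by apply/asboolP; exists G; rewrite a0 b0 mul0r !addr0.
Qed.

Lemma cusp_normE F : cusp_norm (\pi F)%qT = cusp_subst F.
Proof.
apply/eqP; rewrite -subr_eq0 -rmorphB /=; apply/eqP.
have : repr (\pi_cusp F)%qT - F \in cusp_ideal by rewrite Quotient.idealrBE reprK.
by case/asboolP => G ->; rewrite rmorphM /= cusp_subst_eq mulr0.
Qed.

Lemma cusp_norm_is_zmod_morphism : zmod_morphism cusp_norm.
Proof.
elim/quotW => F; elim/quotW => G.
by rewrite -rmorphB !cusp_normE rmorphB.
Qed.
Lemma cusp_norm_is_monoid_morphism : monoid_morphism cusp_norm.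
Proof.
split; first by rewrite -(rmorph1 \pi_cusp%qT) cusp_normE rmorph1.
by elim/quotW => F; elim/quotW => G; rewrite -rmorphM !cusp_normE rmorphM.
Qed.
HB.instance Definition _ := GRing.isZmodMorphism.Build _ _ cusp_norm
  cusp_norm_is_zmod_morphism.
HB.instance Definition _ := GRing.isMonoidMorphism.Build _ _ cusp_norm
  cusp_norm_is_monoid_morphism.

Lemma cusp_norm_inj : injective cusp_norm.
Proof.
move=> x y /eqP; rewrite -subr_eq0 -rmorphB; set z := x - y => /eqP z0.
apply/eqP; rewrite -subr_eq0 -/z -[z]reprK.
have := cusp_subst_ker z0; rewrite -{1}[repr z]subr0 Quotient.idealrBE => /eqP ->.
by rewrite rmorph0.
Qed.

(* k[[T]] is integral over R and has the same total ring of fractions. *)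
Lemma cusp_norm_integral (f : fps k) :
  exists2 P : {poly cusp}, P \is monic & root (map_poly cusp_norm P) f.
Proof.
have [a [b ->]] := fps_parity f.
pose pi : fps (fps k) -> cusp := \pi_cusp%qT.
pose c0 : cusp := \pi_cusp%qT (fpsC a ^+ 2 - cuspX * fpsC b ^+ 2).
pose c1 : cusp := \pi_cusp%qT (- (fpsC a *+ 2)).
exists ('X^2 + (c1 *: 'X + c0%:P)).
  rewrite monicE lead_coefDl ?lead_coefXn // size_polyXn.
  by rewrite ltnS (leq_trans (size_polyD _ _)) // geq_max size_polyC
    (leq_trans (size_scale_leq _ _)) ?size_polyX // (leq_trans (leq_b1 _)).
rewrite /root !rmorphD /= map_polyZ /= map_polyXn map_polyX map_polyC /=.
rewrite !hornerE /= !cusp_normE rmorphB rmorphN rmorphMn !(rmorphXn, rmorphM) /=.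
rewrite cusp_substX; apply/eqP.
set A := cusp_subst _; set B := cusp_subst _.
by ring.
Qed.

Lemma cusp_norm_fraction (f : fps k) :
  exists a b : cusp, GRing.lreg b /\ cusp_norm b * f = cusp_norm a.
Proof.
have [a [b ->]] := fps_parity f.
exists (\pi_cusp (cuspX ^+ m * fpsC a + cuspY * fpsC b))%qT.
exists (\pi_cusp (cuspX ^+ m))%qT; split.
  move=> x y /(congr1 cusp_norm); rewrite !rmorphM /= cusp_normE rmorphXn /=.
  rewrite cusp_substX -exprM => e; apply: cusp_norm_inj; apply: fpsP => n.
  have := fpsXnM (cusp_norm x) (2 * m) (n + 2 * m).
  by rewrite e fpsXnM ltnNge leq_addl addnK.
rewrite !cusp_normE rmorphD !rmorphM !rmorphXn /= cusp_substX cusp_substY.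
by rewrite -exprM mulrDr mulrA -exprSr.
Qed.

End Cusp.

Local Open Scope classical_set_scope.

Definition restr_scalars (A B : pzRingType) (h : {rmorphism A -> B})
  (V : lmodType B) : Type := V.

Section Restriction.
Variables (A B : pzRingType) (h : {rmorphism A -> B}) (V : lmodType B).
Local Notation restr_scalars := (restr_scalars h V).

HB.instance Definition _ := GRing.Zmodule.copy restr_scalars V.

Let scale (a : A) (v : restr_scalars) : restr_scalars := h a *: (v : V).

Let scaleA a b v : scale a (scale b v) = scale (a * b) v.
Proof. by rewrite /scale scalerA rmorphM. Qed.
Let scale1 : left_id 1 scale.
Proof. by move=> v; rewrite /scale rmorph1 scale1r. Qed.
Let scaleDr : right_distributive scale +%R.
Proof. by move=> a u v; exact: scalerDr. Qed.
Let scaleDl v : {morph scale^~ v : a b / a + b}.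
Proof. by move=> a b; rewrite /scale rmorphD scalerDl. Qed.

HB.instance Definition _ := GRing.Zmodule_isLmodule.Build A restr_scalars
  scaleA scale1 scaleDr scaleDl.

End Restriction.

Section Zeta.
Variable R : realType.

Definition complex_exp (z : R[i]) : R[i] :=
  (expR (complex.Re z))%:C%C * (cos (complex.Im z) +i* sin (complex.Im z))%C.

(* n^z for n > 0. *)
Definition natpow (n : nat) (z : R[i]) : R[i] := complex_exp (z * (ln n%:R)%:C%C).

Definition add_cosets (M : zmodType) (N : set M) : set (set M) :=
  [set [set x + y | y in N] | x in [set: M]].

Definition module_index (M : zmodType) (N : set M) : nat :=
  #|` fset_set (add_cosets N)|.

Definition finite_index_submods (A : pzRingType) (M : lmodType A) : set (set M) :=
  [set N : set M | submod_closed (mem N) /\ finite_set (add_cosets N)].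
Arguments finite_index_submods {A} M.

Definition zeta_term (A : pzRingType) (M : lmodType A) (s : R[i])
  (N : finite_index_submods M) : R[i]^o := natpow (module_index (val N)) (- s).

(* The sum is unconditional: the limit is along finite sets of submodules. *)
Definition zeta (A : pzRingType) (M : lmodType A) (s : R[i]) : R[i] :=
  summability.sum (@zeta_term A M s).

Definition zeta_converges (A : pzRingType) (M : lmodType A) (s : R[i]) : Prop :=
  cvg (partial_sum (@zeta_term A M s) @ totally).

End Zeta.

Section CuspZeta.
Variables (R : realType) (k : fieldType) (m d : nat).

(* cusp_norm identifies the normalization of cusp k m with k[[T]]: see
   cusp_norm_inj, cusp_norm_integral, cusp_norm_fraction and
   fps_integrally_closed. *)
Definition Rtilde_d : lmodType (fps k) := 'rV[fps k]_d.
Definition Rtilde_d_cusp : lmodType (cusp k m) :=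
  restr_scalars (@cusp_norm k m : {rmorphism _ -> _}) Rtilde_d.

Definition nu_cusp (s : R[i]) : R[i] := zeta Rtilde_d_cusp s / zeta Rtilde_d s.

End CuspZeta.

Section SkewHall.
Variables (V : idomainType) (pi : V).

Definition dvr_with_residue_field (k : fieldType) : Prop :=
  [/\ pi != 0,
      forall x : V, x != 0 ->
        exists n u, u \is a GRing.unit /\ x = u * pi ^+ n
    & exists red : {rmorphism V -> k},
        (forall c, exists x, red x = c) /\
        (forall x, red x = 0 <-> exists y, x = y * pi)].

Variable M : lmodType V.

(* f induces an isomorphism from the direct sum of the V/(pi^mu_i) onto N;
   zero entries of mu give zero summands, so mu may be padded with zeros. *)
Definition has_type (N : set M) (mu : seq nat) : Prop :=
  exists f : {linear 'rV[V]_(size mu) -> M},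
    range f = N /\
    forall x, f x = 0 <-> forall i, exists y, x 0 i = y * pi ^+ nth 0%N mu i.

Definition skew_hall (mu : seq nat) : nat :=
  #|` fset_set [set N : set M | submod_closed (mem N) /\ has_type N mu]|.

End SkewHall.

(* Main.v *)
Require Import Defs.
From HB Require Import structures.
From mathcomp Require Import all_boot all_order all_fingroup all_algebra.
From mathcomp Require Import ring_quotient generic_quotient.
From mathcomp Require Import finmap complex zify ring lra.
From mathcomp Require Import boolp classical_sets reals cardinality summability.
From mathcomp Require Import topology normedtype sequences exp trigo.
Set Implicit Arguments.
Unset Strict Implicit.
Unset Printing Implicit Defensive.
Import Order.TTheory GRing.Theory Num.Theory numFieldNormedType.Exports.
Local Open Scope classical_set_scope.
Local Open Scope ring_scope.

(** Write A = k[[X]] and O = k[[T]] with X = T^2, so that O = A + T A, while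
    R acts on O through A + T^(2m+1) A.

    An R-submodule N of finite index in O^d generates an O-lattice O N. This
    lattice is free by the theorem on elementary divisors ([smith_form]), and
    a basis of it carries N to some N0 with O N0 = O^d without changing the
    relative index ([spanning_transport]). Hence zeta^R is zeta^O times the
    finite sum of t^e over the N0 with O N0 = O^d and index q^e
    ([cusp_card]).

    Such an N0 contains T^(2m) O^d, because T^(2m) O lies in R
    ([conductor]). By Nakayama's lemma N0 projects onto the even part of
    O^d = A^d + T A^d ([Ospan_covers]), so it is the graph of an A-linear map
    A^d -> A^d / K, where X^m A^d <= K <= A^d and K is the odd slice of N0;
    every such map occurs. A map is a choice of d classes modulo K, so each K
    of index q^j accounts for q^(d j) modules N0, all of index q^j
    ([spanning_card]). This gives the factor (q^d t)^j.

    It remains to see that the K of cotype mu in A^d are as many as the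
    submodules of type mu in M, although V is any discrete valuation ring with
    residue field k. The submodules of type mu in M = (V / pi^m)^d come from
    the lattices of cotype m - mu in V^d ([ftype_cotype]). The lattices of
    cotype a form one orbit of GL_d (V / pi^m), and the stabiliser of one of
    them is cut out by the conditions that the (i, j) entry is divisible by
    pi^(a_j - a_i). In terms of pi-adic digits both sets of matrices are the
    same for all V, hence so is the size of the orbit ([cotype_count]), and
    transposition identifies the stabilisers for a and m - a ([cotype_card]).

    On the analytic side, intersecting a lattice with the last coordinates
    gives the recursion c_(d+1) (n) = sum_(j <= n) q^j c_d (j) for the number
    of O-lattices of index q^n ([lattice_card]), so zeta^O is the product of
    the 1 / (1 - q^i t) for i < d. For d > 0 it converges absolutely
    and does not vanish when q^(d-1) |t| < 1 ([gf_lattice_cvg]). Sums over all submodules are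
    grouped by index ([zeta_cvg]), which is legitimate by absolute
    convergence. *)

(** * Counting *)

(** An enumeration rather than a number, so that one statement says both that
    S is finite and how many elements it has. *)
Definition has_card (T : eqType) (S : set T) (n : nat) : Prop :=
  exists2 s : seq T, uniq s /\ (forall x, S x <-> x \in s) & size s = n.

Section HasCard.
Implicit Types T : eqType.

Lemma has_card_inj T (S : set T) n p : has_card S n -> has_card S p -> n = p.
Proof.
move=> [s [us sS] <-] [s' [us' sS'] <-]; apply/perm_size/uniq_perm => // x.
by apply/idP/idP => [/sS/sS'|/sS'/sS].
Qed.

Lemma has_card_eq T (S S' : set T) n :
  (forall x, S x <-> S' x) -> has_card S n -> has_card S' n.
Proof.
move=> SS' [s [us sS] sn]; exists s => //; split=> // x.
by rewrite -SS'.
Qed.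

Lemma has_card_bij T T' (f : T -> T') (S : set T) (S' : set T') n :
  (forall x y, S x -> S y -> f x = f y -> x = y) ->
  (forall y, S' y <-> exists2 x, S x & f x = y) ->
  has_card S n -> has_card S' n.
Proof.
move=> f_inj fS [s [us sS] <-]; exists (map f s); last by rewrite size_map.
split; first by rewrite map_inj_in_uniq // => x y /sS Sx /sS; exact: f_inj.
move=> y; rewrite fS; split=> [[x /sS sx <-]|/mapP[x sx ->]]; first exact: map_f.
by exists x => //; apply/sS.
Qed.

Lemma has_card_bij_inv T T' (f : T -> T') (S : set T) (S' : set T') n :
  (forall x y, S x -> S y -> f x = f y -> x = y) ->
  (forall y, S' y <-> exists2 x, S x & f x = y) ->
  has_card S' n -> has_card S n.
Proof.
move=> f_inj fS S'n; have [[x0 Sx0]|S0] := pselect (exists x, S x); last first.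
  case: S'n => s [us sS'] <-; case: s us sS' => [|y s] us sS'.
    by exists [::] => //; split=> // x; split=> // Sx; case: S0; exists x.
  by have /sS'/fS[x Sx _] := mem_head y s; case: S0; exists x.
have /choice[g gP] y : exists x, S' y -> S x /\ f x = y.
  have [/fS[x Sx xy]|nS] := pselect (S' y); first by exists x.
  by exists x0.
apply: (has_card_bij (f := g) _ _ S'n).
  by move=> y y' /gP[_ e] /gP[_ e'] gyy'; rewrite -e -e' gyy'.
move=> x; split=> [Sx|[y /gP[Sx _] <-] //].
have S'x : S' (f x) by apply/fS; exists x.
by have [? ?] := gP _ S'x; exists (f x) => //; apply: f_inj.
Qed.

Lemma has_card_image T T' (f : T -> T') (S : set T) n :
  has_card S n -> exists p, has_card (f @` S) p.
Proof.
move=> [s [us sS] _]; exists (size (undup (map f s))).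
exists (undup (map f s)) => //; split; first exact: undup_uniq.
move=> y; rewrite mem_undup; split=> [[x /sS sx <-]|/mapP[x sx ->]].
  exact: map_f.
by exists x => //; apply/sS.
Qed.

Lemma has_card_sub T (S S' : set T) n :
  S' `<=` S -> has_card S n -> exists p, has_card S' p.
Proof.
move=> SS' [s [us sS] _]; exists (size [seq x <- s | `[< S' x >]]).
exists [seq x <- s | `[< S' x >]] => //; split; first exact: filter_uniq.
move=> x; rewrite mem_filter; split=> [Sx|/andP[/asboolP //]].
by rewrite (introT (asboolP _) Sx); apply/sS/SS'.
Qed.

Lemma has_card_pred (T : finType) (P : pred T) : has_card [set x | P x] #|P|.
Proof.
exists (enum P); last by rewrite cardE.
by split=> [|x]; [exact: enum_uniq|rewrite mem_enum].
Qed.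

(** The double counting principle behind every enumeration below. *)
Lemma has_card_fibers T T' (f : T -> T') (S : set T) (s : seq T') (c : T' -> nat) :
  uniq s -> (forall x, S x -> f x \in s) ->
  (forall y, y \in s -> has_card [set x | S x /\ f x = y] (c y)) ->
  has_card S (\sum_(y <- s) c y)%N.
Proof.
move=> us Ss fib.
have /choice[e eP] y : exists e : seq T, y \in s ->
    [/\ uniq e, forall x, (S x /\ f x = y) <-> x \in e & size e = c y].
  case: (boolP (y \in s)) => [/fib[e [ue eS] sz]|_]; first by exists e.
  by exists [::].
exists [seq x | y <- s, x <- e y]; last first.
  rewrite size_allpairs_dep sumnE big_map big_seq [RHS]big_seq.
  by apply: eq_bigr => y /eP[].
split.
  apply: (@allpairs_uniq_dep _ (fun=> T)) => //; first by move=> y /eP[].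
  have tagE p : p \in [seq @Tagged T' y (fun=> T) x | y <- s, x <- e y] ->
      tag p = f (tagged p).
    by move=> /allpairsPdep[y [x [/eP[_ yP _] /yP[_ yE] ->]]] /=; rewrite yE.
  by move=> [y x] [y' x'] /tagE /= -> /tagE /= -> /= ->.
move=> x; split=> [Sx|/allpairsPdep[y [z [/eP[_ yP _] /yP[Sz _] ->]]] //].
apply/allpairsPdep; exists (f x), x; split=> //; first exact: Ss.
by have [_ xP _] := eP _ (Ss _ Sx); apply/xP.
Qed.

Lemma has_card_fset (T : choiceType) (S : set T) n :
  has_card S n -> finite_set S /\ #|` fset_set S | = n.
Proof.
move=> [s [us sS] <-].
have -> : S = [set` s] by apply/seteqP; split=> x /=; rewrite sS.
split; first exact: finite_seq.
have -> : fset_set [set` s] = [fset x in s]%fset.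
  by apply/finmap.fsetP => x; rewrite in_fset_set ?inE //=; apply/idP/idP; rewrite ?inE.
by rewrite card_fseq undup_id.
Qed.

Lemma fset_has_card (T : choiceType) (S : set T) :
  finite_set S -> has_card S #|` fset_set S |.
Proof.
move=> finS; exists (fset_set S) => //; split; first exact: fset_uniq.
by move=> x; rewrite in_fset_set // inE.
Qed.

End HasCard.

(** * Indices of subgroups *)

Definition is_subgroup (M : zmodType) (B : set M) : Prop :=
  B 0 /\ forall x y, B x -> B y -> B (x - y).

Definition coset_set (M : zmodType) (B : set M) (x : M) : set M :=
  [set x + y | y in B].

(** A need not be the whole group, so that indices can be multiplied along
    chains of subgroups. *)
Definition has_index (M : zmodType) (A B : set M) (n : nat) : Prop :=
  has_card (coset_set B @` A) n.

Section Index.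
Implicit Types M : zmodType.

Lemma subgroup0 M (B : set M) : is_subgroup B -> B 0.
Proof. by case. Qed.
Lemma subgroupB M (B : set M) x y : is_subgroup B -> B x -> B y -> B (x - y).
Proof. by case=> _; exact. Qed.
Lemma subgroupN M (B : set M) x : is_subgroup B -> B x -> B (- x).
Proof. by move=> sB Bx; rewrite -sub0r; apply: subgroupB => //; exact: subgroup0. Qed.
Lemma subgroupD M (B : set M) x y : is_subgroup B -> B x -> B y -> B (x + y).
Proof.
move=> sB Bx By; rewrite -[y]opprK; apply: subgroupB => //.
exact: subgroupN.
Qed.
Lemma subgroup_sum M (B : set M) I (r : seq I) (P : pred I) (F : I -> M) :
  is_subgroup B -> (forall i, P i -> B (F i)) -> B (\sum_(i <- r | P i) F i).
Proof.
move=> sB BF; elim/big_ind: _ => //; first exact: subgroup0.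
by move=> x y; exact: subgroupD.
Qed.

Lemma coset_setE M (B : set M) x z : coset_set B x z <-> B (z - x).
Proof.
split=> [[y By <-]|Bzx]; first by rewrite addrC addKr.
by exists (z - x) => //; rewrite addrC subrK.
Qed.

Lemma coset_set_eq M (B : set M) x y :
  is_subgroup B -> (coset_set B x = coset_set B y <-> B (x - y)).
Proof.
move=> sB; split=> [e|Bxy].
  by rewrite -coset_setE -e coset_setE subrr; exact: subgroup0.
apply/seteqP; split=> z; rewrite !coset_setE => Bz.
  have -> : z - y = (z - x) + (x - y) by rewrite addrA subrK.
  exact: subgroupD.
have -> : z - x = (z - y) - (x - y) by rewrite opprB addrA subrK.
exact: subgroupB.
Qed.

Lemma has_index_inj M (A B : set M) n p :
  has_index A B n -> has_index A B p -> n = p.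
Proof. exact: has_card_inj. Qed.

(** The hypotheses say that phi induces a bijection A/B -> A'/B'; this covers
    isomorphisms as well as the inclusions of the second isomorphism theorem. *)
Lemma has_index_map M M' (phi : M -> M') (A B : set M) (A' B' : set M') n :
  is_subgroup B -> is_subgroup B' ->
  (forall a, A a -> A' (phi a)) ->
  (forall a b, A a -> A b -> (B (a - b) <-> B' (phi a - phi b))) ->
  (forall a', A' a' -> exists2 a, A a & B' (a' - phi a)) ->
  has_index A B n <-> has_index A' B' n.
Proof.
move=> sB sB' AA' BB' surj.
have /choice[psi psiP] X : exists Y, forall a, A a -> X = coset_set B a ->
    Y = coset_set B' (phi a).
  have [[a Aa ->]|noX] := pselect (exists2 a, A a & X = coset_set B a).
    exists (coset_set B' (phi a)) => b Ab /(coset_set_eq _ _ sB) Bab.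
    by apply/(coset_set_eq _ _ sB'); apply/BB'.
  by exists set0 => a Aa Xa; case: noX; exists a.
have psiE a : A a -> psi (coset_set B a) = coset_set B' (phi a).
  by move=> Aa; apply: psiP.
have psi_inj X Y : (coset_set B @` A) X -> (coset_set B @` A) Y ->
    psi X = psi Y -> X = Y.
  move=> [a Aa <-] [b Ab <-]; rewrite !psiE // => /(coset_set_eq _ _ sB') Bab.
  by apply/(coset_set_eq _ _ sB)/BB'.
have psi_surj Y : (coset_set B' @` A') Y <->
    exists2 X, (coset_set B @` A) X & psi X = Y.
  split=> [[a' /surj[a Aa Ba] <-]|[_ [a Aa <-] <-]].
    exists (coset_set B a); first by exists a.
    by rewrite psiE //; apply/esym/(coset_set_eq _ _ sB').
  by rewrite psiE //; exists (phi a) => //; exact: AA'.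
split=> [|]; first exact: has_card_bij psi_inj psi_surj.
pose theta Y := if pselect (exists2 X, (coset_set B @` A) X & psi X = Y) is left ex
  then s2val (cid2 ex) else set0.
have thetaP Y : (coset_set B' @` A') Y ->
    (coset_set B @` A) (theta Y) /\ psi (theta Y) = Y.
  rewrite /theta; case: pselect => [ex _|nex /psi_surj //].
  by case: (cid2 ex).
move=> A'B'; apply: (has_card_bij (f := theta) _ _ A'B') => [X Y /thetaP[_ e] /thetaP[_ e'] eXY|X].
  by rewrite -e -e' eXY.
split=> [AX|[Y /thetaP[? _] <-] //].
have AY : (coset_set B' @` A') (psi X) by apply/psi_surj; exists X.
by exists (psi X) => //; have [? ?] := thetaP _ AY; apply: psi_inj.
Qed.

(** The cosets of C in a given coset a + B are the translates by a of the
    cosets of C in B. *)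
Lemma has_index_mul M (A B C : set M) n p :
  is_subgroup A -> is_subgroup B -> is_subgroup C -> C `<=` B -> B `<=` A ->
  has_index A B n -> has_index B C p -> has_index A C (n * p).
Proof.
move=> sA sB sC CB BA [s [us sAB] <-] BCp.
pose f X : set M := [set z | exists2 x, X x & B (z - x)].
have fE a : f (coset_set C a) = coset_set B a.
  apply/seteqP; split=> z; rewrite coset_setE.
    move=> [x /coset_setE/CB Bx Bz].
    by have -> : z - a = (z - x) + (x - a) by [rewrite addrA subrK]; apply: subgroupD.
  by exists a => //; apply/coset_setE; rewrite subrr; exact: subgroup0.
rewrite -sum1_size big_distrl /=; under eq_bigr do rewrite mul1n.
apply: (@has_card_fibers _ _ f) => // [_ [a Aa <-]|Y /sAB[a Aa <-]].
  by rewrite fE; apply/sAB; exists a.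
apply: (has_card_bij (f := fun X => [set a + x | x in X]) _ _ BCp).
  move=> X X2 _ _ e; apply/seteqP; split=> x Xx.
    have : [set a + y | y in X2] (a + x) by rewrite -e; exists x.
    by move=> [y Xy /addrI <-].
  have : [set a + y | y in X] (a + x) by rewrite e; exists x.
  by move=> [y Xy /addrI <-].
have trE b : [set a + x | x in coset_set C b] = coset_set C (a + b).
  apply/seteqP; split=> z; rewrite coset_setE.
    move=> [x /coset_setE Cx <-].
    by rewrite opprD addrACA subrr add0r.
  move=> Cz; exists (z - a); last by rewrite addrC subrK.
  by apply/coset_setE; rewrite -addrA -opprD.
move=> Z; split=> [[[y Ay <-]]|[_ [b Bb <-] <-]].
  rewrite fE => /(coset_set_eq _ _ sB) Bya.
  exists (coset_set C (y - a)); first by exists (y - a).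
  by rewrite trE addrC subrK.
rewrite trE /= fE; split; first by exists (a + b) => //; apply: subgroupD => //; exact: BA.
by apply/(coset_set_eq _ _ sB); rewrite [a + b]addrC addrK.
Qed.

Lemma has_index_finer M (A B C : set M) n :
  is_subgroup B -> is_subgroup C -> C `<=` B -> B `<=` A -> has_index A C n ->
  (exists p, has_index A B p) /\ (exists p, has_index B C p).
Proof.
move=> sB sC CB BA AC; split; last first.
  by apply: has_card_sub AC => _ [b Bb <-]; exists b => //; exact: BA.
have [p] := has_card_image (fun X : set M => [set z | exists2 x, X x & B (z - x)]) AC.
move=> H; exists p; move: H; rewrite /has_index; congr (has_card _ p).
have fE a : [set z | exists2 x, coset_set C a x & B (z - x)] = coset_set B a.
  apply/seteqP; split=> z; rewrite coset_setE.
    move=> [x /coset_setE/CB Bx Bz].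
    by have -> : z - a = (z - x) + (x - a) by [rewrite addrA subrK]; apply: subgroupD.
  by exists a => //; apply/coset_setE; rewrite subrr; exact: subgroup0.
apply/seteqP; split=> [_ [_ [a Aa <-] <-]|_ [a Aa <-]]; rewrite ?fE; first by exists a.
by exists (coset_set C a); [exists a|exact: fE].
Qed.

Lemma has_index1 M (A : set M) : is_subgroup A -> has_index A A 1.
Proof.
move=> sA; exists [:: coset_set A 0] => //; split=> // X; rewrite inE.
split=> [[a Aa <-]|/eqP ->]; last by exists 0 => //; exact: subgroup0.
by apply/eqP/(coset_set_eq _ _ sA); rewrite subr0.
Qed.

(** Through the intermediate subgroup of the a in A with phi a in phi B: its
    index in A is seen after phi, and B meets it in the kernel of phi. *)
Lemma has_index_ext M M' (phi : M -> M') (A B : set M) n p :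
  {morph phi : x y / x - y} ->
  is_subgroup A -> is_subgroup B -> B `<=` A ->
  has_index (phi @` A) (phi @` B) n ->
  has_index (A `&` [set x | phi x = 0]) (B `&` [set x | phi x = 0]) p ->
  has_index A B (n * p).
Proof.
move=> phiB sA sB BA AnB kAB.
have phi0 : phi 0 = 0 by rewrite -(subrr 0) phiB subrr.
have sphi (C : set M) : is_subgroup C -> is_subgroup (phi @` C).
  move=> sC; split; first by exists 0; rewrite ?phi0 //; exact: subgroup0.
  by move=> _ _ [x Cx <-] [y Cy <-]; exists (x - y); rewrite ?phiB //; exact: subgroupB.
have sker (C : set M) : is_subgroup C -> is_subgroup (C `&` [set x | phi x = 0]).
  move=> sC; split; first by split; [exact: subgroup0|rewrite /= phi0].
  move=> x y [Cx /= x0] [Cy /= y0]; split; first exact: subgroupB.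
  by rewrite /= phiB x0 y0 subrr.
pose B' := A `&` [set x | (phi @` B) (phi x)].
have sB' : is_subgroup B'.
  split; first by split; [exact: subgroup0|exists 0; rewrite ?phi0 //; exact: subgroup0].
  move=> x y [Ax Bx] [Ay By]; split; first exact: subgroupB.
  by rewrite /= phiB; apply: (subgroupB (sphi _ sB)).
have BB' : B `<=` B' by move=> x Bx; split; [exact: BA|exists x].
apply: (@has_index_mul _ A B' B) => //; first by move=> x [].
  apply/(@has_index_map _ _ phi A B' (phi @` A) (phi @` B)) => //.
  - exact: sphi.
  - move=> a b Aa Ab; split=> [[_ /=]|]; first by rewrite phiB.
    by move=> Bab; split; [exact: (subgroupB sA)|rewrite /= phiB].
  - by move=> _ [a Aa <-]; exists a => //; rewrite subrr; apply: (subgroup0 (sphi _ sB)).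
apply/(@has_index_map _ _ id (A `&` [set x | phi x = 0])
  (B `&` [set x | phi x = 0]) B' B) => //.
- exact: sker.
- move=> a [Aa /= a0]; split=> //=; rewrite a0; exact: (subgroup0 (sphi _ sB)).
- move=> a b [Aa /= a0] [Ab /= b0]; split=> [[]//|Bab]; split=> //.
  by rewrite /= phiB a0 b0 subrr.
- move=> a [Aa [b Bb e]]; exists (a - b).
    split; first by apply: subgroupB => //; exact: BA.
    by rewrite /= phiB e subrr.
  by rewrite opprB addrC subrK.
Qed.

Lemma module_indexE M (N : set M) n :
  has_index setT N n -> finite_set (add_cosets N) /\ module_index N = n.
Proof. exact: has_card_fset. Qed.

End Index.

(** * Divisibility and digits in a discrete valuation ring *)

Definition is_submodule (A : pzRingType) (M : lmodType A) (N : set M) : Prop :=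
  N 0 /\ forall (c : A) u v, N u -> N v -> N (c *: u + v).

Section Submodule.
Variables (A : pzRingType) (M : lmodType A) (N : set M).
Hypothesis sN : is_submodule N.

Lemma submodule_subgroup : is_subgroup N.
Proof.
case: sN => N0 NZ; split=> // x y Nx Ny.
by rewrite addrC -scaleN1r; exact: NZ.
Qed.

Lemma submoduleZ c x : N x -> N (c *: x).
Proof. by case: sN => N0 NZ Nx; rewrite -[_ *: _]addr0; exact: NZ. Qed.

End Submodule.

Lemma submod_closedE (A : pzRingType) (M : lmodType A) (N : set M) :
  submod_closed (mem N) <-> is_submodule N.
Proof.
split=> [[N0 NZ]|[N0 NZ]]; split.
- exact: set_mem.
- by move=> c u v /mem_set Nu /mem_set Nv; apply: set_mem; exact: NZ.
- exact: mem_set.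
- by move=> c u v /set_mem Nu /set_mem Nv; apply: mem_set; exact: NZ.
Qed.

(** The part of the theory of discrete valuation rings that makes sense without
    inverses or a domain structure, so that it applies to power series as well
    as to V. *)
Record is_dvr (k : fieldType) (V : comNzRingType) (pi : V)
    (red : {rmorphism V -> k}) : Prop := IsDvr {
  dvr_piI : forall x y, pi * x = pi * y -> x = y;
  dvr_redS : forall c, exists x, red x = c;
  dvr_redK : forall x, red x = 0 <-> exists y, x = y * pi;
  dvr_unit : forall u, red u != 0 -> exists v, u * v = 1 }.

Definition pdvd (V : comNzRingType) (pi : V) (a : nat) (x : V) : Prop :=
  exists y, x = y * pi ^+ a.

Definition box (V : comNzRingType) (pi : V) d (a : 'I_d -> nat) : set 'rV[V]_d :=
  [set y | forall i, pdvd pi (a i) (y 0 i)].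

(** V^d / L is the sum of the V / (pi^(a i)): the rows of U are a basis of V^d
    adapted to L. *)
Definition cotype (V : comNzRingType) (pi : V) d (a : 'I_d -> nat)
    (L : set 'rV[V]_d) : Prop :=
  exists U Ui : 'M[V]_d, [/\ U *m Ui = 1%:M, Ui *m U = 1%:M
    & forall x, L x <-> box pi a (x *m Ui)].

Section Dvr.
Variables (k : finFieldType) (V : comNzRingType) (pi : V).
Variable red : {rmorphism V -> k}.
Hypothesis hV : is_dvr pi red.
Local Notation pdvd := (pdvd pi).
Local Notation box := (box pi).
Local Notation cotype := (cotype pi).

Lemma pdvd_id a x : pdvd a (x * pi ^+ a).
Proof. by exists x. Qed.
Lemma pdvd0 a : pdvd a 0.
Proof. by exists 0; rewrite mul0r. Qed.
Lemma pdvdB a x y : pdvd a x -> pdvd a y -> pdvd a (x - y).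
Proof. by move=> [x' ->] [y' ->]; exists (x' - y'); rewrite mulrBl. Qed.
Lemma pdvd_subgroup a : is_subgroup (pdvd a).
Proof. by split; [exact: pdvd0|exact: pdvdB]. Qed.
Lemma pdvdM a b x y : pdvd a x -> pdvd b y -> pdvd (a + b) (x * y).
Proof. by move=> [x' ->] [y' ->]; exists (x' * y'); rewrite mulrACA exprD. Qed.
Lemma pdvd_n0 x : pdvd 0 x.
Proof. by exists x; rewrite mulr1. Qed.
Lemma pdvdW a b x : (b <= a)%N -> pdvd a x -> pdvd b x.
Proof.
move=> le [y ->]; exists (y * pi ^+ (a - b)).
by rewrite -mulrA -exprD subnK.
Qed.
Lemma pdvdMl a x y : pdvd a y -> pdvd a (x * y).
Proof. by move=> [y' ->]; exists (x * y'); rewrite mulrA. Qed.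

Lemma pi_expI a x y : pi ^+ a * x = pi ^+ a * y -> x = y.
Proof.
elim: a => [|a IH]; first by rewrite !mul1r.
by rewrite exprS -!mulrA => /(dvr_piI hV)/IH.
Qed.

Lemma pdvd_cancel a b x : pdvd b (pi ^+ a * x) <-> pdvd (b - a) x.
Proof.
split=> [[y e]|]; last first.
  move=> x_ba; apply: pdvdW (leq_maxr a b) _; rewrite maxnE.
  by apply: pdvdM => //; exists 1; rewrite mul1r.
have [le|lt] := leqP b a.
  by move: le; rewrite /leq => /eqP ->; exact: pdvd_n0.
exists y; apply: (@pi_expI a); rewrite e mulrCA -exprD subnKC //; exact: ltnW.
Qed.

Lemma pdvd1 x : pdvd 1 x <-> red x = 0.
Proof. by rewrite (dvr_redK hV); split=> -[y ->]; exists y; rewrite ?expr1. Qed.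

(** Pi-adic digits, with respect to a section of the residue map sending 0 to
    0. Addition and multiplication depend on V through carries, but congruence
    modulo a power of pi does not: this is all that the counting of orbits
    needs. *)
Lemma digits_exist : exists dig : V -> nat -> k,
  [/\ forall x y c, pdvd c (x - y) <-> forall i, (i < c)%N -> dig x i = dig y i,
      forall (e : nat -> k) c, exists x, forall i, (i < c)%N -> dig x i = e i,
      forall x, dig x 0 = red x
    & forall i, dig 0 i = 0].
Proof.
have /choice[sec secP] c : exists x, red x = c /\ (c = 0 -> x = 0).
  have [->|c0] := eqVneq c 0; first by exists 0; rewrite rmorph0.
  by have [x xc] := dvr_redS hV c; exists x; split=> // /eqP; rewrite (negPf c0).
have /choice[tl tlP] x : exists y, x = sec (red x) + pi * y.
  have [|y e] := iffLR (dvr_redK hV (x - sec (red x))).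
    by rewrite rmorphB /= (secP _).1 subrr.
  by exists y; rewrite mulrC -e addrC subrK.
pose dig x i := red (iter i tl x).
have digS x i : dig x i.+1 = dig (tl x) i by rewrite /dig iterSr.
have sec0 : sec 0 = 0 by exact: (secP 0).2.
have tl0 : tl 0 = 0.
  have := tlP 0; rewrite rmorph0 sec0 add0r => e.
  by apply: (dvr_piI hV); rewrite -e mulr0.
exists dig; split=> //.
- move=> x y c; elim: c x y => [|c IH] x y; first by split=> // _; exact: pdvd_n0.
  have subE : red x = red y -> x - y = pi ^+ 1 * (tl x - tl y).
    move=> exy; rewrite [in LHS](tlP x) [in LHS](tlP y) exy.
    by rewrite opprD addrACA subrr add0r mulrBr expr1.
  split=> [xy [|i]|xy].
  + move=> _; rewrite /dig /=; apply/eqP; rewrite -subr_eq0 -rmorphB /=.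
    by apply/eqP/pdvd1; apply: pdvdW xy.
  + rewrite ltnS !digS; apply: (iffLR (IH _ _)).
    have exy : red x = red y.
      apply/eqP; rewrite -subr_eq0 -rmorphB /=.
      by apply/eqP/pdvd1; apply: pdvdW xy.
    by move: xy; rewrite subE // pdvd_cancel subn1.
  + rewrite subE; last exact: (xy 0%N).
    by rewrite pdvd_cancel subn1; apply/IH => i lei; rewrite -!digS; exact: xy.
- move=> e c; elim: c e => [|c IH] e; first by exists 0.
  have [x xe] := IH (fun i => e i.+1); exists (sec (e 0%N) + pi * x).
  have red_e : red (sec (e 0%N) + pi * x) = e 0%N.
    rewrite rmorphD rmorphM /= (secP _).1.
    have -> : red pi = 0 by apply/(dvr_redK hV); exists 1; rewrite mul1r.
    by rewrite mul0r addr0.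
  move=> [|i]; first by rewrite /dig /=.
  rewrite ltnS digS => /xe <-; congr (dig _ i); apply: (dvr_piI hV).
  have := tlP (sec (e 0%N) + pi * x); rewrite red_e.
  by move/addrI.
- by move=> i; rewrite /dig; have -> : iter i tl 0 = 0 by [elim: i => //= i ->]; exact: rmorph0.
Qed.

Lemma pdvd_index a : has_index setT (pdvd a) (#|k| ^ a)%N.
Proof.
have [dig [digP digS dig0 _]] := digits_exist.
have /choice[val valP] (e : {ffun 'I_a -> k}) :
    exists x, forall i : 'I_a, dig x i = e i.
  have [x xe] := digS (fun i => if insub i is Some i' then e i' else 0) a.
  by exists x => i; rewrite xe // valK.
have := has_card_pred (@predT {ffun 'I_a -> k}).
rewrite card_ffun card_ord.
apply: (has_card_bij (f := fun e => coset_set (pdvd a) (val e))).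
  move=> e e' _ _ /(coset_set_eq _ _ (pdvd_subgroup a))/digP ee'.
  by apply/ffunP => i; rewrite -!valP ee'.
move=> X; split=> [[x _ <-]|[e _ <-]]; last by exists (val e).
exists [ffun i : 'I_a => dig x i] => //.
apply/(coset_set_eq _ _ (pdvd_subgroup a))/digP => i lei.
by rewrite (valP _ (Ordinal lei)) ffunE.
Qed.

Lemma box_submodule d (a : 'I_d -> nat) : is_submodule (box a).
Proof.
split=> [i|c u v bu bv i]; first by rewrite mxE; exact: pdvd0.
rewrite !mxE; apply: (subgroupD (pdvd_subgroup _)) => //.
exact: pdvdMl.
Qed.

Lemma box_mulmx d n (x : 'rV[V]_d) (Q : 'M[V]_d) :
  box (fun=> n) x -> box (fun=> n) (x *m Q).
Proof.
move=> bx j; rewrite mxE; apply: (@subgroup_sum _ (pdvd n)) => [|l _].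
  exact: pdvd_subgroup.
by rewrite mulrC; apply: pdvdMl; exact: bx.
Qed.

Lemma box_index d (a : 'I_d -> nat) :
  has_index setT (box a) (#|k| ^ (\sum_i a i))%N.
Proof.
elim: d a => [|d IH] a.
  rewrite big_ord0 expn0; have -> : box a = setT by apply/seteqP; split=> // x _ [].
  by apply: has_index1; split.
rewrite big_ord_recl expnD.
have sb d' (b : 'I_d' -> nat) := submodule_subgroup (box_submodule b).
have sT (M : zmodType) : is_subgroup [set: M] by [].
apply: (@has_index_ext _ _ (fun x : 'rV_d.+1 => x 0 0)) => //.
- by move=> x y; rewrite !mxE.
- exact: sb.
- have := pdvd_index (a ord0); congr (has_index _ _ _); apply/seteqP; split.
  + by move=> c _; exists (const_mx c); rewrite ?mxE.
  + by [].
  + move=> c ac; exists (\row_i if i == 0 then c else 0); rewrite ?mxE // => i.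
    by rewrite mxE; case: eqP => [->|_] //; exact: pdvd0.
  + by move=> _ [x bx <-]; exact: bx.
apply/(has_index_map (phi := fun x : 'rV[V]_d.+1 => \row_i x 0 (lift ord0 i))
  (A' := setT) (B' := box (fun i => a (lift ord0 i)))) => //.
- split; first by split; [exact: (subgroup0 (sb _ _))|rewrite /= mxE].
  move=> x y [bx /= x0] [bv /= y0]; split; first exact: (subgroupB (sb _ _)).
  by rewrite /= !mxE x0 y0 subrr.
- exact: sb.
- move=> x y [_ /= x0] [_ /= y0]; split=> [[bxy _] i|bxy].
    by have := bxy (lift ord0 i); rewrite !mxE.
  split; last by rewrite /= !mxE x0 y0 subrr.
  move=> i; case: (unliftP ord0 i) => [j|] ->; last first.
    by rewrite !mxE x0 y0 subrr; exact: pdvd0.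
  by have := bxy j; rewrite !mxE.
- move=> y _; exists (\row_i if unlift ord0 i is Some j then y 0 j else 0).
    by split=> //=; rewrite mxE unlift_none.
  by move=> i; rewrite !mxE liftK subrr; exact: pdvd0.
Qed.

Lemma cotype_submodule d (a : 'I_d -> nat) L : cotype a L -> is_submodule L.
Proof.
move=> [U [Ui [_ _ LE]]]; have [b0 bZ] := box_submodule a; split.
  by apply/LE; rewrite mul0mx.
move=> c u v /LE Lu /LE Lv; apply/LE; rewrite mulmxDl -scalemxAl; exact: bZ.
Qed.

Lemma cotype_index d (a : 'I_d -> nat) L :
  cotype a L -> has_index setT L (#|k| ^ (\sum_i a i))%N.
Proof.
move=> cL; have := cL; move=> [U [Ui [UUi UiU LE]]].
apply/(has_index_map (phi := fun x => x *m Ui) (A' := setT) (B' := box a)) => //.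
- exact: (submodule_subgroup (cotype_submodule cL)).
- exact: (submodule_subgroup (box_submodule a)).
- by move=> x y _ _; rewrite LE mulmxBl.
- move=> y _; exists (y *m U) => //; rewrite -mulmxA UUi mulmx1 subrr.
  exact: (submodule_subgroup (box_submodule a)).1.
- exact: box_index.
Qed.

Lemma mx_red_unit d (X : 'M[V]_d) :
  map_mx red X \in unitmx -> exists2 Y, X *m Y = 1%:M & Y *m X = 1%:M.
Proof.
rewrite unitmxE unitfE det_map_mx => /(dvr_unit hV)[v uv].
exists (v *: \adj X); first by rewrite -scalemxAr mul_mx_adj scale_scalar_mx mulrC uv.
by rewrite -scalemxAl mul_adj_mx scale_scalar_mx mulrC uv.
Qed.

Lemma mx_unit_red d (X Y : 'M[V]_d) :
  X *m Y = 1%:M -> map_mx red X \in unitmx.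
Proof.
move=> XY; have : map_mx red X *m map_mx red Y = 1%:M.
  by rewrite -map_mxM XY map_mx1.
by case/mulmx1_unit.
Qed.

Lemma boxE d (a : 'I_d -> nat) y :
  box a y <-> exists z, y = z *m diag_mx (\row_i pi ^+ a i).
Proof.
split=> [by_|[z ->] i].
  have /choice[z zP] i := by_ i; exists (\row_i z i).
  by apply/rowP => i; rewrite mul_mx_diag !mxE zP.
by rewrite mul_mx_diag !mxE; exists (z 0 i).
Qed.

Definition box_stab d (a : 'I_d -> nat) (S : 'M[V]_d) : Prop :=
  forall i j, pdvd (a j - a i) (S i j).

(** That S maps the box into itself is visible on the generators pi^(a i) e_i.
    Then D S = S' D for the diagonal matrix D of the pi^(a i), and
    det S' = det S is a unit, so that the inverse of S preserves the box too. *)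
Lemma box_stabP d (a : 'I_d -> nat) (S Si : 'M[V]_d) :
  S *m Si = 1%:M ->
  box_stab a S <-> forall y, box a (y *m S) <-> box a y.
Proof.
move=> SSi; split=> [stS|stS i j]; last first.
  apply/pdvd_cancel.
  have /stS/(_ j) : box a (pi ^+ a i *: delta_mx 0 i).
    move=> j'; rewrite !mxE eqxx /=; case: (eqVneq j' i) => [->|_] /=.
      by rewrite mulr1; exists 1; rewrite mul1r.
    by rewrite mulr0; exact: pdvd0.
  by rewrite -scalemxAl -rowE !mxE.
pose D := diag_mx (\row_i pi ^+ a i).
have /choice[S1 S1P] ij : exists x, pi ^+ a ij.1 * S ij.1 ij.2 = x * pi ^+ a ij.2.
  by case: ij => i j /=; apply/pdvd_cancel.
(* S' is D S D^-1. *)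
pose S' := \matrix_(i, j) S1 (i, j).
have DS : D *m S = S' *m D.
  by apply/matrixP => i j; rewrite mul_diag_mx mul_mx_diag !mxE (S1P (i, j)).
have detS : \det S' = \det S.
  have detD : \det D = pi ^+ \sum_i a i.
    by rewrite det_diag; under eq_bigr do rewrite mxE; rewrite prodrXr.
  have : \det (D *m S) = \det (S' *m D) by rewrite DS.
  by rewrite !det_mulmx [\det S' * _]mulrC detD => /pi_expI.
have [|Ti S'Ti TiS'] := @mx_red_unit _ S'.
  by rewrite unitmxE det_map_mx detS -det_map_mx -unitmxE (mx_unit_red SSi).
have DSi : D *m Si = Ti *m D.
  have : Ti *m (D *m S) *m Si = Ti *m (S' *m D) *m Si by rewrite DS.
  by rewrite -!mulmxA SSi mulmx1 => ->; rewrite mulmxA TiS' mul1mx.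
move=> y; split=> /boxE[z e]; apply/boxE.
  by exists (z *m Ti); rewrite -mulmxA -DSi mulmxA -e -mulmxA SSi mulmx1.
by exists (z *m S'); rewrite e -!mulmxA DS.
Qed.

End Dvr.

(** * Orbits and stabilisers of lattices *)

Section DigitMatrices.
Variables (k : finFieldType) (m d : nat).

(** Matrices over V / (pi^(m+1)), coded by the digits of their entries: a type
    that does not mention V. *)
Definition digit_mx := 'M[{ffun 'I_m.+1 -> k}]_d.

Definition digit_GL : pred digit_mx :=
  fun D => map_mx (fun e : {ffun 'I_m.+1 -> k} => e ord0) D \in unitmx.

Definition digit_stab (a : 'I_d -> nat) : pred digit_mx := fun D =>
  digit_GL D && [forall i, forall j, forall c : 'I_m.+1, (c < a j - a i)%N ==> (D i j c == 0)].

Lemma digit_stabP a D : reflect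
  (digit_GL D /\ forall i j (c : 'I_m.+1), (c < a j - a i)%N -> D i j c = 0)
  (digit_stab a D).
Proof.
apply: (iffP andP) => -[GD stD]; split=> //.
  move=> i j c; move/forallP/(_ i)/forallP/(_ j)/forallP/(_ c)/implyP: stD.
  by move=> stD /stD /eqP.
apply/forallP => i; apply/forallP => j; apply/forallP => c; apply/implyP => lt.
by rewrite stD.
Qed.

(** The exponent (m - a_j) - (m - a_i) is a_i - a_j, also when truncated. *)
Lemma digit_stab_tr a : (forall i, a i <= m.+1)%N ->
  #|digit_stab (fun i => m.+1 - a i)%N| = #|digit_stab a|.
Proof.
move=> am; apply/esym; apply: (has_card_inj _ (has_card_pred _)).
apply: (has_card_bij (f := fun D : digit_mx => D^T) _ _ (has_card_pred (digit_stab a))).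
  by move=> D D' _ _ /trmx_inj.
have tr_GL (D : digit_mx) : digit_GL D -> digit_GL D^T.
  by rewrite /digit_GL -map_trmx unitmx_tr.
have sub_sub i j : ((m.+1 - a j) - (m.+1 - a i) = a i - a j)%N.
  by have := am i; have := am j; lia.
move=> D; split=> [/digit_stabP[GD stD]|[E /digit_stabP[GE stE] <-]].
  exists D^T; last by rewrite trmxK.
  apply/digit_stabP; split=> [|i j c lt]; first exact: tr_GL.
  by rewrite mxE stD // sub_sub.
apply/digit_stabP; split=> [|i j c]; first exact: tr_GL.
by rewrite sub_sub mxE; exact: stE.
Qed.

Lemma digit_stab_gt0 a : (0 < #|digit_stab a|)%N.
Proof.
apply/card_gt0P; exists (\matrix_(i, j) [ffun c => ((c == ord0) && (i == j))%:R]).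
apply/digit_stabP; split=> [|i j c]; last first.
  rewrite !mxE ffunE; case: eqP => [->|//] /=; case: eqP => [->|//].
  by rewrite subnn.
rewrite /digit_GL; set X := map_mx _ _; have -> : X = 1%:M; last exact: unitmx1.
by apply/matrixP => i j; rewrite !mxE ffunE eqxx.
Qed.

Section Dvr.
Variables (V : comNzRingType) (pi : V) (red : {rmorphism V -> k}).
Hypothesis hV : is_dvr pi red.
Local Notation pdvd := (pdvd pi).
Local Notation box := (box pi).
Local Notation cotype := (cotype pi).
Implicit Types (a : 'I_d -> nat) (X : 'M[V]_d).

Let span a X : set 'rV[V]_d := [set y *m X | y in box a].

Let spanE a X Y : X *m Y = 1%:M -> Y *m X = 1%:M ->
  forall x, span a X x <-> box a (x *m Y).
Proof.
move=> XY YX x; split=> [[y by_ <-]|bx]; first by rewrite -mulmxA XY mulmx1.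
by exists (x *m Y) => //; rewrite -mulmxA YX mulmx1.
Qed.

Let span_eq a S X Xi : X *m Xi = 1%:M -> Xi *m X = 1%:M ->
  map_mx red S \in unitmx -> (span a (S *m X) = span a X <-> box_stab pi a S).
Proof.
move=> XXi XiX /(mx_red_unit hV)[Si SSi SiS].
have SX1 : (S *m X) *m (Xi *m Si) = 1%:M.
  by rewrite mulmxA -(mulmxA S) XXi mulmx1.
have SX2 : (Xi *m Si) *m (S *m X) = 1%:M.
  by rewrite mulmxA -(mulmxA Xi) SiS mulmx1.
rewrite (box_stabP hV _ SSi); split=> [e y|st].
  have := spanE a SX1 SX2 (y *m (S *m X)); rewrite e (spanE a XXi XiX).
  by rewrite -(mulmxA y _ (Xi *m Si)) SX1 mulmx1 -!mulmxA XXi mulmx1.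
apply/seteqP; split=> x; rewrite (spanE a SX1 SX2) (spanE a XXi XiX) => bx.
  by have := iffRL (st (x *m (Xi *m Si))) bx; rewrite -!mulmxA SiS mulmx1.
by apply/st; rewrite -!mulmxA SiS mulmx1.
Qed.

(** Every lattice of cotype a is the image of the box under an invertible
    matrix, which matters only modulo pi^(m+1); the matrices giving the same
    lattice form a coset of the stabiliser of the box. Neither GL_d nor the
    stabiliser depends on V once matrices are read through their digits. *)
Lemma cotype_count a : (forall i, a i <= m.+1)%N ->
  exists2 n, has_card (cotype a) n & (n * #|digit_stab a| = #|digit_GL|)%N.
Proof.
move=> am; have [dig [digP digS dig0 dig_0]] := digits_exist hV.
have mxB (X Y : 'M[V]_d) i j : X i j - Y i j = (X - Y) i j by rewrite !mxE.
pose mdig X : digit_mx := \matrix_(i, j) [ffun c => dig (X i j) (val c)].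
have mdigP X Y : mdig X = mdig Y <-> forall i j, pdvd m.+1 (X i j - Y i j).
  split=> [e i j|XY].
    apply/digP => c ltc; have /ffunP/(_ (Ordinal ltc)) : mdig X i j = mdig Y i j by rewrite e.
    by rewrite !mxE !ffunE.
  apply/matrixP => i j; rewrite !mxE; apply/ffunP => c; rewrite !ffunE.
  exact: (iffLR (digP (X i j) (Y i j) m.+1) (XY i j) _ (ltn_ord c)).
have /choice[val valK] D : exists X, mdig X = D.
  have /choice[f fP] ij : exists x, forall c : 'I_m.+1, dig x c = D ij.1 ij.2 c.
    have [x xe] := digS (fun c => if insub c is Some c' then D ij.1 ij.2 c' else 0) m.+1.
    by exists x => c; rewrite xe // valK.
  exists (\matrix_(i, j) f (i, j)); apply/matrixP => i j; rewrite !mxE.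
  by apply/ffunP => c; rewrite ffunE fP.
have mdig_GL X : digit_GL (mdig X) = (map_mx red X \in unitmx).
  rewrite /digit_GL; congr (_ \in unitmx); apply/matrixP => i j.
  by rewrite !mxE ffunE dig0.
have mdig_stab X : digit_stab a (mdig X) <-> map_mx red X \in unitmx /\ box_stab pi a X.
  rewrite -mdig_GL; split=> [/digit_stabP[GX stX]|[GX stX]].
    split=> // i j; rewrite -[X i j]subr0; apply/digP => c ltc.
    have ltcm : (c < m.+1)%N.
      by apply: leq_trans ltc _; apply: leq_trans (leq_subr _ _) (am j).
    by have := stX i j (Ordinal ltcm) ltc; rewrite mxE ffunE dig_0.
  apply/digit_stabP; split=> // i j c ltc; rewrite mxE ffunE -(dig_0 c).
  by apply: (iffLR (digP _ _ _) _ _ ltc); rewrite subr0.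
have spanW X Y : map_mx red X \in unitmx -> mdig X = mdig Y -> span a X = span a Y.
  move=> uX /mdigP XY; have uY : map_mx red Y \in unitmx.
    by rewrite -mdig_GL -(iffRL (mdigP X Y) XY) mdig_GL.
  have [Yi YYi YiY] := mx_red_unit hV uY; have [Xi XXi XiX] := mx_red_unit hV uX.
  have -> : X = (X *m Yi) *m Y by rewrite -mulmxA YiY mulmx1.
  have XYYX : (X *m Yi) *m (Y *m Xi) = 1%:M.
    by rewrite mulmxA -(mulmxA X) YiY mulmx1.
  apply/(span_eq _ YYi YiY); first exact: mx_unit_red XYYX.
  have -> : X *m Yi = 1%:M + (X - Y) *m Yi by rewrite mulmxBl YYi addrC subrK.
  move=> i j; rewrite !mxE; apply: (subgroupD (pdvd_subgroup _ _)).
    by case: eqP => [->|_]; [rewrite subnn; exact: pdvd_n0|exact: pdvd0].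
  apply: (@pdvdW _ _ m.+1); first by apply: leq_trans (leq_subr _ _) (am j).
  apply: (@subgroup_sum _ (pdvd m.+1)) => [|l _]; first exact: pdvd_subgroup.
  by rewrite mulrC; apply: pdvdMl; rewrite !mxE; exact: XY.
have val_unit D : digit_GL D -> map_mx red (val D) \in unitmx.
  by rewrite -mdig_GL valK.
pose p D := span a (val D).
have [n imn] := has_card_image p (has_card_pred digit_GL).
have imE L : (p @` [set D | digit_GL D]) L <-> cotype a L.
  split=> [[D /= /val_unit/(mx_red_unit hV)[Xi XXi XiX] <-]|[X [Xi [XXi XiX LE]]]].
    by exists (val D), Xi; split=> // x; exact: spanE.
  have uX := mx_unit_red red XXi; exists (mdig X) => /=; first by rewrite mdig_GL.
  transitivity (span a X); last by apply/seteqP; split=> x; rewrite (spanE a XXi XiX) LE.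
  by apply/esym/spanW; rewrite ?valK.
exists n; first exact: has_card_eq imE imn.
have [s [us sP] sn] := imn.
apply: (has_card_inj _ (has_card_pred digit_GL)).
rewrite -sn -sum1_size big_distrl /=; under eq_bigr do rewrite mul1n.
apply: (has_card_fibers (f := p)) => // [D GD|L /sP[D0 /= GD0 <-]].
  by apply/sP; exists D.
set X := val D0; have uX : map_mx red X \in unitmx by exact: val_unit.
have [Xi XXi XiX] := mx_red_unit hV uX.
apply: (has_card_bij (f := fun E => mdig (val E *m X)) _ _ (has_card_pred (digit_stab a))).
  move=> E E' _ _ /mdigP EE'; rewrite -[E]valK -[E']valK; apply/mdigP => i j.
  have -> : val E i j - val E' i j = ((val E *m X - val E' *m X) *m Xi) i j.
    by rewrite mulmxBl -!mulmxA XXi !mulmx1 !mxE.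
  rewrite mxE; apply: (@subgroup_sum _ (pdvd m.+1)) => [|l _]; first exact: pdvd_subgroup.
  by rewrite mulrC; apply: pdvdMl; have := EE' i l; rewrite !mxE.
move=> D; split=> [[/= GD pD]|[E]].
  set Y := val D; have uY : map_mx red Y \in unitmx by exact: val_unit.
  have uYX : map_mx red (Y *m Xi) \in unitmx.
    by rewrite map_mxM unitmx_mul uY; exact: (mx_unit_red _ XiX).
  have YE : (Y *m Xi) *m X = Y by rewrite -mulmxA XiX mulmx1.
  exists (mdig (Y *m Xi)).
    by apply/mdig_stab; split=> //; apply/(span_eq a XXi XiX uYX); rewrite YE.
  rewrite -[RHS]valK -/Y -[in RHS]YE; apply/mdigP => i j.
  rewrite mxB -mulmxBl mxE; apply: (@subgroup_sum _ (pdvd m.+1)) => [|l _]; first exact: pdvd_subgroup.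
  rewrite mulrC; apply: pdvdMl; rewrite -mxB; exact: (iffLR (mdigP _ _) (valK _)).
move=> /= stE <-; have [uE stE'] := iffLR (mdig_stab (val E)) (eq_ind_r (digit_stab a) stE (valK E)).
have uEX : map_mx red (val E *m X) \in unitmx by rewrite map_mxM unitmx_mul uE.
split; first by rewrite mdig_GL.
rewrite /p -(@spanW (val E *m X)) ?valK //.
by apply/(span_eq a XXi XiX uE).
Qed.

End Dvr.
End DigitMatrices.

(** Transposing a stabiliser trades a for m - a, so that lattices of cotype
    a over one ring and of cotype m - a over another are equally many. *)
Lemma cotype_card (k : finFieldType) (m d : nat) (a : 'I_d -> nat)
    (V W : comNzRingType) (pi : V) (tau : W)
    (redV : {rmorphism V -> k}) (redW : {rmorphism W -> k}) :
  is_dvr pi redV -> is_dvr tau redW -> (0 < m)%N -> (forall i, a i <= m)%N ->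
  exists2 n, has_card (@cotype _ pi d a) n
    & has_card (@cotype _ tau d (fun i => m - a i)%N) n.
Proof.
(* The constant digit, on which invertibility depends, exists since m > 0. *)
case: m => // m hV hW _ am.
have [n nV cV] := cotype_count hV am.
have [|p pW cW] := @cotype_count _ m _ _ _ _ hW (fun i => m.+1 - a i)%N.
  by move=> i; rewrite leq_subr.
exists n => //; suff -> : n = p by [].
apply/eqP; rewrite -(eqn_pmul2r (digit_stab_gt0 k m a)) cV -cW.
by rewrite digit_stab_tr.
Qed.

(** * Elementary divisors *)

Section Smith.
Variables (k : finFieldType) (V : comNzRingType) (pi : V).
Variable red : {rmorphism V -> k}.
Hypothesis hV : is_dvr pi red.

(** Replacing the i-th row of the identity by y gives the invertible matrix
    1 + c r, whose inverse is 1 - v c r because r c = y_i - 1. *)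
Lemma primitive_basis d (y : 'rV[V]_d.+1) i : red (y 0 i) != 0 ->
  exists P Pi : 'M[V]_d.+1, [/\ P *m Pi = 1%:M, Pi *m P = 1%:M
    & y *m P = delta_mx 0 0].
Proof.
move=> /(dvr_unit hV)[v yv].
pose c : 'cV[V]_d.+1 := delta_mx i 0; pose r : 'rV[V]_d.+1 := y - delta_mx 0 i.
have rc : r *m c = (y 0 i - 1)%:M.
  rewrite -colE; apply/matrixP => i1 j1; rewrite !ord1 !mxE !eqxx /=.
  by rewrite mulr1n.
pose Q := 1%:M + c *m r; pose Qi := 1%:M - v *: (c *m r).
have crcr : (c *m r) *m (c *m r) = (y 0 i - 1) *: (c *m r).
  by rewrite -mulmxA (mulmxA r) rc mul_scalar_mx -scalemxAr.
have QM : Q *m (c *m r) = y 0 i *: (c *m r).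
  rewrite mulmxDl mul1mx crcr -{1}[c *m r]scale1r -scalerDl.
  by rewrite addrC subrK.
have MQ : (c *m r) *m Q = y 0 i *: (c *m r).
  rewrite mulmxDr mulmx1 crcr -{1}[c *m r]scale1r -scalerDl.
  by rewrite addrC subrK.
have QQi : Q *m Qi = 1%:M.
  by rewrite mulmxBr mulmx1 -scalemxAr QM scalerA mulrC yv scale1r addrK.
have QiQ : Qi *m Q = 1%:M.
  by rewrite mulmxBl mul1mx -scalemxAl MQ scalerA mulrC yv scale1r addrK.
have yQ : delta_mx 0 i *m Q = y.
  have ec : (delta_mx 0 i : 'rV[V]_d.+1) *m c = 1%:M.
    rewrite -rowE; apply/matrixP => i1 j1; rewrite !ord1 !mxE !eqxx /=.
    by rewrite mulr1n.
  by rewrite mulmxDr mulmx1 mulmxA ec mul1mx addrC subrK.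
exists (Qi *m tperm_mx i 0), (tperm_mx i 0 *m Q); split.
- by rewrite mulmxA -(mulmxA Qi) -perm_mxM tperm2 perm_mx1 mulmx1.
- by rewrite mulmxA -(mulmxA (tperm_mx i 0)) QQi mulmx1 -perm_mxM tperm2 perm_mx1.
rewrite mulmxA -{1}yQ -(mulmxA _ Q) QQi mulmx1.
by rewrite -rowE; apply/rowP => j; rewrite !mxE tpermL eqxx eq_sym.
Qed.

Local Notation pdvd := (pdvd pi).
Local Notation box := (box pi).
Local Notation cotype := (cotype pi).

Lemma cotype_mulmx d (a : 'I_d -> nat) L (P Pi : 'M[V]_d) :
  P *m Pi = 1%:M -> Pi *m P = 1%:M ->
  cotype a [set x | L (x *m Pi)] -> cotype a L.
Proof.
move=> PPi PiP [U [Ui [UUi UiU LE]]]; exists (U *m Pi), (P *m Ui); split.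
- by rewrite mulmxA -(mulmxA U) PiP mulmx1.
- by rewrite mulmxA -(mulmxA P) UiU mulmx1.
by move=> x; rewrite mulmxA -LE /= -mulmxA PPi mulmx1.
Qed.

Lemma cotype_perm d (a : 'I_d -> nat) L (s : 'S_d) :
  cotype a L -> cotype (a \o s) L.
Proof.
move=> [U [Ui [UUi UiU LE]]].
exists (perm_mx s *m U), (Ui *m perm_mx s^-1); split.
- by rewrite mulmxA -(mulmxA _ U) UUi mulmx1 -perm_mxM mulgV perm_mx1.
- by rewrite mulmxA -(mulmxA Ui) -perm_mxM mulVg perm_mx1 mulmx1.
move=> x; rewrite LE mulmxA -col_permE; split=> bx i; first by rewrite mxE; exact: bx.
by have := bx (s^-1 i)%g; rewrite mxE /= permKV.
Qed.

(** The second case supplies a vector of least valuation, from which an adapted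
    basis is started. *)
Lemma box_pi_split d (L : set 'rV[V]_d) n :
  (forall x, L x -> box (fun=> n) x) \/
  (exists2 a, (a < n)%N & (forall x, L x -> box (fun=> a) x) /\
     exists x, [/\ L x & exists i, ~ pdvd a.+1 (x 0 i)]).
Proof.
elim: n => [|n [IH|[a lt_an aP]]]; first by left=> x _ i; exact: pdvd_n0.
  have [bx|/existsNP[x /not_implyP[Lx /existsNP[i xi]]]] :=
    pselect (forall x, L x -> box (fun=> n.+1) x); first by left.
  by right; exists n => //; split=> //; exists x; split=> //; exists i.
by right; exists a; rewrite 1?ltnW.
Qed.

(** Induction on d: if x = pi^a y in L has the smallest possible a, then y is
    primitive, a change of basis makes it e_0, and L splits as
    pi^a V e_0 + (L intersected with the last coordinates). *)
Lemma smith_form m d (L : set 'rV[V]_d) : is_submodule L ->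
  (forall x, box (fun=> m) x -> L x) ->
  exists2 a, (forall i, a i <= m)%N & cotype a L.
Proof.
elim: d L => [|d IH] L sL mL.
  exists (fun=> 0%N) => //; exists 1%:M, 1%:M; rewrite mulmx1; split=> // x.
  by split=> _; [move=> []|apply: mL => -[]].
have [Lm|[a lt_am [La [x [Lx [i xi]]]]]] := box_pi_split L m.
  exists (fun=> m) => //; exists 1%:M, 1%:M; rewrite mulmx1; split=> // y.
  by rewrite mulmx1; split; [exact: Lm|exact: mL].
have [y xE] : exists y, x = pi ^+ a *: y.
  have /choice[f fP] j := La x Lx j; exists (\row_j f j).
  by apply/rowP => j; rewrite !mxE fP mulrC.
have [|P [Pi [PPi PiP yP]]] := @primitive_basis _ y i.
  apply/eqP => /(pdvd1 hV) yi; apply: xi.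
  by rewrite xE mxE -addn1; apply: pdvdM => //; exists 1; rewrite mul1r.
pose L1 := [set z : 'rV[V]_d.+1 | L (z *m Pi)].
suff [b bm bL1] : exists2 b, (forall i, b i <= m)%N & cotype b L1.
  by exists b => //; exact: (cotype_mulmx PPi PiP bL1).
have sL1 : is_submodule L1.
  case: sL => L0 LZ; split; first by rewrite /L1 /= mul0mx.
  by move=> c u v; rewrite /L1 /= mulmxDl -scalemxAl; exact: LZ.
have L1_e : L1 (pi ^+ a *: delta_mx 0 0).
  by rewrite /L1 /= -yP scalemxAl -xE -mulmxA PPi mulmx1.
have L1_a z : L1 z -> pdvd a (z 0 0).
  by move=> /La/(box_mulmx P)/(_ 0); rewrite -mulmxA PiP mulmx1.
pose emb (z : 'rV[V]_d) : 'rV[V]_d.+1 := row_mx (0 : 'rV_1) z.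
have embl z (j : 'I_1) : emb z 0 (lshift d j) = 0.
  by rewrite [LHS](row_mxEl (0 : 'rV_1) z 0 j) mxE.
have embr z j : emb z 0 (rshift 1 j) = z 0 j.
  by rewrite [LHS](row_mxEr (0 : 'rV_1) z 0 j).
have embE z : L1 z <-> pdvd a (z 0 0) /\ L1 (emb (rsubmx (z : 'rV_(1 + d)))).
  have zE c : z 0 0 = c * pi ^+ a ->
      emb (rsubmx (z : 'rV_(1 + d))) = - c *: (pi ^+ a *: delta_mx 0 0) + z.
    move=> zc; apply/rowP => j; case: (splitP (j : 'I_(1 + d))) => j' jE.
      have -> : j = 0 by apply/val_inj; rewrite /= jE ord1.
      have e0 : (0 : 'I_d.+1) = lshift d (0 : 'I_1) by apply/val_inj.
      by rewrite [in LHS]e0 embl !mxE eqxx mulr1 zc mulNr addNr.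
    have -> : j = rshift 1 j' by apply/val_inj; rewrite /= jE.
    by rewrite embr !mxE /= !mulr0 add0r.
  split=> [Lz|[[c zc] Lz]].
    have [c zc] := L1_a z Lz; split; first by exists c.
    by rewrite (zE c) //; apply: sL1.2.
  have := sL1.2 c _ _ L1_e Lz; rewrite (zE c) // addrA -scalerDl addrN scale0r.
  by rewrite add0r.
pose L2 := [set z | L1 (emb z)].
have embD c u v : emb (c *: u + v) = c *: emb u + emb v.
  rewrite -[RHS]/(c *: row_mx (0 : 'rV_1) u + row_mx 0 v : 'rV_(1 + d)).
  by rewrite scale_row_mx add_row_mx scaler0 addr0.
have [||b bm [U [Ui [UUi UiU L2E]]]] := IH L2.
- split; first by rewrite /L2 /= /emb row_mx0; exact: sL1.1.
  by move=> c u v; rewrite /L2 /= embD; exact: sL1.2.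
- move=> z bz; apply: mL; apply: box_mulmx => j.
  case: (splitP (j : 'I_(1 + d))) => j' jE.
    have -> : j = lshift d j' by apply/val_inj; rewrite /= jE.
    by rewrite embl; exact: pdvd0.
  have -> : j = rshift 1 j' by apply/val_inj; rewrite /= jE.
  by rewrite embr; exact: bz.
pose a' (i : 'I_(1 + d)) := match split i with inl _ => a | inr j => b j end.
exists a' => [j|]; first by rewrite /a'; case: split => // _; exact: ltnW.
have blk (A B : 'M[V]_d) : A *m B = 1%:M ->
    block_mx (1%:M : 'M_1) 0 0 A *m block_mx (1%:M : 'M_1) 0 0 B = 1%:M.
  move=> AB; rewrite mulmx_block !mulmx0 !mul0mx !addr0 add0r mulmx1 AB.
  by rewrite -scalar_mx_block.
exists (block_mx (1%:M : 'M_1) 0 0 U), (block_mx (1%:M : 'M_1) 0 0 Ui); split.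
- exact: blk UUi.
- exact: blk UiU.
move=> z; rewrite embE.
have -> : L1 (emb (rsubmx (z : 'rV_(1 + d)))) <-> box b (rsubmx (z : 'rV_(1 + d)) *m Ui).
  exact: L2E.
have zU : (z : 'rV_(1 + d)) *m block_mx (1%:M : 'M_1) 0 0 Ui
    = row_mx (lsubmx (z : 'rV_(1 + d))) (rsubmx (z : 'rV_(1 + d)) *m Ui).
  by rewrite -{1}[z](@hsubmxK _ 1 1 d) mul_row_block !mulmx0 mulmx1 addr0 add0r.
rewrite [z *m _]zU; set w := row_mx _ _.
have wl (j : 'I_1) : w 0 (lshift d j) = z 0 0.
  by rewrite [LHS](row_mxEl _ _ 0 j) mxE ord1; congr (z _ _); apply/val_inj.
have wr j : w 0 (rshift 1 j) = (rsubmx (z : 'rV_(1 + d)) *m Ui) 0 j.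
  by rewrite [LHS](row_mxEr _ _ 0 j).
split=> [[z0a bz] j|bz].
  rewrite /a'; case: splitP => j' jE.
    have -> : j = lshift d j' by apply/val_inj; rewrite /= jE.
    by rewrite wl.
  have -> : j = rshift 1 j' by apply/val_inj; rewrite /= jE.
  by rewrite wr; exact: bz.
split; first by have := bz (lshift d (0 : 'I_1)); rewrite wl /a' (unsplitK (inl _ 0)).
by move=> j; have := bz (rshift 1 j); rewrite wr /a' (unsplitK (inr _ j)).
Qed.

End Smith.

(** * Types of modules *)

Definition nonincreasing d (a : 'I_d -> nat) : Prop :=
  forall i j : 'I_d, (i <= j)%N -> (a j <= a i)%N.

Lemma nonincr_perm d (a : 'I_d -> nat) : exists s : 'S_d, nonincreasing (a \o s).
Proof.
pose t := [tuple a i | i < d].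
have /tuple_permP[s sE] : perm_eq (sort_tuple geq t) t by rewrite perm_sort.
exists s => i j leij.
have nthE l : nth 0%N (sort geq t) l = nth 0%N (sort_tuple geq t) l by [].
have tE (l : 'I_d) : a (s l) = nth 0%N (sort geq t) l.
  by rewrite nthE sE -tnth_nth !tnth_mktuple.
rewrite /= !tE; apply: (sorted_leq_nth (leT := geq)) => //.
- by move=> x y z /= yx xz; apply: leq_trans xz yx.
- by move=> x /=.
- by apply: sort_sorted => x y; exact: leq_total.
- by rewrite inE size_sort size_tuple.
- by rewrite inE size_sort size_tuple.
Qed.

Lemma nonincr_sorted d m (mu : d.-tuple 'I_m.+1) :
  sorted geq (map val mu) <-> nonincreasing (fun i => val (tnth mu i)).
Proof.
have nthE (i : 'I_d) : val (tnth mu i) = nth 0%N (map val mu) i.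
  by rewrite -[LHS](tnth_map val) (tnth_nth 0%N).
split=> [smu i j leij|mu_ni].
  rewrite !nthE; apply: (sorted_leq_nth (leT := geq)) => //.
  - by move=> x y z /= yx xz; apply: leq_trans xz yx.
  - by move=> x /=.
  - by rewrite inE size_map size_tuple.
  - by rewrite inE size_map size_tuple.
apply/(sortedP 0%N) => i; rewrite size_map size_tuple => lti /=.
have := mu_ni (Ordinal (ltnW lti)) (Ordinal lti) (leqnSn i).
by rewrite !nthE.
Qed.

Section Types.
Variables (k : finFieldType) (V : comNzRingType) (pi : V).
Variable red : {rmorphism V -> k}.
Hypothesis hV : is_dvr pi red.
Local Notation pdvd := (pdvd pi).
Local Notation box := (box pi).
Local Notation cotype := (cotype pi).

(** Both f and g present the same module modulo Z. If nu i exceeded mu i = c,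
    multiplication by pi^c would kill all generators but the first i on the f
    side, and keep the first i + 1 independent modulo pi on the g side. The
    change of generators would then factor the identity of k^(i+1) through
    k^i. *)
Lemma type_le (M : lmodType V) (Z : set M) d (mu nu : 'I_d -> nat)
    (f g : {linear 'rV[V]_d -> M}) :
  is_submodule Z -> nonincreasing mu -> nonincreasing nu ->
  (forall x, Z (f x) <-> box mu x) -> (forall x, Z (g x) <-> box nu x) ->
  (forall x, exists y, Z (f x - g y)) -> (forall x, exists y, Z (g x - f y)) ->
  forall i, (nu i <= mu i)%N.
Proof.
move=> sZ muN nuN fZ gZ fg gf i; rewrite leqNgt; apply/negP => lt_i.
have gZ' := submodule_subgroup sZ.
(* x j and y l express the generators of each side through the other. *)
set c := mu i.
have /choice[x xP] (j : 'I_d) := gf (delta_mx 0 j).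
have /choice[y yP] (j : 'I_d) := fg (delta_mx 0 j).
have lt_id := ltn_ord i.
pose w (j : 'I_i.+1) : 'I_d := widen_ord lt_id j.
pose w' (l : 'I_i) : 'I_d := widen_ord (ltnW lt_id) l.
have key (j : 'I_d) :
    box nu (pi ^+ c *: (delta_mx 0 j - \sum_(l < i) x j 0 (w' l) *: y (w' l))).
  apply/gZ; rewrite linearZ /= linearB /= linear_sum /=.
  have -> : g (delta_mx 0 j) - \sum_(l < i) g (x j 0 (w' l) *: y (w' l))
    = (g (delta_mx 0 j) - f (x j)) + (f (x j - \sum_(l < i) x j 0 (w' l) *: delta_mx 0 (w' l))
      + \sum_(l < i) x j 0 (w' l) *: (f (delta_mx 0 (w' l)) - g (y (w' l)))).
    have tele (u v z t : M) : u - t = (u - v) + ((v - z) + (z - t)).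
      by rewrite [v - z + _]addrA subrK addrA subrK.
    rewrite [LHS](tele _ (f (x j)) (f (\sum_(l < i) x j 0 (w' l) *: delta_mx 0 (w' l)))).
    rewrite [in RHS]linearB /=; congr (_ + (_ + _)).
    by rewrite linear_sum -sumrB; apply: eq_bigr => l _; rewrite scalerBr !linearZ.
  rewrite scalerDr; apply: subgroupD => //; first exact: submoduleZ.
  rewrite scalerDr; apply: subgroupD => //; last first.
    apply: submoduleZ => //; apply: subgroup_sum => // l _.
    exact: submoduleZ.
  rewrite -linearZ; apply/fZ => l; rewrite !mxE summxE.
  (* pi^c kills the generators e_l with l >= i on the f side. *)
  have [lt_li|le_il] := ltnP l i.
    rewrite (bigD1 (Ordinal lt_li)) //= big1 => [|l' ne]; last first.
      rewrite !mxE eqxx /=; case: eqP => [e|]; last by rewrite mulr0.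
      by case/eqP: ne; apply/val_inj; rewrite /= e.
    rewrite !mxE eqxx /= [w' _](_ : _ = l); last exact/val_inj.
    by rewrite eqxx mulr1 addr0 subrr mulr0; exact: pdvd0.
  apply: pdvdW (muN _ _ le_il) _; rewrite mulrC; exact: pdvd_id.
pose X : 'M[k]_(i.+1, i) := \matrix_(j, l) red (x (w j) 0 (w' l)).
pose Y : 'M[k]_(i, i.+1) := \matrix_(l, j) red (y (w' l) 0 (w j)).
have XY : X *m Y = 1%:M.
  apply/matrixP => j j'; rewrite !mxE.
  have wE : (w j' == w j) = (j' == j) by rewrite -!(inj_eq val_inj).
  have := key (w j) (w j'); rewrite !mxE eqxx andTb wE => /(pdvd_cancel hV).
  have lt_c : (0 < nu (w j') - c)%N.
    by rewrite subn_gt0 (leq_trans lt_i) // nuN //= -ltnS.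
  move=> /(pdvdW lt_c)/(pdvd1 hV); rewrite rmorphB rmorph_nat => /eqP.
  rewrite subr_eq0 eq_sym [j' == j]eq_sym => /eqP <-; rewrite summxE rmorph_sum.
  by apply: eq_bigr => l _; rewrite !mxE rmorphM.
have := mulmx_max_rank X Y; rewrite XY mxrank1.
by rewrite ltnn.
Qed.

Lemma type_unique (M : lmodType V) (Z : set M) d (mu nu : 'I_d -> nat)
    (f g : {linear 'rV[V]_d -> M}) :
  is_submodule Z -> nonincreasing mu -> nonincreasing nu ->
  (forall x, Z (f x) <-> box mu x) -> (forall x, Z (g x) <-> box nu x) ->
  (forall x, exists y, Z (f x - g y)) -> (forall x, exists y, Z (g x - f y)) ->
  mu = nu.
Proof.
move=> sZ muN nuN fZ gZ fg gf; apply/funext => i; apply/eqP; rewrite eqn_leq.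
by rewrite (type_le sZ nuN muN gZ fZ gf fg) (type_le sZ muN nuN fZ gZ fg gf).
Qed.

Lemma cotype_unique d (a b : 'I_d -> nat) L :
  nonincreasing a -> nonincreasing b -> cotype a L -> cotype b L -> a = b.
Proof.
move=> aN bN aL bL; have := aL; have := bL.
move=> [W [Wi [WWi WiW LW]]] [U [Ui [UUi UiU LU]]].
have L0 := (submodule_subgroup (cotype_submodule aL)).1.
apply: (@type_unique 'rV[V]_d L d a b (mulmxr U) (mulmxr W)) => //.
- exact: cotype_submodule aL.
- by move=> x; rewrite LU /= -mulmxA UUi mulmx1.
- by move=> x; rewrite LW /= -mulmxA WWi mulmx1.
- by move=> x; exists (x *m U *m Wi); rewrite /= -[_ *m Wi *m W]mulmxA WiW mulmx1 subrr.
- by move=> x; exists (x *m W *m Ui); rewrite /= -[_ *m Ui *m U]mulmxA UiU mulmx1 subrr.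
Qed.

Lemma smith_form_sorted m d (L : set 'rV[V]_d) : is_submodule L ->
  (forall x, box (fun=> m) x -> L x) ->
  exists2 a, (forall i, a i <= m)%N & nonincreasing a /\ cotype a L.
Proof.
move=> sL mL; have [a am aL] := smith_form hV sL mL.
have [s sa] := nonincr_perm a; exists (a \o s) => [i|]; first exact: am.
by split=> //; exact: cotype_perm.
Qed.

(** The type of K as a function of the index, with no condition on its order. *)
Definition ftype (M : lmodType V) d (mu : 'I_d -> nat) (K : set M) : Prop :=
  exists g : {linear 'rV[V]_d -> M}, range g = K /\ forall x, g x = 0 <-> box mu x.

Section Module.
Variables (M : lmodType V) (m d : nat) (F : {linear 'rV[V]_d -> M}).
Hypothesis F_surj : range F = setT.
Hypothesis F_ker : forall x, F x = 0 <-> box (fun=> m) x.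

(** If L = sum of the pi^(a i) V u_i contains pi^m V^d, then L / pi^m V^d is the
    sum of the V / pi^(m - a i). *)
Lemma cotype_ftype (a : 'I_d -> nat) (K : set M) : (forall i, a i <= m)%N ->
  cotype a (F @^-1` K) -> ftype (fun i => m - a i)%N K.
Proof.
move=> am [U [Ui [UUi UiU KE]]].
pose D := diag_mx (\row_i pi ^+ a i); exists (F \o mulmxr (D *m U)); split.
  apply/seteqP; split=> [_ [x _ <-]|y Ky].
    apply/KE; rewrite /= -!mulmxA UUi mulmx1; apply/boxE; by exists x.
  have [x _ xy] : range F y by rewrite F_surj.
  have /KE/boxE[z ze] : (F @^-1` K) x by rewrite /= xy.
  by exists z => //; rewrite /= mulmxA -ze -mulmxA UiU mulmx1.
move=> x; rewrite F_ker /= mulmxA; split=> [bx i|bx].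
  have := box_mulmx Ui bx; rewrite -(mulmxA _ U) UUi mulmx1 => /(_ i).
  by rewrite mul_mx_diag !mxE mulrC => /(pdvd_cancel hV).
apply: box_mulmx => i; rewrite mul_mx_diag !mxE mulrC; apply/(pdvd_cancel hV).
exact: bx.
Qed.

(** The preimage of K has some cotype a; the type m - a of K that results must
    be mu, up to a permutation, by uniqueness. *)
Lemma ftype_cotype (mu : 'I_d -> nat) (K : set M) :
  is_submodule K -> nonincreasing mu -> ftype mu K ->
  cotype (fun i => m - mu i)%N (F @^-1` K).
Proof.
move=> sK muN Kmu.
have [|x|a am aK] := @smith_form _ _ _ _ hV m _ (F @^-1` K).
- case: sK => K0 KZ; split; first by rewrite /= linear0.
  by move=> c u v Ku Kv; rewrite /= linearP; exact: KZ.
- by move/F_ker => /= ->; case: sK.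
have [s sN] := nonincr_perm (fun i => m - a i)%N.
have aK' := cotype_perm s aK.
have aM i : (a (s i) <= m)%N by exact: am.
have Knu := cotype_ftype aM aK'.
suff muE : mu = (fun i => m - a (s i))%N.
  rewrite muE [X in cotype X](_ : _ = a \o s) //.
  by apply/funext => i /=; rewrite subKn.
have [f [fK fker]] := Kmu; have [g [gK gker]] := Knu.
apply: (@type_unique M [set 0] d _ _ f g) => //.
- by split=> // c u v -> ->; rewrite scaler0 addr0.
- move=> x; have : range g (f x) by rewrite gK -fK; exists x.
  by move=> [y _ yE]; exists y; rewrite /= yE subrr.
- move=> x; have : range f (g x) by rewrite fK -gK; exists x.
  by move=> [y _ yE]; exists y; rewrite /= yE subrr.
Qed.

(** Submodules of M correspond to the lattices between pi^m V^d and V^d. *)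
Lemma ftype_card (mu : 'I_d -> nat) n : (forall i, mu i <= m)%N -> nonincreasing mu ->
  has_card (cotype (fun i => m - mu i)%N) n ->
  has_card [set K : set M | is_submodule K /\ ftype mu K] n.
Proof.
move=> mum muN; have FK L : cotype (fun i => m - mu i)%N L -> F @^-1` (F @` L) = L.
  move=> cL; have sL := submodule_subgroup (cotype_submodule cL).
  apply/seteqP; split=> x; last by exists x.
  move=> [y Ly Fxy]; rewrite -(subrK y x); apply: subgroupD => //.
  have /F_ker bxy : F (x - y) = 0 by rewrite linearB /= -Fxy subrr.
  have [U [Ui [_ _ LE]]] := cL; apply/LE => i.
  exact: pdvdW (leq_subr _ _) (box_mulmx Ui bxy i).
apply: (has_card_bij (f := fun L => F @` L)).
  by move=> L L' /FK {2}<- /FK {2}<- ->.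
move=> K; split=> [[sK Kmu]|[L cL <-]].
  exists (F @^-1` K); first exact: ftype_cotype.
  apply/seteqP; split=> [_ [x Kx <-] //|y Ky].
  by have [x _ xy] : range F y by [rewrite F_surj]; exists x; rewrite //= xy.
split.
  have [L0 LZ] := cotype_submodule cL; split; first by exists 0; rewrite ?linear0.
  by move=> c _ _ [u Lu <-] [v Lv <-]; exists (c *: u + v); rewrite ?linearP //; exact: LZ.
have := @cotype_ftype (fun i => m - mu i)%N (F @` L) _ _.
rewrite FK // [X in ftype X](_ : _ = mu); first by apply=> // i; exact: leq_subr.
by apply/funext => i; rewrite subKn.
Qed.

End Module.

End Types.

Lemma has_type_ftype (W : idomainType) (tau : W) (M : lmodType W) (N : set M) s d :
  size s = d ->
  has_type tau N s <-> ftype tau (fun i : 'I_d => nth 0%N s i) N.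
Proof. by move=> <-. Qed.


(** * Counting lattices *)

(** The coefficients of the product of the 1 / (1 - q^i z) for i < d. *)
Fixpoint lattice_count (q d n : nat) : nat :=
  if d is d'.+1 then (\sum_(j < n.+1) q ^ j * lattice_count q d' j)%N else (n == 0)%N.

Section Lattices.
Variables (k : finFieldType) (V : comNzRingType) (pi : V).
Variable red : {rmorphism V -> k}.
Hypothesis hV : is_dvr pi red.
Local Notation q := #|k|.
Local Notation pdvd := (pdvd pi).
Local Notation box := (box pi).
Local Notation cotype := (cotype pi).

Lemma card_field_gt1 : (1 < q)%N.
Proof. by apply/card_gt1P; exists 0, 1; rewrite eq_sym oner_eq0. Qed.

(** Two of the vectors x, pi x, ..., pi^n x agree modulo L, and
    pi^i - pi^j = pi^i (1 - pi^(j-i)) is a unit times pi^i. *)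
Lemma finite_index_box d (L : set 'rV[V]_d) n :
  is_submodule L -> has_index setT L n -> forall x, box (fun=> n) x -> L x.
Proof.
move=> sL [s [us sP] sn]; have gL := submodule_subgroup sL.
have piL x : L (pi ^+ n *: x).
  have : ~~ uniq [seq coset_set L (pi ^+ i *: x) | i <- iota 0 n.+1].
    apply/negP => us'; have := uniq_leq_size (s2 := s) us'.
    rewrite size_map size_iota sn ltnn => H; suff : false by []; apply: H.
    by move=> _ /mapP[i _ ->]; apply/sP; exists (pi ^+ i *: x).
  case/(uniqPn set0) => i [j [lt_ij]]; rewrite size_map size_iota => lt_jn.
  have lt_in := ltn_trans lt_ij lt_jn.
  rewrite !(nth_map 0%N) ?size_iota // !nth_iota // !add0n.
  move=> /(coset_set_eq _ _ gL).
  have [|v uv] := dvr_unit hV (u := 1 - pi ^+ (j - i)).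
    rewrite rmorphB rmorph1 rmorphXn /=.
    have -> : red pi = 0 by apply/(dvr_redK hV); exists 1; rewrite mul1r.
    by rewrite expr0n subn_eq0 leqNgt lt_ij /= subr0 oner_neq0.
  have -> : pi ^+ i *: x - pi ^+ j *: x = (1 - pi ^+ (j - i)) *: (pi ^+ i *: x).
    by rewrite scalerBl scale1r scalerA -exprD subnK // ltnW.
  move=> Lij.
  have le_in : (i <= n)%N by [].
  rewrite -(subnK le_in) exprD -scalerA; apply: (submoduleZ sL).
  by have := submoduleZ sL v Lij; rewrite scalerA mulrC uv scale1r.
move=> x bx; rewrite [x]row_sum_delta; apply: subgroup_sum => // i _.
by have [c ->] := bx i; rewrite -scalerA; apply: (submoduleZ sL).
Qed.

Definition lattice d n : set (set 'rV[V]_d) :=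
  [set L | is_submodule L /\ has_index setT L (q ^ n)%N].

Lemma lattice_cotype d (L : set 'rV[V]_d) n :
  is_submodule L -> has_index setT L n ->
  exists a, [/\ cotype a L, n = (q ^ \sum_i a i)%N, lattice (\sum_i a i) L
    & forall x, box (fun=> n) x -> L x].
Proof.
move=> sL Ln; have bL := finite_index_box sL Ln.
have [a _ aL] := smith_form hV sL bL; have La := cotype_index hV aL.
by exists a; split=> //; exact: has_index_inj Ln La.
Qed.

Lemma ideal_pdvd N (I : set V) : I 0 -> (forall c x y, I x -> I y -> I (c * x + y)) ->
  I (pi ^+ N) -> exists b, I = pdvd b.
Proof.
elim: N I => [|N IH] I I0 IM IN.
  exists 0%N; apply/seteqP; split=> x _; first exact: pdvd_n0.
  by rewrite -[x]addr0 -[x]mulr1; exact: IM.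
have [all_pi|/existsNP[u /not_implyP[Iu u1]]] := pselect (forall x, I x -> pdvd 1 x).
  have [|||b bI] := IH [set x | I (pi * x)].
  - by rewrite /= mulr0.
  - by move=> c x y Ix Iy; rewrite /= mulrDr mulrCA; exact: IM.
  - by rewrite /= -exprS.
  exists b.+1; apply/seteqP; split=> x.
    move=> Ix; have [y xE] := all_pi x Ix.
    have : pdvd b y by rewrite -bI /= mulrC -[pi]expr1 -xE.
    by rewrite xE -addn1 => by_; apply: pdvdM => //; exists 1; rewrite mul1r.
  move=> [y ->]; rewrite exprS mulrCA.
  by have : pdvd b (y * pi ^+ b) by [exact: pdvd_id]; rewrite -bI.
exists 0%N; apply/seteqP; split=> x _; first exact: pdvd_n0.
have [|v uv] := dvr_unit hV (u := u); first by apply/eqP => /(pdvd1 hV).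
have := IM (x * v) u 0 Iu I0.
by rewrite addr0 -mulrA [v * u]mulrC uv mulr1.
Qed.

Section Step.
Variable d : nat.
Let hd (x : 'rV[V]_d.+1) : V := x 0 ord0.
Let hdD c x y : hd (c *: x + y) = c * hd x + hd y.
Proof. by rewrite /hd !mxE. Qed.
Let hdB x y : hd (x - y) = hd x - hd y.
Proof. by rewrite /hd !mxE. Qed.
Let hd0 : hd 0 = 0.
Proof. by rewrite /hd mxE. Qed.
Let tl (x : 'rV[V]_d.+1) : 'rV[V]_d := \row_j x 0 (lift ord0 j).
Let mk (c : V) (z : 'rV[V]_d) : 'rV[V]_d.+1 :=
  \row_i if unlift ord0 i is Some j then z 0 j else c.

Let hd_mk c z : hd (mk c z) = c.
Proof. by rewrite /hd mxE unlift_none. Qed.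
Let tl_mk c z : tl (mk c z) = z.
Proof. by apply/rowP => j; rewrite !mxE liftK. Qed.
Let mkE x : mk (hd x) (tl x) = x.
Proof. by apply/rowP => i; rewrite mxE; case: unliftP => [j|] ->; rewrite ?mxE. Qed.
Let mk_lin c u v x y : mk (c * u + v) (c *: x + y) = c *: mk u x + mk v y.
Proof. by apply/rowP => i; rewrite !mxE; case: unliftP => [j|] _; rewrite ?mxE. Qed.
Let tl_lin c x y : tl (c *: x + y) = c *: tl x + tl y.
Proof. by apply/rowP => i; rewrite !mxE. Qed.

Let slice (L : set 'rV[V]_d.+1) : set 'rV[V]_d := [set z | L (mk 0 z)].

Let slice_submodule L : is_submodule L -> is_submodule (slice L).
Proof.
move=> [L0 LZ]; split.
  rewrite /slice /= (_ : mk 0 0 = 0) //.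
  by apply/rowP => i; rewrite !mxE; case: unliftP => [j|] _; rewrite ?mxE.
move=> c u v Lu Lv; rewrite /slice /= -[X in mk X](addr0 0) -{1}(mulr0 c) mk_lin.
exact: LZ.
Qed.

Let lattice_split L n b j : is_submodule L ->
  (hd @` L) = pdvd b -> lattice j (slice L) -> has_index setT L n ->
  n = (q ^ (b + j))%N.
Proof.
move=> sL hdL [_ Lj] Ln; apply: has_index_inj Ln _; rewrite expnD.
have gL := submodule_subgroup sL.
apply: (@has_index_ext _ _ hd) => //.
- rewrite hdL [X in has_index X](_ : _ = setT); first exact: pdvd_index hV b.
  by apply/seteqP; split=> // c _; exists (mk c 0); rewrite ?hd_mk.
have [_ _] := slice_submodule sL.
apply/(has_index_map (phi := tl) (A' := setT) (B' := slice L)) => //.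
- split; first by split; [exact: subgroup0|exact: hd0].
  move=> x y [Lx /= x0] [Ly /= y0]; split; first exact: subgroupB.
  by rewrite /= hdB x0 y0 subrr.
- exact: submodule_subgroup (slice_submodule sL).
- move=> x y [_ /= x0] [_ /= y0].
  have -> : tl x - tl y = tl (x - y) by apply/rowP => i; rewrite !mxE.
  have xy0 : hd (x - y) = 0 by rewrite hdB x0 y0 subrr.
  by rewrite /slice /= -xy0 mkE; split=> [[]|].
move=> y _; exists (mk 0 y); first by split=> //=; exact: hd_mk.
by rewrite tl_mk subrr; exact: (slice_submodule sL).1.
Qed.

Let hd_pdvd L n : is_submodule L -> has_index setT L n ->
  exists b, (hd @` L) = pdvd b.
Proof.
move=> sL Ln; have [L0 LZ] := sL.
apply: (@ideal_pdvd n); first by exists 0; rewrite ?hd0.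
  move=> c _ _ [x Lx <-] [y Ly <-]; exists (c *: x + y); first exact: LZ.
  exact: hdD.
exists (mk (pi ^+ n) 0); last exact: hd_mk.
apply: (finite_index_box sL Ln) => i; rewrite mxE.
by case: unliftP => [j|] _; [rewrite mxE; exact: pdvd0|exists 1; rewrite mul1r].
Qed.

Let slice_lattice L n : is_submodule L -> has_index setT L n ->
  exists j, lattice j (slice L).
Proof.
move=> sL Ln; have [||a _ aL] := @smith_form _ _ _ _ hV n _ (slice L).
- exact: slice_submodule.
- move=> z bz; apply: (finite_index_box sL Ln) => i; rewrite mxE.
  by case: unliftP => [j|] _; [exact: bz|exact: pdvd0].
by exists (\sum_i a i)%N; split; [exact: slice_submodule|exact: (cotype_index hV aL)].
Qed.

(** Such an L has first coordinates pi^a V by multiplicativity of the index. It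
    is generated by the vectors (0, y) with y in L' and by one vector
    (pi^a, r), where only the class of r modulo L' matters. *)
Let slice_fiber L' a j : lattice j L' ->
  has_card [set L | lattice (a + j) L /\ slice L = L'] (q ^ j)%N.
Proof.
move=> [sL' jL']; have gL' := submodule_subgroup sL'.
(* ext r is generated by L' and (pi^a, r); g does the same for a whole class. *)
pose ext r : set 'rV[V]_d.+1 :=
  [set x | exists2 c, hd x = c * pi ^+ a & L' (tl x - c *: r)].
have extE r s : L' (r - s) -> ext r `<=` ext s.
  move=> rs x [c xc Lx]; exists c => //.
  have -> : tl x - c *: s = (tl x - c *: r) + c *: (r - s).
    by rewrite scalerBr addrA subrK.
  by apply: subgroupD => //; exact: submoduleZ.
have ext_sub r : is_submodule (ext r).
  split.
    exists 0; rewrite ?mul0r ?hd0 // scale0r subr0.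
    have -> : tl 0 = 0 by apply/rowP => i; rewrite !mxE.
    exact: sL'.1.
  move=> c x y [u xu Lx] [v yv Ly]; exists (c * u + v).
    by rewrite hdD xu yv mulrDl mulrA.
  rewrite tl_lin scalerDl -scalerA opprD addrACA -scalerBr.
  exact: sL'.2.
have ext_slice r : slice (ext r) = L'.
  apply/seteqP; split=> z.
    move=> [c]; rewrite hd_mk tl_mk mulrC -(mulr0 (pi ^+ a)) => /(pi_expI hV) <-.
    by rewrite scale0r subr0.
  move=> Lz; exists 0; first by rewrite hd_mk mul0r.
  by rewrite tl_mk scale0r subr0.
have ext_hd r : (hd @` ext r) = pdvd a.
  apply/seteqP; split=> [_ [x [c xc _] <-]|_ [c ->]]; first by exists c.
  exists (mk (c * pi ^+ a) (c *: r)); last exact: hd_mk.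
  exists c; first exact: hd_mk.
  by rewrite tl_mk subrr; exact: subgroup0.
have box_ext r : exists n, forall x, box (fun=> n) x -> ext r x.
  exists (a + q ^ j)%N => x bx; have [c xc] := bx ord0.
  exists (c * pi ^+ (q ^ j)); first by rewrite /hd xc -mulrA -exprD addnC.
  have bL' := finite_index_box sL' jL'; apply: bL' => i.
  rewrite !mxE; apply: (subgroupB (pdvd_subgroup _ _)).
    by apply: pdvdW (bx _); rewrite leq_addl.
  by rewrite mulrC mulrA; apply: pdvd_id.
have ext_lattice r : lattice (a + j) (ext r).
  split=> //; have [n bn] := box_ext r.
  have [b _ bL] := smith_form hV (ext_sub r) bn.
  have idx := cotype_index hV bL; rewrite -(lattice_split (ext_sub r) (ext_hd r) _ idx) //.
  by rewrite ext_slice.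
pose g X : set 'rV[V]_d.+1 := [set x | exists2 r, X r & ext r x].
have gE r : g (coset_set L' r) = ext r.
  apply/seteqP; split=> x; last first.
    by exists r => //; apply/coset_setE; rewrite subrr; exact: subgroup0.
  by move=> [s /coset_setE Ls]; exact: extE.
apply: (has_card_bij (f := g) _ _ jL').
  move=> _ _ [r _ <-] [s _ <-]; rewrite !gE => rs; apply/(coset_set_eq _ _ gL').
  have : ext r (mk (pi ^+ a) r).
    exists 1; rewrite ?hd_mk ?mul1r // tl_mk scale1r subrr; exact: subgroup0.
  rewrite rs => -[c]; rewrite hd_mk tl_mk -{1}[pi ^+ a]mulr1 [c * _]mulrC.
  by move=> /(pi_expI hV) <-; rewrite scale1r.
move=> L; split=> [[[sL Lidx] sliceL]|[_ [r _ <-] <-]]; last first.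
  by rewrite gE; split.
have [b hdL] := hd_pdvd sL Lidx.
have baj : b = a.
  have := lattice_split sL hdL (j := j) _ Lidx; rewrite sliceL => /(_ (conj sL' jL')).
  by move/eqP; rewrite eqn_exp2l ?card_field_gt1 // eqn_add2r => /eqP.
subst b; have : (hd @` L) (pi ^+ a) by rewrite hdL; exists 1; rewrite mul1r.
move=> [x Lx xa]; exists (coset_set L' (tl x)); first by exists (tl x).
have gL := submodule_subgroup sL.
have cut y c : hd y = c * pi ^+ a -> mk 0 (tl y - c *: tl x) = - c *: x + y.
  move=> yc; rewrite -[in RHS](mkE x) -[in RHS](mkE y) -mk_lin xa yc mulNr addNr.
  by rewrite scaleNr addrC.
rewrite gE; apply/seteqP; split=> y.
  move=> [c yc]; rewrite -sliceL /slice /= cut // => Ly.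
  by have := sL.2 c _ _ Lx Ly; rewrite addrA -scalerDl addrN scale0r add0r.
move=> Ly; have : (hd @` L) (hd y) by exists y.
rewrite hdL => -[c yc]; exists c => //.
by rewrite -sliceL /slice /= cut //; exact: sL.2.
Qed.

Lemma lattice_count_step n : (forall j, has_card (@lattice d j) (lattice_count q d j)) ->
  has_card (@lattice d.+1 n) (lattice_count q d.+1 n).
Proof.
move=> IH.
have /choice[e eP] (L : set 'rV[V]_d.+1) :
    exists j, lattice n L -> (j < n.+1)%N /\ lattice j (slice L).
  have [nL|nL] := pselect (lattice n L); last by exists 0%N.
  have [sL idx] := nL; have [j jL] := slice_lattice sL idx; exists j => _; split=> //.
  have [b hdL] := hd_pdvd sL idx; have /eqP := lattice_split sL hdL jL idx.
  by rewrite eqn_exp2l ?card_field_gt1 // => /eqP ->; rewrite ltnS leq_addl.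
have -> : lattice_count q d.+1 n
    = (\sum_(j <- iota 0 n.+1) q ^ j * lattice_count q d j)%N.
  rewrite /= -(big_mkord xpredT (fun j => q ^ j * lattice_count q d j)%N).
  by rewrite /index_iota subn0.
apply: (has_card_fibers (f := e)) => [|L /eP[lt_jn _]|j]; first exact: iota_uniq.
  by rewrite mem_iota.
rewrite mem_iota /= add0n => lt_jn.
have [s [us sP] <-] := IH j.
rewrite mulnC -sum1_size big_distrl /=; under eq_bigr do rewrite mul1n.
apply: (has_card_fibers (f := slice)) => // [L [/eP[_ jL] ej]|L' /sP jL'].
  by apply/sP; rewrite -ej.
apply: has_card_eq (slice_fiber (n - j) jL') => L; rewrite subnK //.
split=> [[nL sliceL]|[[nL _] sliceL]] //; split=> //; split=> //.
have [_ [_ idx]] := eP _ nL; rewrite sliceL in idx.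
have /eqP := has_index_inj idx jL'.2.
by rewrite eqn_exp2l ?card_field_gt1 // => /eqP.
Qed.

End Step.

Lemma lattice_card d n : has_card (@lattice d n) (lattice_count q d n).
Proof.
elim: d n => [|d IH] n; last exact: lattice_count_step.
have T1 (L : set 'rV[V]_0) : is_submodule L -> L = setT.
  by move=> [L0 _]; apply/seteqP; split=> // x _; rewrite [x]thinmx0 //.
have T0 : lattice 0 [set: 'rV[V]_0] by split=> //; exact: has_index1.
case: n => [|n].
  exists [:: setT] => //; split=> // L; rewrite inE; split=> [[/T1 -> //]|/eqP -> //].
exists [::] => //; split=> // L; split=> // -[/T1 -> idx].
have /eqP := has_index_inj idx T0.2.
by rewrite eqn_exp2l ?card_field_gt1.
Qed.

End Lattices.

(** * Skew Hall numbers *)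

Section FpsDvr.
Variable k : fieldType.

Definition fps_red (f : fps k) : k := f 0%N.

Fact fps_red_zmod : zmod_morphism fps_red.
Proof. by []. Qed.
HB.instance Definition _ := GRing.isZmodMorphism.Build _ _ fps_red fps_red_zmod.
Fact fps_red_monoid : monoid_morphism fps_red.
Proof. by split=> // f g; rewrite /fps_red fps_coefM big_ord1. Qed.
HB.instance Definition _ := GRing.isMonoidMorphism.Build _ _ fps_red fps_red_monoid.

Lemma fps_dvr : is_dvr (fpsX : fps k) fps_red.
Proof.
split.
- exact: fpsX_inj.
- by move=> c; exists (fpsC c).
- move=> x; split=> [/fps_divX[y ->]|[y ->]]; first by exists y; rewrite mulrC.
  by rewrite rmorphM [X in _ * X](_ : _ = 0) ?mulr0.
- exact: fps_inv.
Qed.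

End FpsDvr.

Lemma dvr_is_dvr (k : fieldType) (V : idomainType) (pi : V) :
  dvr_with_residue_field pi k -> exists red : {rmorphism V -> k}, is_dvr pi red.
Proof.
move=> [pi0 V_pi [red [redS redK]]]; exists red; split=> //.
  by move=> x y; exact: mulfI.
move=> u u0; have [|n [w [uw uE]]] := V_pi u.
  by apply: contraNneq u0 => ->; rewrite rmorph0.
case: n uE => [|n] uE.
  by exists w^-1; rewrite uE mulr1 divrr.
case/eqP: u0; apply/redK; exists (w * pi ^+ n).
by rewrite uE exprSr mulrA.
Qed.

Section SkewHallCount.
Variables (k : finFieldType) (m d : nat).
Hypothesis m_gt0 : (0 < m)%N.
Variables (V : idomainType) (pi : V).
Hypothesis hV : dvr_with_residue_field pi k.
Variable M : lmodType V.
Hypothesis hM : has_type pi [set: M] (nseq d m).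
Local Notation q := #|k|.

Let part (mu : d.-tuple 'I_m.+1) : 'I_d -> nat := fun i => val (tnth mu i).

Let partE (mu : d.-tuple 'I_m.+1) : (fun i : 'I_d => nth 0%N (map val mu) i) = part mu.
Proof. by apply/funext => i; rewrite /part -(tnth_map val) (tnth_nth 0%N). Qed.

(** From submodules of M to lattices of cotype m - mu in V^d, and from there to
    lattices of cotype mu over power series. *)
Lemma skew_hall_card (mu : d.-tuple 'I_m.+1) : sorted geq (map val mu) ->
  has_card (@cotype _ (fpsX : fps k) d (part mu)) (skew_hall pi M (map val mu)).
Proof.
move=> /nonincr_sorted mu_ni; have [red hred] := dvr_is_dvr hV.
have mum i : (part mu i <= m)%N by rewrite /part -ltnS; exact: ltn_ord.
have [n nV] := @cotype_card _ m d (fun i => m - part mu i)%N _ _ _ _ _ _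
  hred (fps_dvr k) m_gt0 (fun i => leq_subr _ _).
rewrite [X in has_card (cotype _ X)](_ : _ = part mu); last first.
  by apply/funext => i; rewrite subKn.
suff -> : skew_hall pi M (map val mu) = n by [].
have [F [F_surj F_ker]] := iffLR (has_type_ftype pi _ (size_nseq d m)) hM.
have F_ker' x : F x = 0 <-> box pi (fun=> m) x.
  rewrite F_ker; suff -> : (fun i : 'I_d => nth 0%N (nseq d m) i) = (fun=> m) by [].
  by apply/funext => i; rewrite nth_nseq ltn_ord.
have := ftype_card hred F_surj F_ker' mum mu_ni nV.
move=> /(has_card_eq _) H; apply: (has_card_fset (H _ _)).2 => K.
by rewrite /= submod_closedE (has_type_ftype _ _ (d := d)) ?size_map ?size_tuple // partE.
Qed.

(** Both sides group by the partition mu of j that is the cotype of K; the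
    index of K is then q^j. *)
Lemma skew_hall_sum j :
  has_card [set K : set 'rV[fps k]_d | lattice k j K /\
      forall x, box fpsX (fun=> m) x -> K x]
    (\sum_(mu : d.-tuple 'I_m.+1 | sorted geq (map val mu) && (sumn (map val mu) == j))
       skew_hall pi M (map val mu))%N.
Proof.
have hA := fps_dvr k.
pose S := [set K : set 'rV[fps k]_d | lattice k j K /\
      forall x, box fpsX (fun=> m) x -> K x].
have sumE (mu : d.-tuple 'I_m.+1) : sumn (map val mu) = (\sum_i part mu i)%N.
  by rewrite sumnE big_map big_tuple.
have /choice[ty tyP] (K : set 'rV[fps k]_d) : exists mu : d.-tuple 'I_m.+1, S K ->
    [/\ sorted geq (map val mu), sumn (map val mu) == j & cotype fpsX (part mu) K].
  have [[[sK Kj] mK]|nK] := pselect (S K); last by exists [tuple ord0 | i < d].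
  have [a am [aN aK]] := smith_form_sorted hA sK mK.
  pose mu := [tuple (inord (a i) : 'I_m.+1) | i < d].
  have muE : part mu = a.
    by apply/funext => i; rewrite /part tnth_mktuple /= inordK // ltnS.
  exists mu => _; split; last by rewrite muE.
    by apply/nonincr_sorted; rewrite -/(part mu) muE.
  rewrite sumE muE -(@eqn_exp2l q) ?card_field_gt1 //; apply/eqP.
  exact: has_index_inj (cotype_index hA aK) Kj.
rewrite -[X in has_card _ X]big_filter.
apply: (has_card_fibers (f := ty)).
- by rewrite filter_uniq // index_enum_uniq.
- by move=> K /tyP[smu muj _]; rewrite mem_filter smu muj mem_index_enum.
move=> mu; rewrite mem_filter => /andP[/andP[smu /eqP muj] _].
apply: has_card_eq (skew_hall_card smu) => K; split=> [Kmu|[SK tymu]]; last first.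
  by have [_ _] := tyP _ SK; rewrite tymu.
have SK : S K.
  split; first split; first exact: cotype_submodule Kmu.
    by have := cotype_index hA Kmu; rewrite -sumE muj.
  move=> x bx; have [U [Ui [_ _ LE]]] := Kmu; apply/LE => i.
  apply: pdvdW (box_mulmx Ui bx i); rewrite /part -ltnS; exact: ltn_ord.
split=> //; have [sty _ cty] := tyP _ SK.
have := cotype_unique hA (iffLR (nonincr_sorted _) sty) (iffLR (nonincr_sorted _) smu) cty Kmu.
by move=> e; apply/eq_from_tnth => i; apply/val_inj; exact: (congr1 (fun f => f i) e).
Qed.

End SkewHallCount.

(** * Even and odd parts of power series *)

Section EvenOdd.
Variable k : fieldType.
Implicit Types f g a b : fps k.

(** The embedding a |-> a(T^2) of A in O. *)
Definition fps_sq a : fps k := Fps (fun n => if odd n then 0 else a n./2).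
Definition fps_ev f : fps k := Fps (fun n => f n.*2).
Definition fps_od f : fps k := Fps (fun n => f n.*2.+1).

Lemma fps_sqE m a : fps_sq a = cusp_subst m (fpsC a).
Proof. by apply: fpsP => n; rewrite cusp_substC. Qed.

Fact fps_sq_zmod : zmod_morphism fps_sq.
Proof.
move=> a b; apply: fpsP => n; rewrite fps_coefD fps_coefN /=.
by case: ifP; rewrite ?subr0.
Qed.
HB.instance Definition _ := GRing.isZmodMorphism.Build _ _ fps_sq fps_sq_zmod.
Fact fps_sq_monoid : monoid_morphism fps_sq.
Proof.
split.
  have fpsC1 : fpsC (1 : fps k) = 1 by apply: fpsP => -[|n].
  by rewrite (fps_sqE 0) fpsC1 rmorph1.
move=> a b; rewrite !(fps_sqE 0) -rmorphM; congr (cusp_subst _ _).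
by apply: fpsP => n; rewrite fpsCM /=; case: n => //=; rewrite mulr0.
Qed.
HB.instance Definition _ := GRing.isMonoidMorphism.Build _ _ fps_sq fps_sq_monoid.

Lemma fps_sqX : fps_sq fpsX = fpsX ^+ 2.
Proof. by rewrite (fps_sqE 0) -[RHS](cusp_substX k 0). Qed.

Lemma fps_ev_od f : f = fps_sq (fps_ev f) + fpsX * fps_sq (fps_od f).
Proof.
apply: fpsP => n; rewrite fps_coefD fpsXM; case: n => [|n] /=; first by rewrite addr0.
case: (boolP (odd n)) => on /=; first by rewrite addr0 odd_uphalfK.
by rewrite add0r even_halfK.
Qed.

Lemma fps_evE a b : fps_ev (fps_sq a + fpsX * fps_sq b) = a.
Proof.
apply: fpsP => n; rewrite -[LHS]/((fps_sq a + fpsX * fps_sq b) n.*2).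
rewrite fps_coefD fpsXM /= odd_double doubleK.
by case: n => [|n]; rewrite ?addr0 //= odd_double /= addr0.
Qed.

Lemma fps_odE a b : fps_od (fps_sq a + fpsX * fps_sq b) = b.
Proof.
apply: fpsP => n; rewrite -[LHS]/((fps_sq a + fpsX * fps_sq b) n.*2.+1).
rewrite fps_coefD fpsXM /= odd_double /=.
by rewrite add0r doubleK.
Qed.

Fact fps_ev_zmod : zmod_morphism fps_ev.
Proof. by move=> f g; apply: fpsP. Qed.
HB.instance Definition _ := GRing.isZmodMorphism.Build _ _ fps_ev fps_ev_zmod.
Fact fps_od_zmod : zmod_morphism fps_od.
Proof. by move=> f g; apply: fpsP. Qed.
HB.instance Definition _ := GRing.isZmodMorphism.Build _ _ fps_od fps_od_zmod.

End EvenOdd.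

(** The decomposition O^d = A^d + T A^d: [vmk x y] is x(T^2) + T y(T^2). *)
HB.lock Definition vmk (k : fieldType) d (x y : 'rV[fps k]_d) : 'rV[fps k]_d :=
  map_mx (@fps_sq k) x + fpsX *: map_mx (@fps_sq k) y.
HB.lock Definition vev (k : fieldType) d (z : 'rV[fps k]_d) : 'rV[fps k]_d :=
  map_mx (@fps_ev k) z.
HB.lock Definition vod (k : fieldType) d (z : 'rV[fps k]_d) : 'rV[fps k]_d :=
  map_mx (@fps_od k) z.

Section EvenOddVectors.
Variables (k : fieldType) (d : nat).
Implicit Types (x y z : 'rV[fps k]_d) (a : fps k).

Let vunlock := (@vmk.unlock, @vev.unlock, @vod.unlock).

Lemma vmkK z : vmk (vev z) (vod z) = z.
Proof. by apply/rowP => i; rewrite !vunlock !mxE -fps_ev_od. Qed.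
Lemma vevE x y : vev (vmk x y) = x.
Proof. by apply/rowP => i; rewrite !vunlock !mxE fps_evE. Qed.
Lemma vodE x y : vod (vmk x y) = y.
Proof. by apply/rowP => i; rewrite !vunlock !mxE fps_odE. Qed.
Lemma vevB x y : vev (x - y) = vev x - vev y.
Proof. by rewrite !vunlock map_mxB. Qed.
Lemma vodB x y : vod (x - y) = vod x - vod y.
Proof. by rewrite !vunlock map_mxB. Qed.
Lemma vmkB x y x' y' : vmk x y - vmk x' y' = vmk (x - x') (y - y').
Proof. by rewrite !vunlock !map_mxB scalerBr opprD addrACA. Qed.
Lemma vmkD x y x' y' : vmk x y + vmk x' y' = vmk (x + x') (y + y').
Proof. by rewrite !vunlock !map_mxD scalerDr addrACA. Qed.
Lemma vmkZ a x y : fps_sq a *: vmk x y = vmk (a *: x) (a *: y).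
Proof.
by rewrite !vunlock !map_mxZ scalerDr !scalerA [fps_sq a * _]mulrC.
Qed.
Lemma vmkXZ x y : fpsX *: vmk x y = vmk (fpsX *: y) x.
Proof.
by rewrite !vunlock map_mxZ scalerDr scalerA /= fps_sqX addrC.
Qed.
Lemma vmkXnZ m x y :
  fpsX ^+ (2 * m).+1 *: vmk x y = vmk (fpsX ^+ m.+1 *: y) (fpsX ^+ m *: x).
Proof.
rewrite exprSr -scalerA vmkXZ exprM -fps_sqX -rmorphXn vmkZ.
by rewrite scalerA -exprSr.
Qed.
Lemma vmk00 : vmk 0 0 = 0 :> 'rV[fps k]_d.
Proof. by rewrite !vunlock !map_mx0 scaler0 addr0. Qed.
Lemma vev0 : vev 0 = 0 :> 'rV[fps k]_d.
Proof. by rewrite !vunlock map_mx0. Qed.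
Lemma vod0 : vod 0 = 0 :> 'rV[fps k]_d.
Proof. by rewrite !vunlock map_mx0. Qed.

End EvenOddVectors.

(** * Submodules over the cuspidal ring *)

Section CuspSubmodules.
Variables (k : finFieldType) (m d : nat).
Local Notation q := #|k|.
Local Notation O := (fps k).
Implicit Types N : set 'rV[O]_d.

(** R-submodules in terms of generators of the image of R in O. *)
Definition cusp_sub N : Prop := [/\ is_subgroup N,
  forall a x, N x -> N (fps_sq a *: x) & forall x, N x -> N (fpsX ^+ (2 * m).+1 *: x)].

Lemma cusp_subP N : is_submodule (N : set (Rtilde_d_cusp k m d)) <-> cusp_sub N.
Proof.
pose pi : fps (fps k) -> cusp k m := \pi_(cusp k m)%qT.
have piE F : cusp_norm (pi F) = cusp_subst m F := cusp_normE m F.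
have scE (r : cusp k m) (x : Rtilde_d_cusp k m d) :
  r *: x = cusp_norm r *: (x : 'rV[O]_d) by [].
split=> [sN|[gN Nsq NX]].
  split; first exact: submodule_subgroup sN.
    move=> a x Nx; have := submoduleZ sN (pi (fpsC a)) Nx.
    by rewrite scE piE -fps_sqE.
  move=> x Nx; have := submoduleZ sN (pi (cuspY k)) Nx.
  by rewrite scE piE cusp_substY.
split; first exact: subgroup0 gN.
move=> r u v Nu Nv; apply: (subgroupD gN) => //; rewrite scE.
have [G [a [b rE]]] := cusp_divE m (repr r).
rewrite /cusp_norm rE !rmorphD !rmorphM /= cusp_subst_eq mulr0 add0r cusp_substY.
rewrite -!fps_sqE scalerDl -scalerA; apply: (subgroupD gN); first exact: Nsq.
by apply: Nsq; exact: NX.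
Qed.

Lemma cusp_sub_subgroup N : cusp_sub N -> is_subgroup N.
Proof. by case. Qed.

(** The O-module generated by N is N + T N, because O = A + T A and T^2 is in
    A. *)
Definition Ospan N : set 'rV[O]_d := [set z | exists x y, [/\ N x, N y & z = x + fpsX *: y]].

Lemma sub_Ospan N : cusp_sub N -> N `<=` Ospan N.
Proof.
move=> [gN _ _] x Nx; exists x, 0; rewrite scaler0 addr0; split=> //.
exact: subgroup0.
Qed.

Lemma Ospan_submodule N : cusp_sub N -> is_submodule (Ospan N).
Proof.
move=> [gN Nsq _]; split.
  by exists 0, 0; rewrite scaler0 addr0; split=> //; exact: subgroup0.
move=> c _ _ [x [y [Nx Ny ->]]] [u [v [Nu Nv ->]]].
exists (fps_sq (fps_ev c) *: x + fps_sq (fpsX * fps_od c) *: y + u).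
exists (fps_sq (fps_od c) *: x + fps_sq (fps_ev c) *: y + v); split.
- by apply: subgroupD => //; apply: subgroupD => //; exact: Nsq.
- by apply: subgroupD => //; apply: subgroupD => //; exact: Nsq.
rewrite {1}[c]fps_ev_od rmorphM /= fps_sqX.
by apply/rowP => i; rewrite !mxE; ring.
Qed.

(** T^(2m) and T^(2m+1) both lie in R, so T^(2m) maps N + T N into N. *)
Lemma conductor N z : cusp_sub N -> Ospan N z -> N (fpsX ^+ (2 * m) *: z).
Proof.
move=> [gN Nsq NX] [x [y [Nx Ny ->]]]; rewrite scalerDr; apply: subgroupD => //.
  by rewrite exprM -fps_sqX -rmorphXn; exact: Nsq.
by rewrite scalerA -exprSr; exact: NX.
Qed.

(** The graph of the A-linear map W : A^d -> A^d / K inside O^d = A^d + T A^d. *)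
Definition graph (K : set 'rV[O]_d) (W : 'M[O]_d) : set 'rV[O]_d :=
  [set z | K (vod z - vev z *m W)].

Definition odd_slice N : set 'rV[O]_d := [set y | N (vmk 0 y)].

Lemma odd_slice_submodule N : cusp_sub N -> is_submodule (odd_slice N).
Proof.
move=> [gN Nsq _]; split.
  rewrite /odd_slice /= (_ : vmk 0 0 = 0); first exact: subgroup0.
  exact: vmk00.
move=> c u v Nu Nv; rewrite /odd_slice /= -[X in vmk X](addr0 0) -vmkD.
apply: (subgroupD gN); last exact: Nv.
have -> : vmk 0 (c *: u) = fps_sq c *: vmk 0 u by rewrite vmkZ scaler0.
exact: Nsq.
Qed.

Definition covers N : Prop := forall x, exists w, N (vmk x w).

(** Every class modulo N has a representative T y(T^2). *)
Lemma covers_index N n : cusp_sub N -> covers N ->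
  has_index setT N n <-> has_index setT (odd_slice N) n.
Proof.
move=> sN cN; have gN := cusp_sub_subgroup sN.
apply: iff_sym; apply: (has_index_map (phi := vmk 0)) => //.
- exact: submodule_subgroup (odd_slice_submodule sN).
- by move=> a b _ _; rewrite vmkB subrr.
move=> z _; have [w Nw] := cN (vev z); exists (vod z - w) => //.
by rewrite -{1}[z]vmkK vmkB subr0 opprB addrC subrK.
Qed.

(** It is the identity modulo X; this is the form in which Nakayama's lemma is
    used. *)
Lemma one_sub_unit (W : 'M[O]_d) :
  exists2 Bi, (1%:M - fpsX *: W) *m Bi = 1%:M & Bi *m (1%:M - fpsX *: W) = 1%:M.
Proof.
apply: (mx_red_unit (fps_dvr k)).
rewrite map_mxB map_mx1 map_mxZ [X in X *: _](_ : _ = 0) ?scale0r ?subr0 ?unitmx1 //.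
Qed.

(** Writing e_i = u + T v with u, v in N, the even part of u is e_i - X w_i with
    w_i the odd part of v. So the image of N in A^d contains the rows of the
    invertible matrix 1 - X W. *)
Lemma Ospan_covers N : cusp_sub N -> Ospan N = setT -> covers N.
Proof.
move=> sN spN; have [gN Nsq _] := sN.
pose E := [set x | exists w, N (vmk x w)].
have sE : is_submodule E.
  split; first by exists 0; exact: (odd_slice_submodule sN).1.
  move=> c u v [w Nw] [w' Nw']; exists (c *: w + w').
  by rewrite -vmkD -vmkZ; apply: subgroupD => //; exact: Nsq.
have /choice[w wP] (i : 'I_d) : exists w, E (delta_mx 0 i - fpsX *: w).
  have : Ospan N (vmk (delta_mx 0 i) 0) by rewrite spN.
  move=> [u [v [Nu Nv]]]; rewrite -[u]vmkK -[v]vmkK vmkXZ vmkD => e.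
  exists (vod v); exists (vod u); move: Nu; rewrite -{1}[u]vmkK.
  by have := congr1 (@vev k d) e; rewrite !vevE => ->; rewrite addrK.
have [Bi _ BiB] := one_sub_unit (\matrix_i w i).
move=> x; suff : E x by [].
have -> : x = x *m Bi *m (1%:M - fpsX *: \matrix_i w i) by rewrite -mulmxA BiB mulmx1.
rewrite mulmx_sum_row; apply: subgroup_sum; first exact: submodule_subgroup.
move=> i _; apply: submoduleZ => //; rewrite linearB /= linearZ /= rowK row1.
exact: wP.
Qed.

(** Y exchanges the two parts up to factors X^(m+1) and X^m, and X^m A^d lies
    in K. *)
Lemma graph_cusp_sub K W : is_submodule K -> (forall x, box fpsX (fun=> m) x -> K x) ->
  cusp_sub (graph K W).
Proof.
move=> sK mK; have gK := submodule_subgroup sK.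
have boxX x : K (fpsX ^+ m *: x).
  by apply: mK => i; rewrite mxE mulrC; exact: pdvd_id.
split.
- split; first by rewrite /graph /= vod0 vev0 mul0mx subr0; exact: subgroup0.
  move=> x y Kx Ky; rewrite /graph /= vodB vevB mulmxBl.
  have -> : forall a b c e : 'rV[O]_d, a - b - (c - e) = (a - c) - (b - e).
    by move=> a b c e; rewrite !opprB ![_ - _ + _]addrACA [- b - c]addrC.
  exact: (subgroupB gK Kx Ky).
- move=> a x Kx; rewrite /graph /= -[x]vmkK vmkZ vodE vevE -scalemxAl -scalerBr.
  exact: submoduleZ.
- move=> x Kx; rewrite /graph /= -[x]vmkK vmkXnZ vodE vevE exprSr -scalerA.
  by rewrite -scalemxAl -scalerBr; exact: boxX.
Qed.

(** Solving z = u + T v with u = (e, e W) and v = (e', e' W) amounts to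
    e' (1 - X W^2) = (odd part of z) - (even part of z) W. *)
Lemma graph_Ospan K W : is_submodule K -> Ospan (graph K W) = setT.
Proof.
move=> sK; apply/seteqP; split=> // z _; have K0 := (submodule_subgroup sK).1.
have [Bi _ BiB] := one_sub_unit (W *m W).
pose e' := (vod z - vev z *m W) *m Bi.
pose e := vev z - fpsX *: (e' *m W).
have graphP x : graph K W (vmk x (x *m W)) by rewrite /graph /= vodE vevE subrr.
exists (vmk e (e *m W)), (vmk e' (e' *m W)); split=> //.
rewrite vmkXZ vmkD -[LHS]vmkK; congr vmk; first by rewrite subrK.
have : e' *m (1%:M - fpsX *: (W *m W)) = vod z - vev z *m W.
  by rewrite -mulmxA BiB mulmx1.
rewrite mulmxBr mulmx1 => e'E.
rewrite mulmxBl -scalemxAl -mulmxA scalemxAr -addrA [- _ + _]addrC e'E.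
by rewrite addrC subrK.
Qed.

Lemma graph_slice K W : odd_slice (graph K W) = K.
Proof.
by apply/seteqP; split=> y; rewrite /odd_slice /graph /= vodE vevE mul0mx subr0.
Qed.

Lemma graph_eqP K W W' : is_submodule K ->
  graph K W = graph K W' <-> forall i, K (row i W - row i W').
Proof.
move=> sK; have gK := submodule_subgroup sK; split=> [e i|KW].
  have : graph K W (vmk (row i 1%:M) (row i W)).
    by rewrite /graph /= vodE vevE -row_mul mul1mx subrr; exact: subgroup0.
  by rewrite e /graph /= vodE vevE -row_mul mul1mx.
have KxW x : K (x *m W - x *m W').
  rewrite -mulmxBr mulmx_sum_row; apply: subgroup_sum => // i _.
  by apply: submoduleZ => //; rewrite linearB /=; exact: KW.
apply/seteqP; split=> z Kz; rewrite /graph /=.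
  have -> : vod z - vev z *m W' = (vod z - vev z *m W) + (vev z *m W - vev z *m W').
    by rewrite addrA subrK.
  exact: subgroupD.
have -> : vod z - vev z *m W = (vod z - vev z *m W') - (vev z *m W - vev z *m W').
  by rewrite opprB addrA subrK.
exact: subgroupB.
Qed.

Lemma covers_graph N : cusp_sub N -> covers N ->
  exists W, N = graph (odd_slice N) W.
Proof.
move=> sN cN; have [gN Nsq _] := sN.
have /choice[w wP] (i : 'I_d) := cN (delta_mx 0 i).
exists (\matrix_i w i).
have Ngr x : N (vmk x (x *m \matrix_i w i)).
  rewrite {1}[x]row_sum_delta mulmx_sum_row.
  elim/big_rec2: _ => [|i y1 y2 _ IH]; first exact: (odd_slice_submodule sN).1.
  by rewrite rowK -vmkD -vmkZ; apply: subgroupD => //; exact: Nsq.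
apply/seteqP; split=> z Nz; rewrite /graph /odd_slice /= in Nz *.
  by rewrite -(subrr (vev z)) -vmkB vmkK; exact: subgroupB.
have := subgroupD gN Nz (Ngr (vev z)).
by rewrite vmkD add0r subrK vmkK.
Qed.

End CuspSubmodules.

(** * Counting cuspidal submodules *)

Lemma has_card_ffun (T : eqType) (S : set T) n d : has_card S n ->
  has_card [set h : {ffun 'I_d -> T} | forall i, S (h i)] (n ^ d)%N.
Proof.
move=> [s [us sS] sn]; case: n => [|n] in sn *.
  case: d => [|d].
    exists [:: [ffun i : 'I_0 => match notF (ltn_ord i) with end]] => //; split=> // h.
    rewrite in_cons orbF; split=> [_|_ []//]; apply/eqP/ffunP => -[]; by [].
  rewrite exp0n //; exists [::] => //; split=> // h; split=> // /(_ ord0)/sS.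
  by case: s sn {us sS}.
have x0 : T by case: s sn {us sS} => // x.
have := has_card_pred (@predT {ffun 'I_d -> 'I_n.+1}).
rewrite card_ffun !card_ord.
apply: (has_card_bij (f := fun e : {ffun 'I_d -> 'I_n.+1} =>
  [ffun i => nth x0 s (e i)] : {ffun 'I_d -> T})).
  move=> e e' _ _ /ffunP ee'; apply/ffunP => i; apply/val_inj/eqP => /=.
  by have /eqP := ee' i; rewrite !ffunE nth_uniq ?sn ?ltn_ord.
move=> h; split=> [hS|[e _ <-] i]; last by rewrite ffunE; apply/sS/mem_nth; rewrite sn.
exists [ffun i => inord (index (h i) s)] => //; apply/ffunP => i; rewrite !ffunE.
have hi : h i \in s by exact/sS.
by rewrite inordK ?nth_index // -sn index_mem.
Qed.

Section CuspCount.
Variables (k : finFieldType) (m d : nat).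
Local Notation q := #|k|.
Local Notation O := (fps k).
Let hO := fps_dvr k.

Definition spanning_sub j : set (set 'rV[O]_d) :=
  [set N | [/\ cusp_sub m N, has_index setT N (q ^ j)%N & Ospan N = setT]].

Definition sublattice j : set (set 'rV[O]_d) :=
  [set K | lattice k j K /\ forall x, box fpsX (fun=> m) x -> K x].

(** The odd vector T x(T^2) with x = X^m y is T^(2m) times an element of O^d. *)
Lemma slice_box (N : set 'rV[O]_d) : cusp_sub m N -> Ospan N = setT ->
  forall x, box fpsX (fun=> m) x -> odd_slice N x.
Proof.
move=> sN spN x bx; have /choice[y yP] i := bx i.
have -> : x = fpsX ^+ m *: \row_i y i by apply/rowP => i; rewrite !mxE yP mulrC.
rewrite /odd_slice /= -(scaler0 _ (fpsX ^+ m)) -vmkZ rmorphXn /= fps_sqX -exprM.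
by apply: conductor sN _; rewrite spN.
Qed.

(** Over a fixed K, the modules are the graphs of the d-tuples of classes
    modulo K. *)
Lemma spanning_card j n : has_card (sublattice j) n -> has_card (spanning_sub j) (n * q ^ (d * j))%N.
Proof.
move=> [s [us sP] <-]; rewrite -sum1_size big_distrl /=; under eq_bigr do rewrite mul1n.
apply: (has_card_fibers (f := @odd_slice k d)) => // [N [sN Nj spN]|K /sP[[sK Kj] mK]].
  apply/sP; split; last exact: slice_box.
  split; first exact: odd_slice_submodule sN.
  exact: iffLR (covers_index _ sN (Ospan_covers sN spN)) Nj.
have gK := submodule_subgroup sK.
rewrite mulnC expnM.
pose g (h : {ffun 'I_d -> set 'rV[O]_d}) : set 'rV[O]_d :=
  [set z | exists2 W, (forall i, h i (row i W)) & graph K W z].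
have gE (h : {ffun 'I_d -> set 'rV[O]_d}) (W : 'M[O]_d) : (forall i, h i = coset_set K (row i W)) -> g h = graph K W.
  move=> hW; apply/seteqP; split=> z; last first.
    move=> Kz; exists W => // i; rewrite hW; apply/coset_setE; rewrite subrr.
    exact: subgroup0.
  move=> [W' W'h]; suff -> : graph K W' = graph K W by [].
  by apply/(graph_eqP _ _ sK) => i; have := W'h i; rewrite hW => /coset_setE.
have hW (h : {ffun 'I_d -> set 'rV[O]_d}) :
    (forall i, (coset_set K @` setT) (h i)) -> exists W, forall i, h i = coset_set K (row i W).
  move=> hK; have /choice[w wP] i : exists w, coset_set K w = h i.
    by have [w _ wE] := hK i; exists w.
  by exists (\matrix_i w i) => i; rewrite rowK wP.
apply: (has_card_bij (f := g) _ _ (has_card_ffun d Kj)).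
  move=> h h' /hW[W Wh] /hW[W' W'h]; rewrite (gE _ _ Wh) (gE _ _ W'h).
  move=> /(graph_eqP _ _ sK) KW; apply/ffunP => i; rewrite Wh W'h.
  exact/(coset_set_eq _ _ gK).
move=> N; split=> [[[sN Nj spN] NK]|[h /hW[W Wh] <-]].
  have [W NE] := covers_graph sN (Ospan_covers sN spN).
  exists [ffun i => coset_set K (row i W)] => [i|].
    by rewrite ffunE; exists (row i W).
  by rewrite (gE _ W) => [|i]; [rewrite NE NK|rewrite ffunE].
rewrite (gE _ _ Wh); have sgr := graph_cusp_sub W sK mK.
have spgr := graph_Ospan W sK; split; last exact: graph_slice.
split=> //; apply: (iffRL (covers_index _ sgr (Ospan_covers sgr spgr))).
by rewrite graph_slice.
Qed.

Lemma cotype_basis (a : 'I_d -> nat) (L : set 'rV[O]_d) : cotype fpsX a L ->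
  exists G : 'M[O]_d, injective (mulmx^~ G : 'rV[O]_d -> _) /\ range (mulmx^~ G) = L.
Proof.
move=> [U [Ui [UUi UiU LE]]].
exists (diag_mx (\row_i fpsX ^+ a i) *m U); split.
  move=> x y /(congr1 (mulmx^~ Ui)) /=; rewrite -!mulmxA UUi !mulmx1.
  rewrite !mul_mx_diag => /rowP xy; apply/rowP => i.
  by have := xy i; rewrite !mxE ![_ * fpsX ^+ _]mulrC => /(pi_expI hO).
apply/seteqP; split=> x.
  move=> [y _ <-]; apply/LE; rewrite -!mulmxA UUi mulmx1; apply/boxE.
  by exists y.
move=> /LE/boxE[z zE]; exists z => //.
by rewrite mulmxA -zE -mulmxA UiU mulmx1.
Qed.

Section Basis.
Variables (L : set 'rV[O]_d) (G : 'M[O]_d).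
Hypothesis GI : injective (mulmx^~ G : 'rV[O]_d -> _).
Hypothesis GL : range (mulmx^~ G) = L.

Lemma basis_push N : cusp_sub m N -> Ospan N = setT ->
  [/\ cusp_sub m (mulmx^~ G @` N), Ospan (mulmx^~ G @` N) = L
   & forall n, has_index setT N n -> has_index L (mulmx^~ G @` N) n].
Proof.
move=> [gN Nsq NX] spN.
have gGN : is_subgroup (mulmx^~ G @` N).
  split; first by exists 0; rewrite ?mul0mx //; exact: subgroup0.
  move=> _ _ [x Nx <-] [y Ny <-]; exists (x - y); rewrite ?mulmxBl //.
  exact: subgroupB.
split.
- split=> //.
    by move=> a _ [x Nx <-]; exists (fps_sq a *: x); rewrite -?scalemxAl //; exact: Nsq.
  by move=> _ [x Nx <-]; exists (fpsX ^+ (2 * m).+1 *: x); rewrite -?scalemxAl //; exact: NX.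
- rewrite -GL; apply/seteqP; split=> [_ [_ [_ [[x Nx <-] [y Ny <-] ->]]]|_ [x _ <-]].
    by exists (x + fpsX *: y) => //; rewrite mulmxDl -scalemxAl.
  have : Ospan N x by rewrite spN.
  move=> [u [v [Nu Nv ->]]]; exists (u *m G), (v *m G).
  by rewrite mulmxDl -scalemxAl; split=> //; [exists u|exists v].
move=> n; apply: iffLR; apply: (has_index_map (phi := mulmx^~ G)) => //.
- by move=> x _; rewrite -GL; exists x.
- move=> x y _ _; rewrite -mulmxBl; split=> [Nxy|[z Nz /GI <-]//].
  by exists (x - y).
- move=> z; rewrite -GL => -[x _ <-]; exists x => //; rewrite subrr.
  exact: subgroup0 gGN.
Qed.

Lemma basis_pull N : cusp_sub m N -> Ospan N = L ->
  exists N0, [/\ cusp_sub m N0, Ospan N0 = setT, mulmx^~ G @` N0 = N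
   & forall n, has_index L N n -> has_index setT N0 n].
Proof.
move=> sN spN; have [gN Nsq NX] := sN; exists (mulmx^~ G @^-1` N).
have NL : N `<=` range (mulmx^~ G) by rewrite GL -spN; exact: sub_Ospan sN.
have gN0 : is_subgroup (mulmx^~ G @^-1` N).
  split; first by rewrite /= mul0mx; exact: subgroup0.
  by move=> x y Nx Ny; rewrite /= mulmxBl; exact: subgroupB.
split.
- split=> // [a x Nx|x Nx]; rewrite /= -scalemxAl; [exact: Nsq|exact: NX].
- apply/seteqP; split=> // x _.
  have : Ospan N (x *m G) by rewrite spN -GL; exists x.
  move=> [u [v [Nu Nv e]]]; have [u0 _ u0E] := NL _ Nu; have [v0 _ v0E] := NL _ Nv.
  exists u0, v0; rewrite /= u0E v0E; split=> //; apply: GI.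
  by rewrite e mulmxDl -scalemxAl u0E v0E.
- apply/seteqP; split=> [_ [x Nx <-] //|x Nx].
  by have [y _ yx] := NL _ Nx; exists y; rewrite //= yx.
move=> n; apply: iffRL; apply: (has_index_map (phi := mulmx^~ G)) => //.
- by move=> x _; rewrite -GL; exists x.
- by move=> x y _ _; rewrite /= mulmxBl.
- move=> z; rewrite -GL => -[x _ <-]; exists x => //; rewrite subrr.
  exact: subgroup0 gN.
Qed.

Lemma spanning_transport j n : has_card (spanning_sub j) n ->
  has_card [set N | [/\ cusp_sub m N, has_index L N (q ^ j)%N & Ospan N = L]] n.
Proof.
apply: (has_card_bij (f := fun N => mulmx^~ G @` N)).
  have sub (N N' : set 'rV[O]_d) : mulmx^~ G @` N = mulmx^~ G @` N' -> N `<=` N'.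
    move=> e x Nx; have : (mulmx^~ G @` N) (x *m G) by exists x.
    by rewrite e => -[y Ny /GI <-].
  by move=> N N' _ _ e; apply/seteqP; split; apply: sub.
move=> N; split=> [[sN Nj spN]|[N0 [sN0 N0j spN0] <-]].
  have [N0 [sN0 spN0 N0N idx]] := basis_pull sN spN.
  by exists N0 => //; split=> //; exact: idx.
by have [? ? idx] := basis_push sN0 spN0; split=> //; exact: idx.
Qed.

End Basis.

(** The first factor comes from the O-lattice O N, the second from the odd slice
    of N in a basis of it. *)
Lemma cusp_index_split (N : set 'rV[O]_d) n : cusp_sub m N -> has_index setT N n ->
  exists i j, [/\ n = (q ^ (i + j))%N, lattice k i (Ospan N)
    & has_index (Ospan N) N (q ^ j)%N].
Proof.
move=> sN Nn; have gN := cusp_sub_subgroup sN.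
have sO := Ospan_submodule sN; have gO := submodule_subgroup sO.
have NO := sub_Ospan sN.
have [[i0 Oi0] [p Np]] := has_index_finer gO gN NO (fun _ _ => I) Nn.
have [a [aO _ Oa _]] := lattice_cotype hO sO Oi0.
have [G [GI GO]] := cotype_basis aO.
have [N0 [sN0 spN0 _ /(_ _ Np) N0p]] := basis_pull GI GO sN erefl.
have cN0 := Ospan_covers sN0 spN0.
have := iffLR (covers_index _ sN0 cN0) N0p.
move=> /(lattice_cotype hO (odd_slice_submodule sN0))[b [_ pE _ _]].
exists (\sum_i a i)%N, (\sum_i b i)%N; split=> //; last by rewrite -pE.
apply: has_index_inj Nn _; rewrite expnD -pE.
by apply: (has_index_mul _ gO gN NO) Oa.2 Np.
Qed.

(** Group the N by the lattice O N, of index q^i; each lattice carries as many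
    N as O^d does. *)
Lemma cusp_card (p : nat -> nat) n : (forall j, has_card (sublattice j) (p j)) ->
  has_card [set N : set 'rV[O]_d | cusp_sub m N /\ has_index setT N (q ^ n)%N]
    (\sum_(i < n.+1) lattice_count q d i * (p (n - i) * q ^ (d * (n - i))))%N.
Proof.
move=> pP; pose S := [set N : set 'rV[O]_d | cusp_sub m N /\ has_index setT N (q ^ n)%N].
have q_gt1 := card_field_gt1 k.
have /choice[e eP] N : exists i, S N -> [/\ (i < n.+1)%N, lattice k i (Ospan N)
    & has_index (Ospan N) N (q ^ (n - i))%N].
  have [[sN Nn]|nS] := pselect (S N); last by exists 0%N.
  have [i [j [/eqP + Oi Nj]]] := cusp_index_split sN Nn.
  rewrite eqn_exp2l // => /eqP nij; exists i => _; rewrite nij ltnS leq_addr; split=> //.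
  by rewrite addKn.
rewrite -(big_mkord xpredT (fun i => lattice_count q d i *
  (p (n - i) * q ^ (d * (n - i))))%N) /index_iota subn0.
apply: (has_card_fibers (f := e)) => [|N /eP[lt_in _ _]|i]; first exact: iota_uniq.
  by rewrite mem_iota.
rewrite mem_iota /= add0n => lt_in.
have [s [us sP] <-] := lattice_card hO d i.
rewrite -sum1_size big_distrl /=; under eq_bigr do rewrite mul1n.
apply: (has_card_fibers (f := @Ospan k d)) => // [N [/eP[_ Oi _] ei]|L /sP Li].
  by apply/sP; rewrite -ei.
have [a [aL _ _ _]] := lattice_cotype hO Li.1 Li.2.
have [G [GI GL]] := cotype_basis aL.
apply: has_card_eq (spanning_transport GI GL (spanning_card (pP (n - i)%N))) => N.
split=> [[sN LN spN]|[[SN eN] spN]].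
  have SN : S N.
    split=> //; rewrite -(subnKC (lt_in : (i <= n)%N)) expnD.
    apply: (has_index_mul _ _ _ _ _ Li.2 LN) => //.
    - exact: submodule_subgroup Li.1.
    - exact: cusp_sub_subgroup sN.
    - by rewrite -spN; exact: sub_Ospan sN.
  split=> //; split=> //; have [_ [_ Oe] _] := eP _ SN.
  rewrite spN in Oe; have /eqP := has_index_inj Oe Li.2.
  by rewrite eqn_exp2l // => /eqP.
split=> //; first exact: SN.1.
by have [_ _] := eP _ SN; rewrite eN spN.
Qed.

End CuspCount.

(** * Generating functions *)

Definition partial_gf (F : pzRingType) (c : nat -> nat) (z : F) (N : nat) : F :=
  \sum_(n < N) (c n)%:R * z ^+ n.

Section LatticeSeries.
Variable q : nat.
Local Notation cl := (lattice_count q).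

Lemma lattice_countS d n : cl d.+1 n.+1 = (cl d.+1 n + q ^ n.+1 * cl d n.+1)%N.
Proof. by rewrite /= big_ord_recr. Qed.

Lemma lattice_count0 d : cl d 0 = 1%N.
Proof. by elim: d => //= d IH; rewrite big_ord_recl big_ord0 IH. Qed.

(** The recursion says that (1 - z) times the generating function in dimension
    d + 1 is the one in dimension d at q z. *)
Lemma gf_latticeS (F : comPzRingType) d (z : F) N :
  (1 - z) * partial_gf (cl d.+1) z N.+1
    = partial_gf (cl d) (q%:R * z) N.+1 - (cl d.+1 N)%:R * z ^+ N.+1.
Proof.
elim: N => [|N IH]; first by rewrite /partial_gf !big_ord1 !lattice_count0 !expr0 expr1; ring.
rewrite {1}/partial_gf big_ord_recr /= -/(partial_gf _ _ _) mulrDr IH.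
rewrite [in RHS]/partial_gf [in RHS]big_ord_recr /= -/(partial_gf _ _ _).
rewrite [(\sum_(j < N.+2) _)%N](_ : _ = cl d.+1 N.+1) // lattice_countS natrD natrM natrX.
by rewrite exprMn !exprS; ring.
Qed.

Lemma gf_lattice_bound (R : realFieldType) d (r : R) : (0 < q)%N -> 0 <= r ->
  ((0 < d)%N -> q%:R ^+ d.-1 * r < 1) ->
  exists B, forall N, partial_gf (cl d) r N <= B.
Proof.
move=> q_gt0; elim: d r => [|d IH] r r0 rd.
  exists 1 => -[|N]; first by rewrite /partial_gf big_ord0.
  rewrite /partial_gf big_ord_recl /= big1 ?addr0 ?expr0 ?mulr1 // => i _.
  by rewrite mul0r.
have {}rd : q%:R ^+ d * r < 1 by exact: rd.
have qr : 0 <= q%:R * r by rewrite mulr_ge0.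
have [|B BP] := IH _ qr.
  by case: d rd {IH} => // d; rewrite exprSr mulrA => + _.
have r1 : r < 1.
  apply: le_lt_trans rd; rewrite -{1}[r]mul1r ler_wpM2r // exprn_ege1 //.
  by rewrite ler1n.
exists (B / (1 - r)) => -[|N].
  rewrite /partial_gf big_ord0 divr_ge0 ?subr_ge0 ?(ltW r1) //.
  by have := BP 0%N; rewrite /partial_gf big_ord0.
rewrite ler_pdivlMr ?subr_gt0 // mulrC gf_latticeS.
apply: le_trans (BP N.+1); rewrite lerBlDr lerDl mulr_ge0 // exprn_ge0 //.
Qed.

End LatticeSeries.

(** A Cauchy product whose second factor is a polynomial, arranged by the
    terms of the polynomial: the partial sums of the first factor are kept
    whole, so that their limit can be taken. *)
Lemma gf_conv (F : comPzRingType) (a b c : nat -> nat) (z : F) J N :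
  (forall n, c n = \sum_(i < n.+1) a i * b (n - i))%N ->
  (forall j, (J <= j)%N -> b j = 0%N) -> (J <= N)%N ->
  partial_gf c z N = \sum_(j < J) (b j)%:R * z ^+ j * partial_gf a z (N - j)%N.
Proof.
move=> cE b0 JN.
have step M : partial_gf c z M = \sum_(j < M) (b j)%:R * z ^+ j * partial_gf a z (M - j)%N.
  elim: M => [|M IH]; first by rewrite /partial_gf !big_ord0.
  rewrite [LHS]/partial_gf big_ord_recr /= -/(partial_gf _ _ _) IH [RHS]big_ord_recr /= subSnn.
  have -> : \sum_(j < M) (b j)%:R * z ^+ j * partial_gf a z (M.+1 - j)%N
     = \sum_(j < M) (b j)%:R * z ^+ j * partial_gf a z (M - j)%N
       + \sum_(j < M) (b j * a (M - j)%N)%:R * z ^+ M.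
    rewrite -big_split; apply: eq_bigr => j _ /=.
    have le_jM : (j <= M)%N by exact: ltnW.
    rewrite subSn // {1}/partial_gf big_ord_recr /= -/(partial_gf _ _ _) mulrDr; congr (_ + _).
    have -> : z ^+ M = z ^+ j * z ^+ (M - j) by rewrite -exprD subnKC.
    by rewrite natrM; ring.
  rewrite -addrA; congr (_ + _); rewrite /partial_gf big_ord1 expr0 mulr1.
  have -> : c M = (\sum_(j < M) b j * a (M - j) + b M * a 0)%N.
    rewrite cE (reindex_inj rev_ord_inj) /= big_ord_recr /= subSS subnn subn0 mulnC.
    congr (_ + _)%N; apply: eq_bigr => j _; have le_jM : (j <= M)%N by exact: ltnW.
    by rewrite subSS subKn // mulnC.
  by rewrite natrD natr_sum mulrDl mulr_suml natrM; congr (_ + _); ring.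
rewrite step (big_ord_widen_cond _ xpredT (fun j => (b j)%:R * z ^+ j * partial_gf a z (N - j)%N) JN).
rewrite [RHS]big_mkcond; apply: eq_bigr => j _ /=.
by case: ltnP => // /b0 ->; rewrite !mul0r.
Qed.

Section Complex.
Variable R : realType.
Local Notation C := (R[i]).

Lemma pos_complexE (e : C) : 0 < e -> e = (complex.Re e)%:C%C /\ 0 < complex.Re e.
Proof. by case: e => a b; rewrite ltcE /= => /andP[/eqP -> a0]. Qed.

(** Partial sums within e of their supremum leave tails at most e. *)
Lemma gf_tail (c : nat -> nat) (r B : R) e : 0 <= r -> (forall N, partial_gf c r N <= B) -> 0 < e ->
  exists N, forall N', (N <= N')%N -> \sum_(N <= n < N') (c n)%:R * r ^+ n <= e.
Proof.
move=> r0 cB e0; pose S := range (partial_gf c r).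
have supS : has_sup S.
  by split; [exists (partial_gf c r 0), 0%N|exists B => _ [N _ <-]].
have [_ [N _ <-] SN] := sup_adherent e0 supS.
exists N => N' le; have : partial_gf c r N' <= sup S by apply: sup_upper_bound => //; exists N'.
rewrite /partial_gf -(big_mkord xpredT (fun n => (c n)%:R * r ^+ n)) (big_cat_nat (leq0n _) le) /=.
rewrite big_mkord -/(partial_gf c r N); lra.
Qed.

Lemma gf_term0 (c : nat -> nat) (t : C) (r B : R) : `|t| = r%:C%C ->
  (forall N, partial_gf c r N <= B) ->
  (fun N => (c N)%:R * t ^+ N : C^o) @ \oo --> (0 : C^o).
Proof.
move=> tr cB; have r0 : 0 <= r by rewrite -(@ler0c R) -tr.
apply/cvgrPdist_le => e /pos_complexE[eE e0].
have [N NP] := gf_tail r0 cB e0; exists N => // n /= le_Nn.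
rewrite sub0r normrN normrM normr_nat normrX tr eE.
rewrite -(rmorph_nat (@real_complex R)) -rmorphXn -rmorphM lecR.
have := NP n.+1 (leqW le_Nn); rewrite big_nat_recr //=; apply: le_trans.
by rewrite lerDr sumr_ge0 // => i _; rewrite mulr_ge0 // exprn_ge0.
Qed.

Lemma gf_lattice_cvg (q : nat) d (t : C) (r : R) : (0 < q)%N -> `|t| = r%:C%C ->
  ((0 < d)%N -> q%:R ^+ d.-1 * r < 1) ->
  (fun N => partial_gf (lattice_count q d) t N : C^o) @ \oo
    --> (\prod_(i < d) (1 - q%:R ^+ i * t)^-1 : C^o).
Proof.
move=> q_gt0; elim: d t r => [|d IH] t r tr rd.
  rewrite big_ord0 -cvg_shiftS; apply: cvg_near_cst; apply: nearW => N.
  rewrite /= /partial_gf big_ord_recl /= big1 ?addr0 ?expr0 ?mulr1 // => i _.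
  by rewrite mul0r.
have r0 : 0 <= r by rewrite -(@ler0c R) -tr.
have {}rd : q%:R ^+ d * r < 1 by exact: rd.
have r1 : r < 1.
  apply: le_lt_trans rd; rewrite -{1}[r]mul1r ler_wpM2r // exprn_ege1 //.
  by rewrite ler1n.
have t1 : 1 - t != 0.
  rewrite subr_eq0; apply/eqP => t1; move: tr; rewrite -t1 normr1.
  by move=> /(congr1 (@complex.Re R)) /= r1'; rewrite -r1' ltxx in r1.
have [B BP] : exists B, forall N, partial_gf (lattice_count q d.+1) r N <= B.
  exact: gf_lattice_bound.
rewrite -cvg_shiftS big_ord_recl expr0 mul1r.
have -> : \prod_(i < d) (1 - q%:R ^+ bump 0 i * t)^-1
    = \prod_(i < d) (1 - q%:R ^+ i * (q%:R * t))^-1.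
  by apply: eq_bigr => i _; rewrite /bump add1n exprSr mulrA.
have E N : partial_gf (lattice_count q d.+1) t N.+1 = (1 - t)^-1 *
   (partial_gf (lattice_count q d) (q%:R * t) N.+1 - t * ((lattice_count q d.+1 N)%:R * t ^+ N)).
  by rewrite mulrCA -exprS -gf_latticeS mulKf.
set P := \prod_(i < d) _.
have H : (fun N => (1 - t)^-1 * (partial_gf (lattice_count q d) (q%:R * t) N.+1
      - t * ((lattice_count q d.+1 N)%:R * t ^+ N)) : C^o) @ \oo
    --> ((1 - t)^-1 * (P - t * 0) : C^o).
  apply: cvgM; first exact: cvg_cst.
  apply: cvgB; last by apply: cvgM; [exact: cvg_cst|exact: gf_term0 tr BP].
  have {}IH := IH (q%:R * t) (q%:R * r).
  rewrite (cvg_shiftS (fun N => partial_gf (lattice_count q d) (q%:R * t) N : C^o)).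
  apply: IH; first by rewrite normrM normr_nat tr rmorphM rmorph_nat.
  by case: d rd {BP E P} => // d; rewrite exprSr mulrA => + _.
rewrite mulr0 subr0 in H; apply: cvg_trans H; apply: near_eq_cvg.
by apply: nearW => N; rewrite /= E.
Qed.

End Complex.

(** * Unconditional sums *)

Lemma sum_by_degree (F : pzRingType) (I : eqType) (deg : I -> nat) (A : seq I) (g : nat -> F) N :
  (forall i, i \in A -> (deg i < N)%N) ->
  \sum_(i <- A) g (deg i) = \sum_(n < N) (count (fun i => deg i == n) A)%:R * g n.
Proof.
elim: A => [|i A IH] degN.
  by rewrite big_nil big1 // => n _; rewrite mul0r.
rewrite big_cons IH; last by move=> j jA; apply: degN; rewrite in_cons jA orbT.
have -> : g (deg i) = \sum_(n < N) (deg i == n)%:R * g n.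
  rewrite (bigD1 (Ordinal (degN i (mem_head _ _)))) //= eqxx mul1r big1 ?addr0 // => n.
  by rewrite -(inj_eq val_inj) /= eq_sym => /negbTE ->; rewrite mul0r.
by rewrite -big_split; apply: eq_bigr => n _ /=; rewrite natrD mulrDl.
Qed.

Section Zeta.
Variable R : realType.
Local Notation C := (R[i]).

(** A finite set containing every index of degree less than N contributes the
    partial sum of length N, up to terms of degree at least N; these are
    bounded by the tail of the series of absolute values. *)
Lemma partial_sum_cvg (I : choiceType) (deg : I -> nat) (c : nat -> nat)
    (t S : C) (r B : R) :
  (forall n, has_card [set i | deg i = n] (c n)) -> `|t| = r%:C%C ->
  (forall N, partial_gf c r N <= B) ->
  (fun N => partial_gf c t N : C^o) @ \oo --> (S : C^o) ->
  partial_sum (fun i => t ^+ deg i : C^o) @ totally --> (S : C^o).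
Proof.
move=> cP tr cB cS; have r0 : 0 <= r by rewrite -(@ler0c R) -tr.
have := @totally_filter I => totally_filter.
apply/cvgrPdist_le => e /pos_complexE[eE e0]; rewrite eE.
set e' := complex.Re e in e0 *; have e2 : 0 < e' / 2 by rewrite divr_gt0.
have [N1 N1P] := gf_tail r0 cB e2.
have e2C : 0 < (e' / 2)%:C%C :> C by rewrite ltcR.
have /cvgrPdist_le/(_ _ e2C)[N2 _ N2P] := cS.
pose N := maxn N1 N2.
have /choice[en enP] n : exists s : seq I, [/\ uniq s, forall i, deg i = n <-> i \in s & size s = c n].
  by have [s [us sP] sn] := cP n; exists s.
exists [fset i in flatten [seq en n | n <- iota 0 N]]%fset => // A /= sA.
pose a n := count (fun i => deg i == n) A.
have aE n : a n = size [seq i <- A | deg i == n] by rewrite size_filter.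
have a_le n : (a n <= c n)%N.
  have [us sP <-] := enP n; rewrite aE; apply: uniq_leq_size.
    by rewrite filter_uniq // fset_uniq.
  by move=> i; rewrite mem_filter => /andP[/eqP/sP].
have a_eq n : (n < N)%N -> a n = c n.
  move=> ltnN; apply/eqP; rewrite eqn_leq a_le /=.
  have [us sP <-] := enP n; rewrite aE; apply: uniq_leq_size => // i ien.
  rewrite mem_filter; apply/andP; split; first by apply/eqP/sP.
  apply: (fsubsetP sA); rewrite inE; apply/flattenP; exists (en n) => //.
  by apply: map_f; rewrite mem_iota.
(* Any bound on the degrees that occur in A would do. *)
pose N' := (N + \sum_(i <- A) (deg i).+1)%N.
have degN' i : i \in (A : seq I) -> (deg i < N')%N.
  move=> iA; rewrite /N' (big_rem i) //=; lia.
rewrite /partial_sum -(big_seq_fsetE _ A xpredT (fun i => t ^+ deg i)) /=.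
rewrite (sum_by_degree (fun n => t ^+ n) degN').
rewrite -(big_mkord xpredT (fun n => (a n)%:R * t ^+ n)).
have leNN' : (N <= N')%N by rewrite leq_addr.
rewrite (big_cat_nat (leq0n _) leNN') /= big_mkord.
have -> : \sum_(n < N) (a n)%:R * t ^+ n = partial_gf c t N.
  by apply: eq_bigr => n _; rewrite a_eq.
rewrite opprD addrA; apply: le_trans (ler_normB _ _) _.
have -> : e'%:C%C = (e' / 2)%:C%C + (e' / 2)%:C%C :> C.
  by rewrite -rmorphD /= -splitr.
apply: lerD; first by apply: N2P; rewrite /= leq_maxr.
apply: le_trans (ler_norm_sum _ _ _) _.
have le_r : \sum_(N <= n < N') (a n)%:R * r ^+ n <= e' / 2.
  apply: le_trans (_ : \sum_(N <= n < N') (c n)%:R * r ^+ n <= _).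
    by apply: ler_sum => n _; rewrite ler_wpM2r ?exprn_ge0 // ler_nat.
  have leN1N' : (N1 <= N')%N by apply: leq_trans leNN'; rewrite leq_maxl.
  apply: le_trans (N1P _ leN1N').
  rewrite [X in _ <= X](big_cat_nat (leq_maxl N1 N2) leNN') /= lerDr.
  by apply: sumr_ge0 => n _; rewrite mulr_ge0 // exprn_ge0.
rewrite -lecR in le_r; apply: le_trans le_r; rewrite rmorph_sum.
apply: ler_sum => n _; rewrite normrM normr_nat normrX tr.
by rewrite rmorphM rmorphXn rmorph_nat.
Qed.

Lemma complex_expD (z w : C) : complex_exp (z + w) = complex_exp z * complex_exp w.
Proof.
rewrite /complex_exp; case: z w => [a b] [c e] /=.
rewrite expRD cosD sinD rmorphM /= mulrACA; congr (_ * _).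
by apply/eqP; rewrite eq_complex /= eqxx [X in _ == X]addrC eqxx.
Qed.

Lemma complex_expMn (z : C) n : complex_exp (z *+ n) = complex_exp z ^+ n.
Proof.
elim: n => [|n IH]; last by rewrite mulrS complex_expD IH exprS.
by rewrite mulr0n expr0 /complex_exp /= expR0 cos0 sin0 mul1r.
Qed.

Lemma norm_complex_exp (z : C) : `|complex_exp z| = (expR (complex.Re z))%:C%C.
Proof.
rewrite /complex_exp normrM !normc_def /= expr0n /= addr0 sqrtr_sqr.
by rewrite cos2Dsin2 sqrtr1 mulr1 ger0_norm // expR_ge0.
Qed.

Lemma natpowX q n (z : C) : (0 < q)%N -> natpow (q ^ n) z = natpow q z ^+ n.
Proof.
move=> q0; rewrite /natpow natrX lnXn ?ltr0n // -complex_expMn.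
by rewrite rmorphMn /= mulrnAr.
Qed.

Lemma norm_natpow q (z : C) : (0 < q)%N ->
  `|natpow q z| = (expR (complex.Re z * ln q%:R))%:C%C.
Proof.
by move=> q0; rewrite /natpow norm_complex_exp; case: z => a b /=; rewrite mulr0 subr0.
Qed.

(** The degree of N is the exponent e of its index q^e, and its term is
    (q^-s)^e. *)
Lemma zeta_cvg (A : pzRingType) (M : lmodType A) (q : nat) (c : nat -> nat)
    (s S : C) (r B : R) : (1 < q)%N ->
  (forall n, has_card [set N : set M | is_submodule N /\ has_index setT N (q ^ n)%N] (c n)) ->
  (forall (N : set M) n, is_submodule N -> has_index setT N n -> exists j, n = (q ^ j)%N) ->
  `|natpow q (- s)| = r%:C%C -> (forall N, partial_gf c r N <= B) ->
  (fun N => partial_gf c (natpow q (- s)) N : C^o) @ \oo --> (S : C^o) ->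
  partial_sum (@zeta_term R A M s) @ totally --> (S : C^o).
Proof.
move=> q_gt1 cP qP tr cB cS; set t := natpow q (- s) in tr cS *.
have q_gt0 : (0 < q)%N by exact: ltnW.
have /choice[deg degP] (N : @finite_index_submods A M) :
    exists j, has_index setT (val N) (q ^ j)%N.
  have [sN finN] : @finite_index_submods A M (val N) by exact: set_valP.
  have idx := fset_has_card finN.
  by have [j jE] := qP _ _ (iffLR (submod_closedE _) sN) idx; exists j; rewrite -jE.
have -> : @zeta_term R A M s = fun N => t ^+ deg N.
  apply/funext => N; rewrite /zeta_term (module_indexE (degP N)).2.
  exact: natpowX.
apply: (partial_sum_cvg _ tr cB cS) => n.
apply: (has_card_bij_inv (f := val) _ _ (cP n)) => [N N' _ _|N]; first exact: val_inj.
split=> [[sN idx]|[N' Nn <-]].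
  have NP : N \in @finite_index_submods A M.
    apply: mem_set; split; last exact: (module_indexE idx).1.
    by apply/submod_closedE.
  exists (SigSub NP) => //=; apply/eqP; rewrite -(@eqn_exp2l q) //; apply/eqP.
  exact: has_index_inj (degP (SigSub NP)) idx.
have [sN _] : @finite_index_submods A M (val N') by exact: set_valP.
split; first exact/submod_closedE.
by rewrite -Nn; exact: degP.
Qed.

End Zeta.

(** * The quotient of the two zeta functions *)

Section Convolution.
Variables (R : realType) (a b c : nat -> nat) (J : nat).
Hypothesis cE : (forall n, c n = \sum_(i < n.+1) a i * b (n - i))%N.
Hypothesis b0 : forall j, (J <= j)%N -> b j = 0%N.

Lemma gf_conv_bound (r B : R) : 0 <= r -> (forall N, partial_gf a r N <= B) ->
  exists B', forall N, partial_gf c r N <= B'.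
Proof.
move=> r0 aB; exists (\sum_(j < J) (b j)%:R * r ^+ j * B) => N.
have mono : partial_gf c r N <= partial_gf c r (N + J)%N.
  rewrite /partial_gf big_split_ord /= lerDl; apply: sumr_ge0 => i _.
  by rewrite mulr_ge0 // exprn_ge0.
apply: le_trans mono _; rewrite (gf_conv _ cE b0) ?leq_addl //.
by apply: ler_sum => j _; rewrite ler_wpM2l // mulr_ge0 // exprn_ge0.
Qed.

Lemma gf_conv_cvg (t E : R[i]) :
  (fun N => partial_gf a t N : R[i]^o) @ \oo --> (E : R[i]^o) ->
  (fun N => partial_gf c t N : R[i]^o) @ \oo --> ((\sum_(j < J) (b j)%:R * t ^+ j) * E : R[i]^o).
Proof.
move=> aE.
have H J' : (J' <= J)%N ->
    (fun N => \sum_(j < J') (b j)%:R * t ^+ j * partial_gf a t (N + J - j)%N : R[i]^o) @ \oo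
    --> ((\sum_(j < J') (b j)%:R * t ^+ j) * E : R[i]^o).
  elim: J' => [_|J' IH lt_J'J].
    rewrite big_ord0 mul0r; apply: cvg_near_cst; apply: nearW => N.
    by rewrite big_ord0.
  have shift : (fun N => partial_gf a t (N + J - J')%N : R[i]^o) @ \oo --> (E : R[i]^o).
    rewrite -(cvg_shiftn (J - J')) in aE; apply: cvg_trans aE.
    by apply: near_eq_cvg; apply: nearW => N /=; rewrite addnBA // ltnW.
  have H' : (fun N => \sum_(j < J') (b j)%:R * t ^+ j * partial_gf a t (N + J - j)%N
       + (b J')%:R * t ^+ J' * partial_gf a t (N + J - J')%N : R[i]^o) @ \oo
      --> ((\sum_(j < J') (b j)%:R * t ^+ j) * E + (b J')%:R * t ^+ J' * E : R[i]^o).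
    apply: cvgD; first exact: IH (ltnW lt_J'J).
    by apply: cvgM; [exact: cvg_cst|exact: shift].
  rewrite big_ord_recr /= mulrDl; apply: cvg_trans H'.
  by apply: near_eq_cvg; apply: nearW => N /=; rewrite big_ord_recr.
rewrite -(cvg_shiftn J).
apply: cvg_trans (H J (leqnn J)); apply: near_eq_cvg; apply: nearW => N /=.
by rewrite (gf_conv _ cE b0) ?leq_addl.
Qed.

End Convolution.

Theorem proposition9p5 (R : realType) (k : finFieldType) (m d : nat)
  (hm : (1 <= m)%N)
  (V : idomainType) (pi : V) (hV : dvr_with_residue_field pi k)
  (M : lmodType V) (hM : has_type pi [set: M]%classic (nseq d m))
  (s : R[i]) (hs : (0 < d)%N -> d%:R - 1 < complex.Re s) :
  let q := #|k| in
  let t := natpow q (- s) in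
  [/\ zeta_converges (Rtilde_d_cusp k m d) s,
      zeta_converges (Rtilde_d k d) s,
      zeta (Rtilde_d k d) s != 0
    & nu_cusp k m d s =
      \sum_(mu : d.-tuple 'I_m.+1 | sorted geq (map val mu))
        (skew_hall pi M (map val mu))%:R
          * (q%:R ^+ d * t) ^+ sumn (map val mu)].
Proof.
move=> q t.
have q_gt1 : (1 < q)%N by exact: card_field_gt1.
have q_gt0 : (0 < q)%N by exact: ltnW.
set r := expR (complex.Re (- s) * ln q%:R) : R.
have tr : `|t| = r%:C%C by exact: norm_natpow.
have r0 : 0 <= r by exact: expR_ge0.
have rd : (0 < d)%N -> q%:R ^+ d.-1 * r < 1.
  move=> d0; have lnq : 0 < ln (q%:R : R) by rewrite ln_gt0 // ltr1n.
  have -> : q%:R ^+ d.-1 = expR (d.-1%:R * ln q%:R) :> R.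
    by rewrite expRM_natl lnK // posrE ltr0n.
  rewrite -expRD -mulrDl expR_lt1 pmulr_llt0 //.
  have := hs d0; rewrite -{1}(prednK d0) -natr1 addrK.
  by case: (s) => x y /=; rewrite subr_lt0.
have [B BP] := gf_lattice_bound q_gt0 r0 rd.
pose E : R[i] := \prod_(i < d) (1 - q%:R ^+ i * t)^-1.
have cE : (fun N => partial_gf (lattice_count q d) t N : R[i]^o) @ \oo --> (E : R[i]^o).
  exact: gf_lattice_cvg q_gt0 tr rd.
have E0 : E != 0.
  apply/prodf_neq0 => i _; rewrite invr_eq0 subr_eq0; apply/eqP => /(congr1 Num.norm).
  rewrite normr1 normrM normrX normr_nat tr -(rmorph_nat (@real_complex R)).
  rewrite -rmorphXn -rmorphM => /(congr1 (@complex.Re R)) /= e.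
  have := rd (leq_ltn_trans (leq0n i) (ltn_ord i)).
  rewrite ltNge {1}e ler_wpM2r //= ler_weXn2l ?ler1n //.
  by rewrite -ltnS prednK // (leq_ltn_trans (leq0n i) (ltn_ord i)).
have FT := fun I : choiceType => @totally_filter I.
have zO : partial_sum (@zeta_term R _ (Rtilde_d k d) s) @ totally --> (E : R[i]^o).
  apply: (zeta_cvg q_gt1 _ _ tr BP cE) => [n|N n sN idx].
    exact: lattice_card (fps_dvr k) d n.
  have [a [_ nE _ _]] := lattice_cotype (fps_dvr k) sN idx.
  by exists (\sum_i a i)%N.
pose p j := (\sum_(mu : d.-tuple 'I_m.+1 | sorted geq (map val mu) && (sumn (map val mu) == j))
       skew_hall pi M (map val mu))%N.
pose b j := (p j * q ^ (d * j))%N.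
pose J := (m * d).+1.
have sumJ (mu : d.-tuple 'I_m.+1) : (sumn (map val mu) < J)%N.
  rewrite /J ltnS sumnE big_map big_tuple mulnC -[d in (d * _)%N]card_ord -sum_nat_const.
  by apply: leq_sum => i _; rewrite -ltnS; exact: ltn_ord.
have b0 j : (J <= j)%N -> b j = 0%N.
  move=> le; rewrite /b /p big_pred0 ?mul0n // => mu.
  by apply/negbTE; rewrite negb_and orbC neq_ltn (leq_trans (sumJ mu) le).
pose c n := (\sum_(i < n.+1) lattice_count q d i * b (n - i))%N.
have [B' BP'] := gf_conv_bound (c := c) (fun _ => erefl) b0 r0 BP.
have cusp_cvg := gf_conv_cvg (c := c) (fun _ => erefl) b0 cE.
set P := \sum_(j < J) _ in cusp_cvg.
have zR : partial_sum (@zeta_term R _ (Rtilde_d_cusp k m d) s) @ totally --> (P * E : R[i]^o).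
  apply: (zeta_cvg q_gt1 _ _ tr BP' cusp_cvg) => [n|N n /cusp_subP sN idx].
    have := cusp_card n (skew_hall_sum hm hV hM).
    by apply: has_card_eq => N /=; rewrite cusp_subP.
  have [i [j [nE _ _]]] := cusp_index_split sN idx.
  by exists (i + j)%N.
have zOE : zeta (Rtilde_d k d) s = E by exact: cvg_lim zO.
have zRE : zeta (Rtilde_d_cusp k m d) s = P * E by exact: cvg_lim zR.
split.
- exact: cvgP zR.
- exact: cvgP zO.
- by rewrite zOE.
rewrite /nu_cusp zOE zRE mulfK //.
rewrite (partition_big (fun mu : d.-tuple 'I_m.+1 => inord (sumn (map val mu)) : 'I_J) xpredT) //=.
apply: eq_bigr => j _; rewrite /b /p natrM natr_sum !mulr_suml.
apply: eq_big => [mu|mu /andP[_ /eqP ->]].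
  by rewrite -(inj_eq val_inj) /= inordK.
by rewrite [(_ ^+ d * t) ^+ _]exprMn -exprM natrX mulrA.
Qed.
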